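(* (1) For $n$ buyers with values drawn i.i.d. from a distribution $\mathcal{D}$ of support size $m$, the optimal (revenue-maximizing) pay-your-bid uniform auction with declining reserve can be found by a linear program of size $\mathrm{poly}(m)$. (2) There exist $2$-buyer instances (i.e. distributions $\mathcal{D}$ with $n=2$) in which the optimal $2$-buyer feasible auction has strictly larger revenue than the best pay-your-bid uniform auction with declining reserve.
   Context: Setting. There are $n$ buyers and $T$ rounds, one item per round; buyer $i$'s value $v_{it}$ in round $t$ is drawn independently from $\mathcal{D}$, with support $0\le w_1<\dots<w_m\le1$, $\Pr[w_j]=q_j$. A repeated auction consists of a finite set of arms (the same for all buyers and rounds) labelled by nonnegative bids, including $0$ and the values $w_1,\dots,w_m$, and for each round $t$ and vector $\vec b$ of arms an allocation probability $a_{i,t}(\vec b)\in[0,1]$ and a price $p_{i,t}(\vec b)\in[0,b_i a_{i,t}(\vec b)]$ for each buyer $i$, with $\sum_i a_{i,t}(\vec b)\le1$, invariance under permuting buyers, and $a_{i,t}(b_i;\vec b_{-i})$, $p_{i,t}(b_i;\vec b_{-i})$ nondecreasing in $b_i$. Pay-your-bid: $p_{i,t}(\vec b)=b_i\cdot a_{i,t}(\vec b)$ for all $i,t$. Uniform auction with declining reserve: (a) there is a reserve $r_t$ for every round $t$, monotonically decreasing in $t$, and (b) in each round the item is awarded to a uniformly random buyer among those with bid $b_{it}\ge r_t$. Buyers. Buyers are clever (never pull an arm with label above their current value) and mean-based. With $\sigma_{i,b,s}(v)=\sum_{t<s}\big(v\,a_{i,t}(b;\vec b_{-i,t})-p_{i,t}(b;\vec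 b_{-i,t})\big)$, a clever strategy is $\gamma$-mean-based if, among arms $b,b'\le v_{i,s}$, whenever $\sigma_{i,b,s}(v_{i,s})<\sigma_{i,b',s}(v_{i,s})-\gamma T$, arm $b$ is pulled in round $s$ with probability at most $\gamma$; clever strategies are moreover no-regret relative to strategies bidding a fixed function of the current value without overbidding. Feasible auctions. For strategies $S_1,\dots,S_n$, let $X^A_{ij},Y^A_{ij},U^A_{ij}$ be, respectively, the round-averaged expected allocation probability of buyer $i$ when his value is $w_j$, the round-averaged expected allocation probability of arm $w_j$ for buyer $i$, and the round-averaged expected utility of buyer $i$ when his value is $w_j$. An $n$-buyer feasible auction is a repeated auction $A$ for which there is a tuple $(x,y,u)$ such that for all $\gamma=o(1)$, whenever all buyers run clever $\gamma$-mean-based strategies, $X^A_{ij}=x_j\pm O(\gamma)$, $Y^A_{ij}=y_j\pm O(\gamma)$, $U^A_{ij}=u_j\pm O(\gamma)$ for all $i,j$. Optimality. ''Optimal''/''best'' refers to the seller's expected revenue when all buyers run $0$-regret (clever) algorithms; in terms of the tuple $(x,u)$ of the auction, the per-round revenue is $n\sum_j q_j(w_jx_j-u_j)$.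
   Formalization: ''For all γ=o(1)'' is read as rates not below order T^(-1/2), since smaller ones fail on first-round ties and sampling noise; ''optimal'' means the supremum of revenue over feasible auctions, approached within every ε, since the maximum need not be attained. *)

(* Defs.v *)
(* MathComp / MathComp-Analysis *)
From mathcomp Require Import all_boot all_order all_algebra perm.
From mathcomp Require Import all_classical all_reals all_analysis.

Set Implicit Arguments.
Unset Strict Implicit.
Unset Printing Implicit Defensive.

Import Order.TTheory GRing.Theory Num.Theory.
Import numFieldNormedType.Exports.

Local Open Scope classical_set_scope.
Local Open Scope ring_scope.

Record valdist (R : realType) (m : nat) := ValDist {
  val_of :> 'I_m -> R;
  prob_of : 'I_m -> R;
  val_ge0 : forall j, 0 <= val_of j;
  val_le1 : forall j, val_of j <= 1;
  val_lt : forall j k : 'I_m, (j < k)%N -> val_of j < val_of k;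
  prob_gt0 : forall j, 0 < prob_of j;
  prob_sum1 : \sum_(j < m) prob_of j = 1
}.

Notation bids n K := {ffun 'I_n -> 'I_K}.

(* (k; b_{-i}) *)
Definition deviate (n K : nat) (b : bids n K) (i : 'I_n) (k : 'I_K) : bids n K :=
  [ffun i' => if i' == i then k else b i'].

Definition permute_bids (n K : nat) (s : {perm 'I_n}) (b : bids n K) : bids n K :=
  [ffun i => b (s i)].

(* Asymptotic notions such as o(1) refer to the horizon T tending to infinity,
   so a repeated auction gives a rule for every horizon T; the finite set of
   arms does not depend on T.  In [alloc T t] and [pay T t] the argument t
   is the round, and only t < T matters. *)
Record auction (R : realType) (n m : nat) (w : 'I_m -> R) := Auction {
  arms : nat;
  label : 'I_arms -> R;
  zero_arm : 'I_arms;
  val_arm : 'I_m -> 'I_arms;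
  alloc : nat -> nat -> bids n arms -> 'I_n -> R;
  pay : nat -> nat -> bids n arms -> 'I_n -> R;
  label_inj : injective label;
  label_ge0 : forall k, 0 <= label k;
  label_zero : label zero_arm = 0;
  label_val : forall j, label (val_arm j) = w j;
  alloc_ge0 : forall T t b i, 0 <= alloc T t b i;
  alloc_le1 : forall T t b i, alloc T t b i <= 1;
  alloc_sum_le1 : forall T t b, \sum_(i < n) alloc T t b i <= 1;
  pay_ge0 : forall T t b i, 0 <= pay T t b i;
  pay_le : forall T t b i, pay T t b i <= label (b i) * alloc T t b i;
  alloc_perm : forall T t (s : {perm 'I_n}) b i,
    alloc T t (permute_bids s b) i = alloc T t b (s i);
  pay_perm : forall T t (s : {perm 'I_n}) b i,
    pay T t (permute_bids s b) i = pay T t b (s i);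
  alloc_mono : forall T t b i k k', label k <= label k' ->
    alloc T t (deviate b i k) i <= alloc T t (deviate b i k') i;
  pay_mono : forall T t b i k k', label k <= label k' ->
    pay T t (deviate b i k) i <= pay T t (deviate b i k') i
}.

Arguments arms {R n m w} A : rename.
Arguments label {R n m w} A k : rename.
Arguments zero_arm {R n m w} A : rename.
Arguments val_arm {R n m w} A j : rename.
Arguments alloc {R n m w} A T t b i : rename.
Arguments pay {R n m w} A T t b i : rename.

Definition pay_your_bid (R : realType) (n m : nat) (w : 'I_m -> R)
    (A : auction n w) : Prop :=
  forall T t b i, (t < T)%N ->
    pay A T t b i = label A (b i) * alloc A T t b i.

Definition uniform_declining_reserve (R : realType) (n m : nat) (w : 'I_m -> R)
    (A : auction n w) (r : nat -> nat -> R) : Prop :=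
  (forall T s t, (s <= t < T)%N -> r T t <= r T s) /\
  (forall T t b i, (t < T)%N ->
     alloc A T t b i =
       if r T t <= label A (b i)
       then (#|[set i' : 'I_n | r T t <= label A (b i')]%SET|%:R)^-1 else 0).

(* [pull hb hv j k] is the probability of pulling arm k when the current value
   is w_j, after a history made of the past bid vectors hb (oldest first) and
   of the buyer's own past values hv; the round is the length of hb. *)
Record strategy (R : realType) (n m K : nat) := Strategy {
  pull : seq (bids n K) -> seq 'I_m -> 'I_m -> 'I_K -> R;
  pull_ge0 : forall hb hv j k, 0 <= pull hb hv j k;
  pull_sum1 : forall hb hv j, \sum_(k < K) pull hb hv j k = 1
}.

Section Play.
Variables (R : realType) (n m : nat) (D : valdist R m) (A : auction n D).

Notation K := (arms A).
Notation strat := (strategy R n m K).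
(* values and arms of all buyers in one round *)
Notation round := ({ffun 'I_n -> 'I_m} * bids n K)%type.

Definition path_prob (T : nat) (S : 'I_n -> strat) (h : T.-tuple round) : R :=
  \prod_(t < T) \prod_(i < n)
    let past := take t h in
    let v := (tnth h t).1 i in
    prob_of D v *
    pull (S i) [seq e.2 | e : round <- past] [seq e.1 i | e : round <- past] v ((tnth h t).2 i).

Definition expect (T : nat) (S : 'I_n -> strat) (F : T.-tuple round -> R) : R :=
  \sum_(h : T.-tuple round) path_prob S h * F h.

(* utility of arm k for buyer i with value v, the others bidding as in b *)
Definition utility (T t : nat) (i : 'I_n) (v : R) (k : 'I_K) (b : bids n K) : R :=
  v * alloc A T t (deviate b i k) i - pay A T t (deviate b i k) i.

Definition cumul_utility (T : nat) (i : 'I_n) (k : 'I_K) (v : R)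
    (hb : seq (bids n K)) : R :=
  \sum_(t < size hb)
    utility T t i v k (nth [ffun=> zero_arm A] hb t).

Definition never_overbids (s : strat) : Prop :=
  forall hb hv j k, D j < label A k -> pull s hb hv j k = 0.

Definition mean_based (T : nat) (g : R) (i : 'I_n) (s : strat) : Prop :=
  forall hb hv j (k k' : 'I_K),
    (size hb < T)%N -> size hv = size hb ->
    label A k <= D j -> label A k' <= D j ->
    cumul_utility T i k (D j) hb < cumul_utility T i k' (D j) hb - g * T%:R ->
    pull s hb hv j k <= g.

Definition regret (T : nat) (i : 'I_n) (S : 'I_n -> strat) (f : 'I_m -> 'I_K) : R :=
  expect (T := T) S (fun h => \sum_(t < T)
    let e := tnth h t in
    (utility T t i (D (e.1 i)) (f (e.1 i)) e.2 -
     utility T t i (D (e.1 i)) (e.2 i) e.2)).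

(* The bound holds against arbitrary (adaptive) behaviour of the others. *)
Definition no_regret (i : 'I_n) (s : nat -> strat) : Prop :=
  exists rho : nat -> R, rho @ \oo --> 0 /\
    forall T (S : 'I_n -> strat) (f : 'I_m -> 'I_K),
      S i = s T -> (forall j, label A (f j) <= D j) ->
      regret T i S f <= rho T * T%:R.

Definition clever (i : 'I_n) (s : nat -> strat) : Prop :=
  (forall T, never_overbids (s T)) /\ no_regret i s.

(* In X and U, division by prob_of D j = Pr[v_it = w_j] turns the expectation
   restricted to the event v_it = w_j into the conditional one. *)
Definition avgX (T : nat) (S : 'I_n -> strat) (i : 'I_n) (j : 'I_m) : R :=
  (T%:R)^-1 * \sum_(t < T) (expect S (fun h : T.-tuple round =>
     let e := tnth h t in
     ((e.1 i == j)%:R * alloc A T t e.2 i)) / prob_of D j).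

Definition avgY (T : nat) (S : 'I_n -> strat) (i : 'I_n) (j : 'I_m) : R :=
  (T%:R)^-1 * \sum_(t < T) expect S (fun h : T.-tuple round =>
     alloc A T t (deviate (tnth h t).2 i (val_arm A j)) i).

Definition avgU (T : nat) (S : 'I_n -> strat) (i : 'I_n) (j : 'I_m) : R :=
  (T%:R)^-1 * \sum_(t < T) (expect S (fun h : T.-tuple round =>
     let e := tnth h t in
     ((e.1 i == j)%:R * (D j * alloc A T t e.2 i - pay A T t e.2 i)))
     / prob_of D j).

(* The averages above carry sampling and discretization errors, which do not
   vanish with gamma.  So gamma = o(1) ranges over rates that are not below
   the sampling scale T^(-1/2); a learner that is mean-based for a smaller
   rate is also mean-based for these. *)
Definition admissible_rate (gamma : nat -> R) : Prop :=
  [/\ forall T, 0 <= gamma T,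
      gamma @ \oo --> 0 &
      (fun T => (Num.sqrt (T%:R : R))^-1%R) =O_\oo gamma].

Definition feasible (x y u : 'I_m -> R) : Prop :=
  forall gamma : nat -> R, admissible_rate gamma ->
  forall S : nat -> 'I_n -> strat,
    (forall i, clever i (fun T => S T i)) ->
    (forall T i, mean_based T (gamma T) i (S T i)) ->
    forall i j,
      [/\ (fun T => avgX T (S T) i j - x j) =O_\oo gamma,
          (fun T => avgY T (S T) i j - y j) =O_\oo gamma &
          (fun T => avgU T (S T) i j - u j) =O_\oo gamma].

End Play.

Definition revenue (R : realType) (n m : nat) (D : valdist R m)
    (x u : 'I_m -> R) : R :=
  n%:R * \sum_(j < m) prob_of D j * (D j * x j - u j).

Definition feasible_revenues (R : realType) (n m : nat) (D : valdist R m) : set R :=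
  [set rev | exists (A : auction n D) (x y u : 'I_m -> R),
     feasible A x y u /\ rev = revenue n D x u].

Definition pyb_declining_revenues (R : realType) (n m : nat) (D : valdist R m) :
    set R :=
  [set rev | exists (A : auction n D) (r : nat -> nat -> R) (x y u : 'I_m -> R),
     [/\ pay_your_bid A, uniform_declining_reserve A r,
         feasible A x y u & rev = revenue n D x u]].

(* Suprema, since prices must stay strictly below values for buyers not to be
   indifferent, so that the optimum is in general only approached. *)
Definition optimal_feasible_revenue (R : realType) (n m : nat) (D : valdist R m) :
    \bar R :=
  ereal_sup [set rev%:E | rev in feasible_revenues n D].

Definition optimal_pyb_declining_revenue (R : realType) (n m : nat)
    (D : valdist R m) : \bar R :=
  ereal_sup [set rev%:E | rev in pyb_declining_revenues n D].

(* asymptotically, a fraction l k of the rounds has a reserve for which w_k is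
   the lowest value not below it *)
Definition reserve_schedule (R : realType) (m : nat) (w : 'I_m -> R)
    (r : nat -> nat -> R) (l : 'I_m -> R) : Prop :=
  forall k : 'I_m,
    (fun T => (T%:R)^-1 * (#|[set t : 'I_T | (r T t <= w k) &&
         [forall j : 'I_m, (j < k)%N ==> (w j < r T t)]]%SET|%:R : R))
    @ \oo --> l k.

(* Arithmetic expressions in the instance data: number n of buyers, values w_j
   and probabilities q_j; [EPow e] is the n-th power of e. *)
Inductive expr (m : nat) : Type :=
| EOne | EBuyers | EVal of 'I_m | EProb of 'I_m
| EAdd of expr m & expr m | EOpp of expr m
| EMul of expr m & expr m | EInv of expr m | EPow of expr m.

Fixpoint expr_size (m : nat) (e : expr m) : nat :=
  match e with
  | EOne | EBuyers | EVal _ | EProb _ => 1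
  | EAdd e1 e2 | EMul e1 e2 => (expr_size e1 + expr_size e2).+1
  | EOpp e1 | EInv e1 | EPow e1 => (expr_size e1).+1
  end.

Fixpoint expr_eval (R : realType) (m n : nat) (D : valdist R m) (e : expr m) : R :=
  match e with
  | EOne => 1
  | EBuyers => n%:R
  | EVal j => D j
  | EProb j => prob_of D j
  | EAdd e1 e2 => expr_eval n D e1 + expr_eval n D e2
  | EOpp e1 => - expr_eval n D e1
  | EMul e1 e2 => expr_eval n D e1 * expr_eval n D e2
  | EInv e1 => (expr_eval n D e1)^-1
  | EPow e1 => expr_eval n D e1 ^+ n
  end.

(* Linear program "maximize c z subject to M z <= b" whose coefficients are
   expressions in the instance; only m is fixed, so that no information on the
   distribution can be hidden in the program.  The variables [lp_sched] give
   the fractions of rounds spent at each reserve level. *)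
Record lp_template (m : nat) := LPTemplate {
  lp_vars : nat;
  lp_rows : nat;
  lp_obj : 'I_lp_vars -> expr m;
  lp_mat : 'I_lp_rows -> 'I_lp_vars -> expr m;
  lp_rhs : 'I_lp_rows -> expr m;
  lp_sched : 'I_m -> 'I_lp_vars
}.

(* total length of the description *)
Definition lp_size (m : nat) (L : lp_template m) : nat :=
  (lp_vars L + lp_rows L
   + \sum_(c < lp_vars L) expr_size (lp_obj c)
   + \sum_(r < lp_rows L) \sum_(c < lp_vars L) expr_size (lp_mat r c)
   + \sum_(r < lp_rows L) expr_size (lp_rhs r))%N.

Section LP.
Variables (R : realType) (m n : nat) (D : valdist R m) (L : lp_template m).

Definition lp_value (z : 'I_(lp_vars L) -> R) : R :=
  \sum_c expr_eval n D (lp_obj c) * z c.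

Definition lp_feasible (z : 'I_(lp_vars L) -> R) : Prop :=
  forall r : 'I_(lp_rows L),
    \sum_c expr_eval n D (lp_mat r c) * z c <= expr_eval n D (lp_rhs r).

Definition lp_optimal (z : 'I_(lp_vars L) -> R) : Prop :=
  lp_feasible z /\ forall z', lp_feasible z' -> lp_value z' <= lp_value z.

End LP.

(* The program L finds the optimal auction: it has an optimal solution, its
   value is the optimal revenue, and the reserve schedule read off any optimal
   solution is the one of auctions of revenue arbitrarily close to optimal. *)
Definition lp_finds_optimal_auction (R : realType) (m n : nat) (D : valdist R m)
    (L : lp_template m) : Prop :=
  (exists z, lp_optimal n D (L := L) z) /\
  forall z, lp_optimal n D (L := L) z ->
    optimal_pyb_declining_revenue n D = (lp_value n D z)%:E /\
    forall eps : R, 0 < eps ->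
      exists (A : auction n D) (r : nat -> nat -> R) (x y u : 'I_m -> R),
        [/\ pay_your_bid A, uniform_declining_reserve A r, feasible A x y u,
            reserve_schedule D r (fun k => z (lp_sched L k)) &
            lp_value n D z - eps <= revenue n D x u].

(* Main.v *)
(* Upper bound: let every buyer run Hedge with a prior favouring the arm of the
   current value.  When prices are bids and the reserve declines, the arms below
   the current reserve have earned exactly 0, like the arm of the own value; so
   the prior makes every buyer whose value meets the reserve bid at least the
   reserve, up to probability o(1).  Hence the allocations x are those of a
   uniform lottery among the values above the reserve, a linear function of the
   fractions l_k of rounds at each reserve level, and the absence of regret gives
   sum_j q_j u_j >= sum_j q_j max_k (w_j - w_k) x_k - o(1).  These are the
   constraints of the linear program.

   Lower bound: put the level-k reserve slightly below w_k, so that no buyer is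
   indifferent.  The cumulative utilities of two arms that matter then drift
   apart at a constant rate, so they are within gamma T of each other in only
   O(gamma T) rounds; in the others a mean-based buyer follows the leader.  His
   utility telescopes to that of the best arm in hindsight, which concentrates
   by a second moment bound.

   For the separation take n = 2 and values 3/4 and 1 with probability 1/2.  The
   program has value 3/4.  Giving the item to the higher of two different bids
   with probability 3/4, at prices making the arm of one's own value strictly
   dominant in every round, yields 97/128. *)

Require Import Defs.
From mathcomp Require Import all_boot all_order all_algebra perm.
From mathcomp Require Import all_classical all_reals all_analysis.
From mathcomp Require Import ring lra zify.

Set Implicit Arguments.
Unset Strict Implicit.
Unset Printing Implicit Defensive.

Import Order.TTheory GRing.Theory Num.Theory.
Import numFieldNormedType.Exports.

Local Open Scope classical_set_scope.
Local Open Scope ring_scope.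

(** * Expectations over plays *)

(** A feasible auction has one tuple (x, y, u) for all admissible learners, so evaluating a single
    profile of learners pins it down; this is why the upper bound may choose its learner. The
    reserves of a given auction may vary with the horizon in any way, so their level fractions need
    not converge. The upper bound therefore reads the schedule off one large finite horizon, with an
    error that is uniform over all deviations, and lets the tolerance tend to 0 only in the
    comparison with the program.

    In the lower bound the bids depend on the history in an uncontrolled way, while the values are
    fresh in every round. In a uniform auction only the side of the reserve on which a bid falls
    affects who may win. So every average is first rewritten as if each bid lay on the same side as
    the value, at the price of the expected number of violations, [mismatch]; after that only
    independent values remain. Both bounds share this reduction and differ in how they control the
    violations. *)

(* [get] and [upd] read and overwrite one coordinate of [e].  The involution
   (e, a) |-> (upd e a, get e) preserves the weight. *)
Lemma resample (R : comNzRingType) (E B : finType) (get : E -> B)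
    (upd : E -> B -> E) (rest : E -> R) (P : B -> R) (F : E -> R) :
    (forall e a, upd (upd e a) (get e) = e) ->
    (forall e a, get (upd e a) = a) ->
    (forall e a, rest (upd e a) = rest e) ->
    \sum_a P a = 1 ->
  \sum_e rest e * P (get e) * F e =
  \sum_e rest e * P (get e) * \sum_a P a * F (upd e a).
Proof.
move=> updK getK restK P1.
transitivity (\sum_(p : E * B) rest p.1 * P (get p.1) * P p.2 * F p.1).
  rewrite -(pair_bigA _ (fun e a => rest e * P (get e) * P a * F e)) /=.
  apply: eq_bigr => e _; rewrite -big_distrl -big_distrr /= P1; ring.
pose phi (p : E * B) := (upd p.1 p.2, get p.1).
have phiK : involutive phi by case=> e a; rewrite /phi /= updK getK.
rewrite (reindex_inj (inv_inj phiK)) /=.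
rewrite -(pair_bigA _ (fun e a => rest (upd e a) * P (get (upd e a)) *
  P (get e) * F (upd e a))) /=.
apply: eq_bigr => e _; rewrite big_distrr /=; apply: eq_bigr => a _.
rewrite restK getK; ring.
Qed.

(** The probabilities sum to 1, so m is positive. The element is a default in [round0] and an index
    of the repeated row of the linear program. *)
Definition some_value (R : realType) (m : nat) (D : valdist R m) : 'I_m.
Proof.
case: m D => [D|m D]; last exact: ord0.
by exfalso; move: (prob_sum1 D); rewrite big_ord0; apply/eqP; rewrite eq_sym oner_neq0.
Defined.

Section Process.
Variables (R : realType) (n m : nat) (D : valdist R m) (A : auction n D).

Notation K := (arms A).
Notation strat := (strategy R n m K).
Notation round := ({ffun 'I_n -> 'I_m} * bids n K)%type.

Definition bids_of (h : seq round) : seq (bids n K) := [seq e.2 | e <- h].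

Definition pull_after (S : 'I_n -> strat) (h : seq round) (i : 'I_n) a k : R :=
  pull (S i) (bids_of h) [seq e.1 i | e : round <- h] a k.

Definition step_prob (S : 'I_n -> strat) (h : seq round) (e : round) : R :=
  \prod_(i < n) (prob_of D (e.1 i) * pull_after S h i (e.1 i) (e.2 i)).

Definition Estep S h (F : round -> R) : R := \sum_e step_prob S h e * F e.

(** Peeling off the last round puts the conditional expectation given the past innermost, so claims
    about whole plays reduce to claims about [Estep], however the strategies use the history. *)
Fixpoint Ex S (T : nat) (F : seq round -> R) : R :=
  if T is T'.+1 then Ex S T' (fun h => Estep S h (fun e => F (rcons h e)))
  else F [::].

Definition round0 : round := ([ffun=> some_value D], [ffun=> zero_arm A]).

(** Additive functional of a play: a summand sees the past and the current round. The default
    [round0] is never reached. *)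
Definition cum (f : seq round -> round -> R) (h : seq round) : R :=
  \sum_(0 <= s < size h) f (take s h) (nth round0 h s).

Lemma cum_nil f : cum f [::] = 0.
Proof. by rewrite /cum big_nil. Qed.

Lemma cum_rcons f h e : cum f (rcons h e) = cum f h + f h e.
Proof.
rewrite /cum size_rcons big_nat_recr //=; congr (_ + f _ _); last first.
- by rewrite nth_rcons ltnn eqxx.
- by rewrite -cats1 take_size_cat.
apply: eq_big_nat => s /andP[_ sh].
by rewrite nth_rcons sh -cats1 takel_cat // ltnW.
Qed.

(** Appending a round is a bijection between pairs of a play and a round and longer plays, and the
    path probability factors along it. *)
Lemma expectE T S (F : seq round -> R) :
  expect (T := T) S (fun h => F h) = Ex S T F.
Proof.
rewrite /expect; elim: T F => [|T IH] F /=.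
  rewrite (big_pred1 [tuple]) => [|h]; last by apply/esym/eqP; exact: tuple0.
  by rewrite /path_prob big_ord0 mul1r.
rewrite -IH.
pose phi (p : T.-tuple round * round) : T.+1.-tuple round := [tuple of rcons p.1 p.2].
have phi_bij : bijective phi.
  apply: inj_card_bij; last by rewrite card_prod !card_tuple expnSr.
  move=> [h e] [h' e'] /(congr1 val) /= /rcons_inj [hh' ->].
  by congr pair; apply: val_inj.
rewrite (reindex phi); last exact: onW_bij.
rewrite -(pair_bigA _ (fun h e => path_prob S (phi (h, e)) * F (phi (h, e)))) /=.
apply: eq_bigr => h _; rewrite /Estep big_distrr /=; apply: eq_bigr => e _.
rewrite mulrA; congr (_ * _).
rewrite /path_prob big_ord_recr /=; congr (_ * _).
  apply: eq_bigr => t _; apply: eq_bigr => i _ /=.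
  have tT : (t < size h)%N by rewrite size_tuple.
  rewrite -cats1 takel_cat ?(ltnW tT) //.
  have -> : tnth (phi (h, e)) (widen_ord (leqnSn T) t) = tnth h t.
    by rewrite !(tnth_nth e) /= nth_rcons tT.
  by [].
rewrite /step_prob; apply: eq_bigr => i _ /=.
have -> : tnth (phi (h, e)) ord_max = e.
  by rewrite (tnth_nth e) /= nth_rcons size_tuple ltnn eqxx.
by rewrite -cats1 take_size_cat ?size_tuple.
Qed.

Lemma sum_expect_cum T S (f : nat -> round -> R) :
  \sum_(t < T) expect S (fun h : T.-tuple round => f t (tnth h t)) =
  Ex S T (cum (fun h => f (size h))).
Proof.
rewrite -expectE /expect exchange_big /=; apply: eq_bigr => h _.
rewrite -big_distrr /=; congr (_ * _).
rewrite /cum size_tuple big_mkord; apply: eq_bigr => t _.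
by rewrite size_takel ?size_tuple ?(ltnW (ltn_ord t)) // (tnth_nth round0).
Qed.

Lemma pull_after_ge0 S h i a k : 0 <= pull_after S h i a k.
Proof. exact: pull_ge0. Qed.

Lemma pull_after_sum1 S h i a : \sum_k pull_after S h i a k = 1.
Proof. exact: pull_sum1. Qed.

Lemma step_prob_ge0 S h e : 0 <= step_prob S h e.
Proof.
by apply: prodr_ge0 => i _; rewrite mulr_ge0 ?pull_after_ge0 // ltW ?prob_gt0.
Qed.

Definition Evals (F : {ffun 'I_n -> 'I_m} -> R) : R :=
  \sum_(v : {ffun 'I_n -> 'I_m}) (\prod_(i < n) prob_of D (v i)) * F v.

(** The pull probabilities of each buyer sum to 1, so the bids integrate out: the values of a round
    are independent of the past and of the strategies. *)
Lemma Estep_vals S h (F : {ffun 'I_n -> 'I_m} -> R) :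
  Estep S h (fun e => F e.1) = Evals F.
Proof.
rewrite /Estep /Evals -(pair_bigA _ (fun v b => step_prob S h (v, b) * F v)) /=.
apply: eq_bigr => v _; rewrite -big_distrl /=; congr (_ * _).
under eq_bigr do rewrite /step_prob big_split /=.
rewrite -big_distrr /=.
transitivity (\prod_(i < n) prob_of D (v i) *
  \prod_(i < n) \sum_k pull_after S h i (v i) k).
  by congr (_ * _); rewrite bigA_distr_bigA.
by rewrite [X in _ * X]big1 ?mulr1 // => i _; rewrite pull_after_sum1.
Qed.

Lemma Evals_const c : Evals (fun _ => c) = c.
Proof.
rewrite /Evals -big_distrl /= -(bigA_distr_bigA (fun _ : 'I_n => prob_of D)) /=.
by rewrite big1 ?mul1r // => i _; rewrite prob_sum1.
Qed.

Lemma Estep_const S h c : Estep S h (fun _ => c) = c.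
Proof. by rewrite (Estep_vals S h (fun _ => c)) Evals_const. Qed.

Lemma EstepD S h F G : Estep S h (fun e => F e + G e) = Estep S h F + Estep S h G.
Proof. by rewrite /Estep -big_split; apply: eq_bigr => e _; rewrite mulrDr. Qed.

Lemma EstepZ S h c F : Estep S h (fun e => c * F e) = c * Estep S h F.
Proof. by rewrite /Estep big_distrr; apply: eq_bigr => e _; rewrite mulrCA. Qed.

Lemma Estep_sum S h (I : finType) (P : pred I) (F : I -> round -> R) :
  Estep S h (fun e => \sum_(i | P i) F i e) = \sum_(i | P i) Estep S h (F i).
Proof.
by rewrite /Estep exchange_big; apply: eq_bigr => e _; rewrite big_distrr.
Qed.

Lemma Estep_le S h F G : (forall e, F e <= G e) -> Estep S h F <= Estep S h G.
Proof. by move=> FG; apply: ler_sum => e _; rewrite ler_wpM2l ?step_prob_ge0. Qed.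

Lemma eq_Estep S h F G : (forall e, F e = G e) -> Estep S h F = Estep S h G.
Proof. by move=> FG; apply: eq_bigr => e _; rewrite FG. Qed.

Lemma Ex_le S T F G : (forall h, size h = T -> F h <= G h) -> Ex S T F <= Ex S T G.
Proof.
elim: T F G => [|T IH] F G FG /=; first exact: FG.
by apply: IH => h sh; apply: Estep_le => e; apply: FG; rewrite size_rcons sh.
Qed.

Lemma eq_Ex S T F G : (forall h, size h = T -> F h = G h) -> Ex S T F = Ex S T G.
Proof.
by move=> FG; apply: le_anti; rewrite !Ex_le // => h sh; rewrite FG.
Qed.

Lemma ExD S T F G : Ex S T (fun h => F h + G h) = Ex S T F + Ex S T G.
Proof.
elim: T F G => [|T IH] F G //=; rewrite -IH; apply: eq_Ex => h _.
exact: EstepD.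
Qed.

Lemma ExZ S T c F : Ex S T (fun h => c * F h) = c * Ex S T F.
Proof.
elim: T F => [|T IH] F //=; rewrite -IH; apply: eq_Ex => h _; exact: EstepZ.
Qed.

Lemma Ex_const S T c : Ex S T (fun _ => c) = c.
Proof.
elim: T => [|T IH] //=; rewrite -[RHS]IH; apply: eq_Ex => h _; exact: Estep_const.
Qed.

Lemma Ex_sum S T (I : finType) (P : pred I) (F : I -> seq round -> R) :
  Ex S T (fun h => \sum_(i | P i) F i h) = \sum_(i | P i) Ex S T (F i).
Proof.
elim: T F => [|T IH] F //=; rewrite -IH; apply: eq_Ex => h _; exact: Estep_sum.
Qed.

Lemma ExB S T F G : Ex S T (fun h => F h - G h) = Ex S T F - Ex S T G.
Proof.
rewrite (@eq_Ex S T _ (fun h => F h + -1 * G h)); last by move=> *; ring.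
by rewrite ExD ExZ mulN1r.
Qed.

Lemma Ex_norm S T F : `|Ex S T F| <= Ex S T (fun h => `|F h|).
Proof.
rewrite ler_norml -mulN1r -ExZ; apply/andP; split; apply: Ex_le => h _.
  by rewrite mulN1r lerNl -normrN ler_norm.
exact: ler_norm.
Qed.

Lemma Ex_cumS S T f :
  Ex S T.+1 (cum f) = Ex S T (cum f) + Ex S T (fun h => Estep S h (f h)).
Proof.
rewrite -ExD /=; apply: eq_Ex => h _.
under eq_Estep do rewrite cum_rcons.
by rewrite EstepD Estep_const.
Qed.

(** By linearity over rounds, it is enough to compare conditional expectations given the past; the
    summands themselves need not be ordered. *)
Lemma Ex_cum_le S T f g :
    (forall h, (size h < T)%N -> Estep S h (f h) <= Estep S h (g h)) ->
  Ex S T (cum f) <= Ex S T (cum g).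
Proof.
elim: T => [|T IH] fg; first by rewrite /= !cum_nil.
rewrite !Ex_cumS lerD //; first by apply: IH => h sh; apply: fg; rewrite ltnW.
by apply: Ex_le => h sh; apply: fg; rewrite sh.
Qed.

Lemma Ex_cum_eq S T f g :
    (forall h, (size h < T)%N -> Estep S h (f h) = Estep S h (g h)) ->
  Ex S T (cum f) = Ex S T (cum g).
Proof.
by move=> fg; apply: le_anti; rewrite !Ex_cum_le // => h sh; rewrite fg.
Qed.

Lemma cumD f g h : cum (fun h e => f h e + g h e) h = cum f h + cum g h.
Proof. by rewrite /cum -big_split. Qed.

Lemma cumZ c f h : cum (fun h e => c * f h e) h = c * cum f h.
Proof. by rewrite /cum big_distrr. Qed.

Lemma cum_sum (I : finType) (P : pred I) (F : I -> seq round -> round -> R) h :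
  cum (fun h e => \sum_(i | P i) F i h e) h = \sum_(i | P i) cum (F i) h.
Proof. by rewrite /cum exchange_big. Qed.

Lemma cum_le f g h :
    (forall h' e, (size h' < size h)%N -> f h' e <= g h' e) ->
  cum f h <= cum g h.
Proof.
move=> fg; rewrite /cum !big_mkord; apply: ler_sum => s _; apply: fg.
by rewrite size_take ltn_ord.
Qed.

Lemma cum_time (f : nat -> R) h :
  cum (fun h _ => f (size h)) h = \sum_(s < size h) f s.
Proof.
rewrite /cum big_mkord; apply: eq_bigr => s _.
by rewrite size_take ltn_ord.
Qed.

Lemma Ex_cum_time S T (f : nat -> R) :
  Ex S T (cum (fun h _ => f (size h))) = \sum_(s < T) f s.
Proof.
rewrite -[RHS](Ex_const S T); apply: eq_Ex => h <-; exact: cum_time.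
Qed.

Definition set_coord (T : finType) (v : {ffun 'I_n -> T}) (i : 'I_n) (a : T) :=
  [ffun i' => if i' == i then a else v i'].

Lemma prod_set_coord (T : finType) (G : 'I_n -> T -> R) v i a :
  \prod_(i' | i' != i) G i' (set_coord v i a i') = \prod_(i' | i' != i) G i' (v i').
Proof. by apply: eq_bigr => i' /negPf ni; rewrite ffunE ni. Qed.

Lemma set_coordK (T : finType) (v : {ffun 'I_n -> T}) i a :
  set_coord (set_coord v i a) i (v i) = v.
Proof. by apply/ffunP => i'; rewrite !ffunE; case: eqP => [->|]. Qed.

Lemma set_coord_eq (T : finType) (v : {ffun 'I_n -> T}) i a : set_coord v i a i = a.
Proof. by rewrite ffunE eqxx. Qed.

Lemma Evals_resample i F :
  Evals F = Evals (fun v => \sum_a prob_of D a * F (set_coord v i a)).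
Proof.
rewrite /Evals.
transitivity (\sum_(v : {ffun 'I_n -> 'I_m})
  \prod_(i' | i' != i) prob_of D (v i') * prob_of D (v i) * F v).
  by apply: eq_bigr => v _; rewrite [in LHS](bigD1 i) //= (mulrC (prob_of _ _)).
rewrite (@resample _ _ _ (fun v : {ffun 'I_n -> 'I_m} => v i)
  (fun v a => set_coord v i a) _ (prob_of D)) ?prob_sum1 //.
- by apply: eq_bigr => v _; rewrite [in RHS](bigD1 i) //= (mulrC (prob_of _ _)).
- by move=> v a; exact: set_coordK.
- by move=> v a; exact: set_coord_eq.
- by move=> v a; apply: (prod_set_coord (fun _ => prob_of D)).
Qed.

Definition set_buyer (e : round) (i : 'I_n) a k : round :=
  (set_coord e.1 i a, deviate e.2 i k).

(** Given the past the buyers act independently, so the value and arm of one buyer may be redrawn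
    while the others are kept. *)
Lemma Estep_resample S h i F :
  Estep S h F = Estep S h (fun e => \sum_a prob_of D a *
    \sum_k pull_after S h i a k * F (set_buyer e i a k)).
Proof.
rewrite /Estep.
pose P (p : 'I_m * 'I_K) := prob_of D p.1 * pull_after S h i p.1 p.2.
pose rest (e : round) := \prod_(i' | i' != i)
  (prob_of D (e.1 i') * pull_after S h i' (e.1 i') (e.2 i')).
have stepE e : step_prob S h e = rest e * P (e.1 i, e.2 i).
  by rewrite /step_prob (bigD1 i) //= mulrC.
transitivity (\sum_(e : round) rest e * P (e.1 i, e.2 i) * F e).
  by apply: eq_bigr => e _; rewrite stepE.
rewrite (@resample _ _ _ (fun e : round => (e.1 i, e.2 i))
  (fun e p => set_buyer e i p.1 p.2) rest P).
- apply: eq_bigr => e _; rewrite stepE; congr (_ * _).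
  rewrite -(pair_bigA _ (fun a k => P (a, k) * F (set_buyer e i a k))) /=.
  apply: eq_bigr => a _; rewrite big_distrr; apply: eq_bigr => k _ /=.
  by rewrite mulrA.
- by move=> [v b] [a k]; rewrite /set_buyer /= set_coordK; congr pair;
     exact: set_coordK.
- by move=> [v b] [a k]; rewrite /set_buyer /= set_coord_eq ffunE eqxx.
- move=> [v b] [a k]; apply: eq_bigr => i' /negPf ni /=.
  by rewrite /set_coord !ffunE ni.
- rewrite -(pair_bigA _ (fun a k => P (a, k))) /= -(prob_sum1 D).
  apply: eq_bigr => a _.
  by rewrite /P /= -big_distrr /= pull_after_sum1 mulr1.
Qed.

Lemma Estep_own S h i (F : 'I_m -> 'I_K -> R) :
  Estep S h (fun e => F (e.1 i) (e.2 i)) =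
  \sum_a prob_of D a * \sum_k pull_after S h i a k * F a k.
Proof.
rewrite (Estep_resample S h i) -[RHS](Estep_const S h); apply: eq_Estep => e.
by do 2![apply: eq_bigr => ? _; congr (_ * _)]; rewrite /= !ffunE eqxx.
Qed.

Lemma Ex_cumB S T f g :
  Ex S T (cum (fun h e => f h e - g h e)) = Ex S T (cum f) - Ex S T (cum g).
Proof. by rewrite -ExB; apply: eq_Ex => h _; rewrite /cum sumrB. Qed.

Lemma regretE T S (i : 'I_n) (f : 'I_m -> 'I_K) : regret T i S f =
  Ex S T (cum (fun h e => utility T (size h) i (D (e.1 i)) (f (e.1 i)) e.2)) -
  Ex S T (cum (fun h e => utility T (size h) i (D (e.1 i)) (e.2 i) e.2)).
Proof.
rewrite -Ex_cumB -(sum_expect_cum T S (fun t (e : round) =>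
  utility T t i (D (e.1 i)) (f (e.1 i)) e.2 -
  utility T t i (D (e.1 i)) (e.2 i) e.2)).
rewrite /regret /expect exchange_big; apply: eq_bigr => h _.
by rewrite big_distrr.
Qed.

(** Orthogonality of the increments bounds the second moment by T. The passage to the first moment
    uses s|x| <= (x^2 + s^2)/2, with s the square root of T, in place of the Cauchy-Schwarz
    inequality. *)
Lemma Ex_martingale_norm S T (phi : seq round -> round -> R) : (0 < T)%N ->
    (forall h, (size h < T)%N -> Estep S h (phi h) = 0) ->
    (forall h e, `|phi h e| <= 1) ->
  Ex S T (fun h => `|cum phi h|) <= Num.sqrt T%:R.
Proof.
move=> T0 phi0 phi1.
have sq t : (t <= T)%N -> Ex S t (fun h => cum phi h ^+ 2) <= t%:R.
  elim: t => [|t IH] tT; first by rewrite /= cum_nil expr0n.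
  apply: le_trans (_ : Ex S t (fun h => cum phi h ^+ 2 + 1) <= _); last first.
    by rewrite ExD Ex_const -natr1 lerD2r IH // ltnW.
  rewrite [leLHS]/=; apply: Ex_le => h sh; rewrite -sh in tT.
  apply: le_trans (_ : Estep S h (fun e => cum phi h ^+ 2 + 2 * cum phi h * phi h e + 1) <= _).
    apply: Estep_le => e; rewrite cum_rcons sqrrD -[_ *+ 2]mulr_natl mulrA lerD2l.
    by rewrite -[phi h e ^+ 2]real_normK ?num_real // exprn_ile1.
  by rewrite !EstepD EstepZ !Estep_const phi0 // mulr0 addr0.
set s := Num.sqrt T%:R; have rT : 0 < s by rewrite sqrtr_gt0 ltr0n.
have rT2 : s ^+ 2 = T%:R by rewrite sqr_sqrtr ?ler0n.
rewrite -(ler_pM2l rT) -ExZ -expr2 rT2.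
apply: le_trans (_ : Ex S T (fun h => 2^-1 * cum phi h ^+ 2 + 2^-1 * T%:R) <= _).
  apply: Ex_le => h _; rewrite -[cum phi h ^+ 2]real_normK ?num_real // -rT2.
  by have := sqr_ge0 (s - `|cum phi h|); rewrite sqrrB; lra.
rewrite ExD ExZ Ex_const; have := sq T (leqnn T); lra.
Qed.

Lemma cumul_utility_rcons T (i : 'I_n) (k : 'I_K) (v : R) (hb : seq (bids n K)) b :
  cumul_utility T i k v (rcons hb b) =
  cumul_utility T i k v hb + utility T (size hb) i v k b.
Proof.
rewrite /cumul_utility size_rcons big_ord_recr /= nth_rcons ltnn eqxx.
by congr (_ + _); apply: eq_bigr => s _; rewrite nth_rcons ltn_ord.
Qed.

Lemma cumul_utility_nil T (i : 'I_n) (k : 'I_K) (v : R) : cumul_utility T i k v [::] = 0.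
Proof. by rewrite /cumul_utility big_ord0. Qed.

Lemma cumul_utilityE T (i : 'I_n) (k : 'I_K) (v : R) (h : seq round) :
  cumul_utility T i k v (bids_of h) =
  cum (fun h e => utility T (size h) i v k e.2) h.
Proof.
elim/last_ind: h => [|h e IH]; first by rewrite cumul_utility_nil cum_nil.
by rewrite /bids_of map_rcons cumul_utility_rcons cum_rcons IH size_map.
Qed.

Lemma deviate_deviate (b : bids n K) i k k' : deviate (deviate b i k) i k' = deviate b i k'.
Proof. by apply/ffunP => i'; rewrite !ffunE; case: eqP. Qed.

Lemma deviate_id (b : bids n K) i : deviate b i (b i) = b.
Proof. by apply/ffunP => i'; rewrite !ffunE; case: eqP => [->|]. Qed.

Lemma utility_deviate T t (i : 'I_n) (v : R) (k k' : 'I_K) (b : bids n K) :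
  utility T t i v k (deviate b i k') = utility T t i v k b.
Proof. by rewrite /utility deviate_deviate. Qed.

Lemma utility_ge0 T t (i : 'I_n) (v : R) (k : 'I_K) (b : bids n K) : label A k <= v -> 0 <= utility T t i v k b.
Proof.
move=> kv; rewrite /utility subr_ge0.
apply: (le_trans (pay_le (a := A) T t _ i)).
by rewrite ffunE eqxx ler_wpM2r ?alloc_ge0.
Qed.

Lemma utility_le1 T t (i : 'I_n) (a : 'I_m) (k : 'I_K) (b : bids n K) : utility T t i (D a) k b <= 1.
Proof.
rewrite /utility lerBlDr ler_wpDr ?pay_ge0 //.
by rewrite mulr_ile1 ?val_ge0 ?alloc_ge0 ?val_le1 ?alloc_le1.
Qed.

End Process.

(** * Hedge *)

Section Rates.
Variable R : realType.

Definition fourth_root (T : nat) : R := Num.sqrt (Num.sqrt T%:R).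

Lemma fourth_root_ge0 T : 0 <= fourth_root T.
Proof. exact: sqrtr_ge0. Qed.

Lemma fourth_root2 T : fourth_root T ^+ 2 = Num.sqrt T%:R.
Proof. by rewrite sqr_sqrtr ?sqrtr_ge0. Qed.

Lemma fourth_root4 T : fourth_root T ^+ 4 = T%:R.
Proof. by rewrite (exprM _ 2 2) fourth_root2 sqr_sqrtr ?ler0n. Qed.

Lemma fourth_root_ge1 T : (0 < T)%N -> 1 <= fourth_root T.
Proof.
move=> T0; rewrite -sqrtr1 ler_wsqrtr // -[leLHS]sqrtr1 ler_wsqrtr //.
by rewrite (ler_nat _ 1).
Qed.

Lemma cvg_div_fourth_root (C : R) : (fun T => C / fourth_root T) @ \oo --> (0 : R).
Proof.
rewrite -(mulr0 C); apply: cvgMr; apply/cvgrPdist_le => e e0.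
exists (Num.truncn (e^-1 ^+ 4)).+1 => // T /= NT.
have aT : e^-1 <= fourth_root T.
  rewrite -(@ler_pXn2r _ 4) ?nnegrE ?fourth_root_ge0 ?invr_ge0 ?(ltW e0) //.
  rewrite fourth_root4; apply: le_trans (ltW (truncnS_gt _)) _.
  by rewrite ler_nat.
rewrite sub0r normrN ger0_norm ?invr_ge0 ?fourth_root_ge0 //.
by rewrite invf_ple ?posrE // (lt_le_trans _ aT) // invr_gt0.
Qed.

(** The inequality e^y <= 1 + y e^y, which is 1 - y <= e^(-y) multiplied by e^y, is applied twice;
    the remaining e^x is bounded by e. *)
Lemma expR_le_quad (x : R) : 0 <= x <= 1 -> expR x <= 1 + x + expR 1 * x ^+ 2.
Proof.
move=> /andP[x0 x1].
have step (y : R) : 0 <= y -> expR y <= 1 + y * expR y.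
  move=> y0; have := @expR_ge1Dx R (- y).
  rewrite -(ler_pM2r (expR_gt0 y)) expRN mulVf ?gt_eqF ?expR_gt0 //; lra.
have ex1 : expR x <= expR 1 by rewrite ler_expR.
have := step x x0; have := ler_wpM2l x0 (step x x0).
have := ler_wpM2l (sqr_ge0 x) ex1; nra.
Qed.

End Rates.

Section Hedge.
Variables (R : realType) (n m : nat) (D : valdist R m) (A : auction n D).

Notation K := (arms A).
Notation strat := (strategy R n m K).
Notation round := ({ffun 'I_n -> 'I_m} * bids n K)%type.

Section HedgeDef.
Variables (T : nat) (i : 'I_n).

(** With [a] = T^(1/4) and [eta] = [a]^(-2) the prior ratio 1 + [a] diverges and decides ties; a gap
    of (2/[a]) T in cumulative utility is scaled by [eta] to 2 [a], whose exponential outweighs the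
    prior; and the regret, of order [a]^3, stays o(T). *)
Let a : R := fourth_root R T.
Let eta : R := (Num.sqrt T%:R)^-1.

Definition hedge_prior j (k : 'I_K) : R := if k == val_arm A j then 1 + a else 1.

Definition hedge_weight (hb : seq (bids n K)) (j : 'I_m) (k : 'I_K) : R :=
  if label A k <= D j then hedge_prior j k * expR (eta * cumul_utility T i k (D j) hb)
  else 0.

Definition hedge_total hb j := \sum_k hedge_weight hb j k.

Definition hedge_pull (hb : seq (bids n K)) (hv : seq 'I_m) (j : 'I_m) (k : 'I_K) : R :=
  hedge_weight hb j k / hedge_total hb j.

Lemma hedge_prior_ge1 j k : 1 <= hedge_prior j k.
Proof. by rewrite /hedge_prior; case: ifP => _ //; rewrite lerDl fourth_root_ge0. Qed.

Lemma hedge_prior_le j k : hedge_prior j k <= 1 + a.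
Proof. by rewrite /hedge_prior; case: ifP => _ //; rewrite lerDl fourth_root_ge0. Qed.

Lemma hedge_weight_ge0 hb j k : 0 <= hedge_weight hb j k.
Proof.
rewrite /hedge_weight; case: ifP => // _.
by rewrite mulr_ge0 ?expR_ge0 // (le_trans ler01) ?hedge_prior_ge1.
Qed.

Lemma hedge_weight_le_total hb j k : hedge_weight hb j k <= hedge_total hb j.
Proof.
by rewrite /hedge_total (bigD1 k) //= lerDl sumr_ge0 // => *; exact: hedge_weight_ge0.
Qed.

Lemma hedge_weight_ge hb j k : label A k <= D j ->
  expR (eta * cumul_utility T i k (D j) hb) <= hedge_weight hb j k.
Proof.
move=> kj; rewrite /hedge_weight kj ler_peMl ?expR_ge0 ?hedge_prior_ge1 //.
Qed.

Lemma hedge_total_gt0 hb j : 0 < hedge_total hb j.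
Proof.
apply: lt_le_trans (hedge_weight_le_total hb j (val_arm A j)).
by apply: lt_le_trans (hedge_weight_ge _ _); rewrite ?expR_gt0 // label_val.
Qed.

Lemma hedge_pull_ge0 hb hv j k : 0 <= hedge_pull hb hv j k.
Proof. by rewrite divr_ge0 ?hedge_weight_ge0 // ltW ?hedge_total_gt0. Qed.

Lemma hedge_pull_sum1 hb hv j : \sum_k hedge_pull hb hv j k = 1.
Proof. by rewrite -big_distrl /= divff // gt_eqF ?hedge_total_gt0. Qed.

Definition hedge : strat := Strategy hedge_pull_ge0 hedge_pull_sum1.

Lemma hedge_never_overbids : never_overbids hedge.
Proof.
move=> hb hv j k jk.
by rewrite /= /hedge_pull /hedge_weight leNgt jk /= mul0r.
Qed.

(** The denominator is at least the weight of k', and its prior is at least 1. *)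
Lemma hedge_pull_le hb hv j k k' : label A k <= D j -> label A k' <= D j ->
  hedge_pull hb hv j k <=
  (1 + a) * expR (eta * (cumul_utility T i k (D j) hb - cumul_utility T i k' (D j) hb)).
Proof.
move=> kj k'j; rewrite /hedge_pull ler_pdivrMr ?hedge_total_gt0 //.
apply: le_trans (_ : (1 + a) * expR (eta * cumul_utility T i k (D j) hb) <= _).
  by rewrite /hedge_weight kj ler_wpM2r ?expR_ge0 ?hedge_prior_le.
rewrite -mulrA ler_wpM2l ?addr_ge0 ?fourth_root_ge0 //.
apply: le_trans (ler_wpM2l (expR_ge0 _) (le_trans (hedge_weight_ge hb k'j)
  (hedge_weight_le_total _ _ _))).
by rewrite -expRD -mulrDr subrK.
Qed.

Lemma hedge_mean_based : mean_based T (2 / a) i hedge.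
Proof.
move=> hb hv j k k' hT _ kj k'j lt_kk'.
have T0 : (0 < T)%N by apply: leq_ltn_trans hT.
have a1 : 1 <= a by exact: fourth_root_ge1.
have a0 : 0 < a by exact: lt_le_trans a1.
have a4 := fourth_root4 R T; rewrite -/a in a4.
have etaE : eta = (a ^+ 2)^-1 by rewrite /eta /a fourth_root2.
apply: le_trans (hedge_pull_le _ _ kj k'j) _.
(* The chain is (1 + a) e^(-2a) <= e^(-a) <= 1/a <= 2/a. *)
apply: le_trans (_ : (1 + a) * expR (- (2 * a)) <= _).
  rewrite ler_wpM2l ?addr_ge0 ?ltW // ltr_expR etaE mulrC ltr_pdivrMr ?exprn_gt0 //.
  move: lt_kk'; rewrite -a4.
  have -> : 2 / a * a ^+ 4 = 2 * a * a ^+ 2 by field; rewrite gt_eqF.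
  by lra.
have ea := @expR_ge1Dx R a.
have -> : - (2 * a) = - a + - a by ring.
rewrite expRD mulrA expRN.
have e0 := expR_gt0 a.
apply: le_trans (_ : (expR a)^-1 <= _).
  by rewrite ler_piMl ?invr_ge0 ?(ltW e0) // ler_pdivrMr // mul1r.
apply: le_trans (_ : a^-1 <= _).
  by rewrite lef_pV2 ?posrE //; lra.
by rewrite ler_peMl ?invr_ge0 ?(ltW a0) // ler1n.
Qed.

(** If k has not earned more than the arm of the own value, the exponentials cannot offset the prior
    ratio 1 + [a]. This settles ties among arms that have earned nothing. *)
Lemma hedge_pull_le_top hb hv j k : label A k <= D j -> k != val_arm A j ->
    cumul_utility T i k (D j) hb <= cumul_utility T i (val_arm A j) (D j) hb ->
  hedge_pull hb hv j k <= (1 + a)^-1.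
Proof.
move=> kj kn ut; have a0 : 0 < 1 + a by rewrite ltr_wpDr ?fourth_root_ge0.
rewrite /hedge_pull ler_pdivrMr ?hedge_total_gt0 //.
rewrite mulrC ler_pdivlMr //.
apply: le_trans (hedge_weight_le_total hb j (val_arm A j)).
rewrite /hedge_weight kj label_val lexx /hedge_prior (negPf kn) eqxx mul1r mulrC.
rewrite ler_wpM2l ?(ltW a0) // ler_expR ler_wpM2l ?invr_ge0 ?sqrtr_ge0 //.
Qed.

Definition hedge_mix j (h : seq round) (e : round) : R :=
  \sum_k hedge_pull (bids_of h) [::] j k * utility T (size h) i (D j) k e.2.

Lemma eta_le1 : 0 <= eta <= 1.
Proof.
rewrite invr_ge0 sqrtr_ge0 /=; case: (posnP T) => [T0|T0].
  by rewrite /eta T0 sqrtr0 invr0.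
rewrite invf_le1 ?sqrtr_gt0 ?ltr0n // -fourth_root2.
by rewrite exprn_ege1 // fourth_root_ge1.
Qed.

(** Potential argument: a round multiplies the total weight by at most 1 + [eta] mix + e [eta]^2,
    which is below the exponential of its excess over 1; the initial weight is at most K (1 +
    [a]). *)
Lemma hedge_total_le j (h : seq round) : hedge_total (bids_of h) j <=
  K%:R * (1 + a) *
  expR (cum (fun h e => eta * hedge_mix j h e + expR 1 * eta ^+ 2) h).
Proof.
have /andP[eta0 eta1] := eta_le1.
elim/last_ind: h => [|h e IH].
  rewrite cum_nil expR0 mulr1 -[K in K%:R]card_ord -sum1_card natr_sum.
  rewrite big_distrl /=; apply: ler_sum => k _; rewrite mul1r /hedge_weight.
  rewrite cumul_utility_nil mulr0 expR0 mulr1.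
  by case: ifP => _; rewrite ?hedge_prior_le // addr_ge0 ?fourth_root_ge0.
rewrite cum_rcons expRD mulrA.
set W := hedge_total (bids_of h) j.
apply: le_trans (_ : W * (1 + (eta * hedge_mix j h e + expR 1 * eta ^+ 2)) <= _);
  last first.
  apply: le_trans (ler_wpM2l (ltW (hedge_total_gt0 _ _)) (expR_ge1Dx _)) _.
  by rewrite ler_wpM2r ?expR_ge0.
have -> : W * (1 + (eta * hedge_mix j h e + expR 1 * eta ^+ 2)) =
  \sum_k hedge_weight (bids_of h) j k *
    (1 + eta * utility T (size h) i (D j) k e.2 + expR 1 * eta ^+ 2).
  under [RHS]eq_bigr do rewrite -addrA mulrDr mulr1 mulrDr (mulrCA _ eta).
  rewrite !big_split /= -/(hedge_total _ _) -/W -big_distrr /= -big_distrl /=.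
  rewrite -/(hedge_total _ _) -/W mulrDr mulr1 mulrDr (mulrCA W eta).
  congr (_ + (_ * _ + _)); rewrite /hedge_mix big_distrr /=.
  apply: eq_bigr => k _; rewrite /hedge_pull -/W; field.
  by rewrite gt_eqF ?hedge_total_gt0.
apply: ler_sum => k _; rewrite /hedge_weight /bids_of map_rcons.
case: ifP => kj; last by rewrite mul0r.
rewrite cumul_utility_rcons size_map mulrDr expRD mulrA ler_wpM2l //.
  by rewrite mulr_ge0 ?expR_ge0 // (le_trans ler01) ?hedge_prior_ge1.
have u0 := utility_ge0 T (size h) i e.2 kj.
have u1 := utility_le1 T (size h) i j k e.2.
apply: le_trans (expR_le_quad _) _; first by rewrite mulr_ge0 //= mulr_ile1.
by rewrite lerD2l ler_wpM2l ?expR_ge0 // exprMn ler_piMr ?sqr_ge0 // exprn_ile1.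
Qed.

(** A single weight is at most the total weight; comparing exponents gives the bound. The factor K
    (1 + [a]) is bounded by its own exponential rather than through its logarithm, which costs at
    most 2 K [a]^3 and is still o(T). *)
Lemma hedge_pathwise j k (h : seq round) : (0 < T)%N -> size h = T ->
    label A k <= D j ->
  cumul_utility T i k (D j) (bids_of h) <=
  cum (hedge_mix j) h + (2 * K%:R + expR 1) / a * T%:R.
Proof.
move=> T0 sh kj.
have a1 : 1 <= a by exact: fourth_root_ge1.
have a0 : 0 < a by exact: lt_le_trans a1.
have a4 := fourth_root4 R T; rewrite -/a in a4.
have etaE : eta = (a ^+ 2)^-1 by rewrite /eta /a fourth_root2.
have := le_trans (hedge_weight_ge (bids_of h) kj) (le_trans
  (hedge_weight_le_total _ _ _) (hedge_total_le j h)).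
rewrite cumD cumZ (cum_time (fun _ => expR 1 * eta ^+ 2)) sh.
rewrite sumr_const card_ord -[_ *+ T]mulr_natl => le1.
have K0 : 0 <= K%:R :> R by rewrite ler0n.
have le2 : K%:R * (1 + a) <= expR (K%:R * (1 + a)).
  by apply: le_trans (expR_ge1Dx _); rewrite lerDr.
have := le_trans le1 (ler_wpM2r (expR_ge0 _) le2).
rewrite -expRD ler_expR -a4 etaE => le3.
rewrite -(ler_pM2l (_ : 0 < (a ^+ 2)^-1)) ?invr_gt0 ?exprn_gt0 //.
apply: le_trans le3 _.
have -> : (a ^+ 2)^-1 * (cum (hedge_mix j) h + (2 * K%:R + expR 1) / a * a ^+ 4) =
  (2 * K%:R + expR 1) * a + (a ^+ 2)^-1 * cum (hedge_mix j) h.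
  by field; rewrite gt_eqF.
rewrite addrCA addrC lerD2r.
have -> : a ^+ 4 * (expR 1 * (a ^+ 2)^-1 ^+ 2) = expR 1.
  by field; rewrite gt_eqF.
have e0 := expR_ge0 (1 : R).
by nra.
Qed.

(** The pathwise bound holds for every sequence of rival bids, so the others may react to the past
    arbitrarily; only the own value and arm are averaged. *)
Lemma hedge_regret (S : 'I_n -> strat) (f : 'I_m -> 'I_K) :
    S i = hedge -> (forall j, label A (f j) <= D j) ->
  regret T i S f <= (2 * K%:R + expR 1) / a * T%:R.
Proof.
move=> Si fj; rewrite regretE -Ex_cumB.
have -> : Ex S T (cum (fun h e => utility T (size h) i (D (e.1 i)) (f (e.1 i)) e.2 -
     utility T (size h) i (D (e.1 i)) (e.2 i) e.2)) =
  Ex S T (cum (fun h e => \sum_j prob_of D j *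
    (utility T (size h) i (D j) (f j) e.2 - hedge_mix j h e))).
  apply: Ex_cum_eq => h _; rewrite (Estep_resample S h i); apply: eq_Estep => e.
  apply: eq_bigr => j _; congr (_ * _).
  rewrite /= /hedge_mix -[X in _ = X - _]mul1r -(pull_after_sum1 S h i j).
  rewrite big_distrl -sumrB; apply: eq_bigr => k _ /=.
  rewrite !ffunE eqxx !utility_deviate mulrBr; congr (_ - _ * _).
  by rewrite /pull_after Si.
case: (posnP T) => [T0|T0].
  by rewrite T0 /= cum_nil mulr0.
rewrite -[leRHS](Ex_const S T); apply: Ex_le => h sh.
set B := leRHS; rewrite cum_sum -[B]mul1r -(prob_sum1 D) big_distrl /=; apply: ler_sum => j _.
rewrite cumZ ler_wpM2l ?(ltW (prob_gt0 D j)) //.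
have -> : cum (fun h e => utility T (size h) i (D j) (f j) e.2 - hedge_mix j h e) h
  = cumul_utility T i (f j) (D j) (bids_of h) - cum (hedge_mix j) h.
  by rewrite cumul_utilityE /cum sumrB.
rewrite lerBlDl; exact: hedge_pathwise.
Qed.

End HedgeDef.

Lemma hedge_clever i : clever i (fun T => hedge T i).
Proof.
split=> [T|]; first exact: hedge_never_overbids.
exists (fun T => (2 * K%:R + expR 1) / fourth_root R T); split.
  exact: cvg_div_fourth_root.
move=> T S f Si fj; exact: hedge_regret.
Qed.

End Hedge.

Lemma hedge_rate_admissible (R : realType) :
  admissible_rate (fun T => 2 / fourth_root R T).
Proof.
split=> [T| |]; first by rewrite divr_ge0 ?fourth_root_ge0.
  exact: cvg_div_fourth_root.
apply/eqOP; exists 1; split=> // c c1; exists 1%N => // T /= T1.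
have a1 := fourth_root_ge1 R T1; have a0 := lt_le_trans ltr01 a1.
rewrite -fourth_root2 !ger0_norm ?divr_ge0 ?invr_ge0 ?exprn_ge0 ?(ltW a0) //.
apply: le_trans (_ : 2 / fourth_root R T <= _); last first.
  by rewrite ler_peMl ?divr_ge0 ?(ltW a0) // ltW.
rewrite expr2 invfM -[leRHS]mulrC ler_wpM2l ?invr_ge0 ?(ltW a0) //.
by apply: (@le_trans _ _ 1); rewrite ?invf_le1 ?ler1n.
Qed.

(** * Uniform auctions with a reserve *)

Section Share.
Variables (R : realType) (n : nat).

(* the chance of [i] when the item goes to a uniformly random buyer among [i]
   and the others satisfying [P] *)
Definition share (V : Type) (P : pred V) (i : 'I_n) (v : 'I_n -> V) : R :=
  (1 + #|[set i' | (i' != i) && P (v i')]%SET|)%:R^-1.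

Lemma share_ge0 V (P : pred V) i v : 0 <= share P i v.
Proof. by rewrite invr_ge0 ler0n. Qed.

Lemma share_le1 V (P : pred V) i v : share P i v <= 1.
Proof. by rewrite invf_le1 ?ltr0n // (ler_nat _ 1). Qed.

Lemma share_ge V (P : pred V) i v : n%:R^-1 <= share P i v.
Proof.
have n0 : (0 < n)%N by apply: leq_ltn_trans (ltn_ord i).
rewrite lef_pV2 ?posrE ?ltr0n // ler_nat.
rewrite addnC addn1 -[leqRHS]card_ord -cardsT; apply: proper_card.
by apply/properP; split; [exact: finset.subsetT | exists i; rewrite !inE ?eqxx].
Qed.

Lemma eq_share V W (P : pred V) (Q : pred W) i v w :
  (forall i', i' != i -> P (v i') = Q (w i')) -> share P i v = share Q i w.
Proof.
move=> PQ; rewrite /share; do 3 f_equal; apply: eq_card => i'; rewrite !inE.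
by case: (altP (i' =P i)) => //= ni; rewrite PQ.
Qed.

Lemma share_in V (P : pred V) i v : P (v i) ->
  share P i v = #|[set i' | P (v i')]%SET|%:R^-1.
Proof.
move=> Pi; rewrite (cardsD1 i) inE Pi /share; congr ((1 + _)%:R^-1).
by apply: eq_card => i'; rewrite !inE.
Qed.

Variables (m : nat) (D : valdist R m).

Lemma Evals_coord i (f : 'I_m -> R) (F : {ffun 'I_n -> 'I_m} -> R) :
    (forall v a, F (set_coord v i a) = F v) ->
  Evals D (fun v => f (v i) * F v) = (\sum_a prob_of D a * f a) * Evals D F.
Proof.
move=> Fi; rewrite (Evals_resample D i) /Evals big_distrr /=.
apply: eq_bigr => v _; rewrite mulrCA; congr (_ * _).
rewrite big_distrl /=; apply: eq_bigr => a _.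
by rewrite Fi set_coord_eq mulrA.
Qed.

Lemma share_set_coord (P : pred 'I_m) i (v : {ffun 'I_n -> 'I_m}) a :
  share P i (set_coord v i a) = share P i v.
Proof. by apply: eq_share => i' /negPf ni; rewrite ffunE ni. Qed.

Lemma Evals_share_sym (P : pred 'I_m) i i' :
  Evals D (fun v => share P i v) = Evals D (fun v => share P i' v).
Proof.
pose phi (v : {ffun 'I_n -> 'I_m}) := [ffun l => v (tperm i i' l)].
have phiK : involutive phi by move=> v; apply/ffunP => l; rewrite !ffunE tpermK.
rewrite {1}/Evals (reindex_inj (inv_inj phiK)) /=; apply: eq_bigr => v _.
congr (_ * _).
  rewrite (reindex_inj (@perm_inj _ (tperm i i'))) /=.
  by apply: eq_bigr => l _; rewrite ffunE tpermK.
rewrite /share; do 3 f_equal.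
rewrite -[in RHS](card_imset _ (@perm_inj _ (tperm i i'))); apply: eq_card => l.
rewrite -[in RHS](tpermK i i' l) (mem_imset _ _ (@perm_inj _ (tperm i i'))) !inE.
by rewrite ffunE -(inj_eq (@perm_inj _ (tperm i i')) l) tpermL.
Qed.

(** Let Q be the mass of P. Multiplied by nQ, the left side is by symmetry and independence the sum
    over buyers of the chances to qualify and win, which is the probability that somebody
    qualifies. *)
Lemma Evals_share (P : pred 'I_m) i : 0 < \sum_(a | P a) prob_of D a ->
  Evals D (fun v => share P i v) =
  (1 - (1 - \sum_(a | P a) prob_of D a) ^+ n) / (n%:R * \sum_(a | P a) prob_of D a).
Proof.
set Q := \sum_(a | P a) _ => Q0.
have n0 : (0 < n)%N by apply: leq_ltn_trans (ltn_ord i).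
apply: (canRL (mulfK _)); first by rewrite mulf_neq0 ?pnatr_eq0 -?lt0n ?(gt_eqF Q0).
transitivity (\sum_(l < n) Evals D (fun v => (P (v l))%:R * share P l v)).
  transitivity (\sum_(l < n) Q * Evals D (fun v => share P i v)).
    by rewrite sumr_const card_ord -[RHS]mulr_natl; ring.
  apply: eq_bigr => l _.
  rewrite (Evals_coord (fun a => (P a)%:R)); last by move=> *; exact: share_set_coord.
  rewrite (Evals_share_sym _ i l); congr (_ * _).
  rewrite /Q big_mkcond; apply: eq_bigr => a _.
  by case: (P a); rewrite ?mulr1 ?mulr0.
(* The shares of the qualifying buyers add up to 1 as soon as there is one. *)
transitivity (Evals D (fun v => 1 - \prod_(l < n) (~~ P (v l))%:R)).
  rewrite /Evals exchange_big; apply: eq_bigr => v _; rewrite -big_distrr /=.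
  congr (_ * _); set N := #|[set l | P (v l)]%SET|.
  transitivity (\sum_(l < n | P (v l)) (N%:R^-1 : R)).
    rewrite [RHS]big_mkcond; apply: eq_bigr => l _.
    by case: ifP => Pl; rewrite ?mul0r // mul1r share_in.
  rewrite sumr_const -/N.
  have -> : #|[pred l | P (v l)]| = N by apply: eq_card => l; rewrite !inE.
  have [l Pl|nP] := pickP (fun l => P (v l)).
    rewrite (bigD1 l) //= Pl mul0r subr0 -[_ *+ _]mulr_natl divff //.
    by rewrite pnatr_eq0 -lt0n; apply/card_gt0P; exists l; rewrite inE.
  rewrite big1 ?subrr; last by move=> l _; rewrite nP.
  suff -> : N = 0%N by [].
  by apply: eq_card0 => l; rewrite inE nP.
rewrite {1}/Evals; under eq_bigr do rewrite mulrBr mulr1.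
rewrite sumrB; congr (_ - _).
  by rewrite -[RHS](Evals_const n D); apply: eq_bigr => v _; rewrite mulr1.
under eq_bigr do rewrite -big_split /=.
rewrite -(bigA_distr_bigA (fun _ a => prob_of D a * (~~ P a)%:R)) /=.
rewrite prodr_const card_ord; congr (_ ^+ _).
rewrite -[X in _ = X - _](prob_sum1 D) [X in _ = X - _](bigID P) /= addrAC subrr add0r [RHS]big_mkcond /=.
by apply: eq_bigr => a _; case: (P a); rewrite ?mulr1 ?mulr0.
Qed.

End Share.

Section Averages.
Variables (R : realType) (n m : nat) (D : valdist R m) (A : auction n D).

Notation K := (arms A).
Notation strat := (strategy R n m K).
Notation round := ({ffun 'I_n -> 'I_m} * bids n K)%type.

Lemma avgXE T (S : 'I_n -> strat) i j : avgX T S i j = T%:R^-1 *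
  (Ex S T (cum (fun h e => (e.1 i == j)%:R * alloc A T (size h) e.2 i)) / prob_of D j).
Proof.
rewrite /avgX -(sum_expect_cum T S (fun t (e : round) =>
  (e.1 i == j)%:R * alloc A T t e.2 i)).
by rewrite big_distrl.
Qed.

Lemma avgYE T (S : 'I_n -> strat) i j : avgY T S i j = T%:R^-1 *
  Ex S T (cum (fun h e => alloc A T (size h) (deviate e.2 i (val_arm A j)) i)).
Proof.
by rewrite /avgY -(sum_expect_cum T S (fun t (e : round) =>
  alloc A T t (deviate e.2 i (val_arm A j)) i)).
Qed.

Lemma avgUE T (S : 'I_n -> strat) i j : avgU T S i j = T%:R^-1 *
  (Ex S T (cum (fun h e => (e.1 i == j)%:R *
    utility T (size h) i (D j) (e.2 i) e.2)) / prob_of D j).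
Proof.
transitivity (T%:R^-1 *
  (Ex S T (cum (fun h e => (e.1 i == j)%:R *
    (D j * alloc A T (size h) e.2 i - pay A T (size h) e.2 i))) / prob_of D j)).
  rewrite /avgU -(sum_expect_cum T S (fun t (e : round) => (e.1 i == j)%:R *
    (D j * alloc A T t e.2 i - pay A T t e.2 i))).
  by rewrite big_distrl.
congr (_ * (_ / _)); apply: Ex_cum_eq => h _; apply: eq_Estep => e.
by rewrite /utility deviate_id.
Qed.

Lemma Ex_cum_close S T (f g err : seq round -> round -> R) :
    (forall h e, (size h < T)%N -> `|f h e - g h e| <= err h e) ->
  `|Ex S T (cum f) - Ex S T (cum g)| <= Ex S T (cum err).
Proof.
move=> fg; rewrite -ExB; apply: le_trans (Ex_norm _ _ _) _.
apply: Ex_le => h sh; rewrite /cum -sumrB !big_mkord.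
apply: le_trans (ler_norm_sum _ _ _) _; apply: ler_sum => s _; apply: fg.
by rewrite size_take ltn_ord -sh ltn_ord.
Qed.

End Averages.

Section Uniform.
Variables (R : realType) (n m : nat) (D : valdist R m) (A : auction n D).
Variables (r : nat -> nat -> R).
Hypothesis uniA : uniform_declining_reserve A r.

Notation K := (arms A).
Notation strat := (strategy R n m K).
Notation round := ({ffun 'I_n -> 'I_m} * bids n K)%type.

Definition bid_share T t (i : 'I_n) (b : bids n K) : R :=
  share R (fun k => r T t <= label A k) i b.

Definition val_share T t (i : 'I_n) (v : {ffun 'I_n -> 'I_m}) : R :=
  share R (fun a => r T t <= D a) i v.

Lemma uniform_alloc T t b i : (t < T)%N ->
  alloc A T t b i = if r T t <= label A (b i) then bid_share T t i b else 0.
Proof.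
move=> tT; rewrite (uniA.2 T t b i tT); case: ifP => // rb.
by rewrite /bid_share share_in.
Qed.

Lemma bid_share_deviate T t i k b : bid_share T t i (deviate b i k) = bid_share T t i b.
Proof. by apply: eq_share => i' /negPf ni; rewrite ffunE ni. Qed.

Lemma uniform_alloc_deviate T t b i k : (t < T)%N ->
  alloc A T t (deviate b i k) i = if r T t <= label A k then bid_share T t i b else 0.
Proof. by move=> tT; rewrite uniform_alloc // ffunE eqxx bid_share_deviate. Qed.

(** A single violation makes this at least 1, which covers the difference of any two probabilities;
    without violation, bids can be replaced by values in the allocation. *)
Definition mismatch T (h : seq round) (e : round) : R :=
  \sum_(i < n) ((r T (size h) <= label A (e.2 i)) != (r T (size h) <= D (e.1 i)))%:R.

Lemma mismatch_cases T h e :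
  1 <= mismatch T h e \/
  forall i, (r T (size h) <= label A (e.2 i)) = (r T (size h) <= D (e.1 i)).
Proof.
have [i mi|mm] := pickP (fun i =>
  (r T (size h) <= label A (e.2 i)) != (r T (size h) <= D (e.1 i))).
  by left; rewrite /mismatch (bigD1 i) //= mi lerDl sumr_ge0.
by right=> i; have /negbFE/eqP := mm i.
Qed.

Lemma mismatch_ge0 T h e : 0 <= mismatch T h e.
Proof. by rewrite sumr_ge0. Qed.

Lemma bid_share_close T h (e : round) i :
  `|bid_share T (size h) i e.2 - val_share T (size h) i e.1| <= mismatch T h e.
Proof.
case: (mismatch_cases T h e) => [m1|mm].
  apply: le_trans m1; rewrite ler_norml.
  have := share_ge0 R (fun k => r T (size h) <= label A k) i e.2.
  have := share_le1 R (fun k => r T (size h) <= label A k) i e.2.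
  have := share_ge0 R (fun a => r T (size h) <= D a) i e.1.
  have := share_le1 R (fun a => r T (size h) <= D a) i e.1.
  by rewrite /bid_share /val_share; lra.
suff -> : bid_share T (size h) i e.2 = val_share T (size h) i e.1.
  by rewrite subrr normr0 mismatch_ge0.
by apply: eq_share => i' _; exact: mm.
Qed.

Lemma alloc_close T h (e : round) i : (size h < T)%N ->
  `|alloc A T (size h) e.2 i -
    (if r T (size h) <= D (e.1 i) then val_share T (size h) i e.1 else 0)|
  <= mismatch T h e.
Proof.
move=> hT; rewrite uniform_alloc //.
have := bid_share_close T h e i.
case: (mismatch_cases T h e) => [m1|mm]; last first.
  by rewrite mm; case: ifP => // _ _; rewrite subrr normr0 mismatch_ge0.
move=> _; apply: le_trans m1; rewrite ler_norml.
have := share_ge0 R (fun k => r T (size h) <= label A k) i e.2.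
have := share_le1 R (fun k => r T (size h) <= label A k) i e.2.
have := share_ge0 R (fun a => r T (size h) <= D a) i e.1.
have := share_le1 R (fun a => r T (size h) <= D a) i e.1.
by rewrite /bid_share /val_share; case: ifP; case: ifP; lra.
Qed.

Definition mean_share T t i : R := Evals D (fun v => val_share T t i v).

Definition ideal_total T i (b : R) : R :=
  \sum_(t < T) (if r T t <= b then mean_share T t i else 0).

(** [val_share] of buyer i depends on the rivals' values alone, so the event that his own value is
    w_j is independent of it and contributes the factor q_j that the division removes. *)
Lemma avgX_close T (S : 'I_n -> strat) i j :
  `|avgX T S i j - T%:R^-1 * ideal_total T i (D j)| <=
  T%:R^-1 * (Ex S T (cum (mismatch T)) / prob_of D j).
Proof.
have q0 := prob_gt0 D j.
rewrite avgXE -mulrBr normrM ger0_norm ?invr_ge0 ?ler0n //.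
rewrite ler_wpM2l ?invr_ge0 ?ler0n //.
rewrite -[X in _ - X](mulfK (lt0r_neq0 q0)) -mulrBl normrM.
rewrite [X in _ * X]ger0_norm ?invr_ge0 ?(ltW q0) // ler_wpM2r ?invr_ge0 ?(ltW q0) //.
have -> : ideal_total T i (D j) * prob_of D j =
  Ex S T (cum (fun h e => (e.1 i == j)%:R *
    (if r T (size h) <= D (e.1 i) then val_share T (size h) i e.1 else 0))).
  rewrite /ideal_total -(Ex_cum_time S T
    (fun t => if r T t <= D j then mean_share T t i else 0)) mulrC -ExZ.
  rewrite (_ : Ex S T (fun h => _) = Ex S T (cum (fun h _ => prob_of D j *
    (if r T (size h) <= D j then mean_share T (size h) i else 0)))); last first.
    by apply: eq_Ex => h _; rewrite cumZ.
  apply: Ex_cum_eq => h _; rewrite Estep_const.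
  rewrite (Estep_vals S h (fun v => (v i == j)%:R *
    (if r T (size h) <= D (v i) then val_share T (size h) i v else 0))).
  transitivity (Evals D (fun v => ((v i == j) && (r T (size h) <= D (v i)))%:R *
    val_share T (size h) i v)).
    rewrite (Evals_coord D (fun a => ((a == j) && (r T (size h) <= D a))%:R));
      last by move=> *; exact: share_set_coord.
    rewrite (bigD1 j) //= eqxx /= big1 ?addr0; last first.
      by move=> a /negPf ->; rewrite mulr0.
    by case: ifP => _; rewrite /= /mean_share; ring.
  apply: eq_bigr => v _; congr (_ * _).
  by case: (v i == j); case: ifP => _; rewrite ?mul1r ?mul0r ?mulr0.
apply: Ex_cum_close => h e hT; rewrite -mulrBr normrM.
have := alloc_close e i hT; have := mismatch_ge0 T h e.
by case: (e.1 i == j); rewrite ?normr1 ?normr0 ?mul1r ?mul0r.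
Qed.

Lemma Ex_bid_share_close T (S : 'I_n -> strat) i (b : R) :
  `|Ex S T (cum (fun h e => if r T (size h) <= b then bid_share T (size h) i e.2 else 0))
    - ideal_total T i b| <= Ex S T (cum (mismatch T)).
Proof.
have -> : ideal_total T i b =
  Ex S T (cum (fun h e => if r T (size h) <= b then val_share T (size h) i e.1 else 0)).
  rewrite /ideal_total -(Ex_cum_time S T
    (fun t => if r T t <= b then mean_share T t i else 0)).
  apply: Ex_cum_eq => h _.
  rewrite Estep_const; case: ifP => _; last by rewrite Estep_const.
  by rewrite (Estep_vals S h (val_share T (size h) i)).
apply: Ex_cum_close => h e hT; case: ifP => _; first exact: bid_share_close.
by rewrite subrr normr0 mismatch_ge0.
Qed.

Lemma avgY_close T (S : 'I_n -> strat) i j :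
  `|avgY T S i j - T%:R^-1 * ideal_total T i (D j)| <=
  T%:R^-1 * Ex S T (cum (mismatch T)).
Proof.
rewrite avgYE -mulrBr normrM ger0_norm ?invr_ge0 ?ler0n //.
rewrite ler_wpM2l ?invr_ge0 ?ler0n //.
apply: le_trans (Ex_bid_share_close T S i (D j)); rewrite le_eqVlt; apply/orP; left.
apply/eqP; congr (`|_ - _|); apply: Ex_cum_eq => h hT; apply: eq_Estep => e.
by rewrite uniform_alloc_deviate // label_val.
Qed.

End Uniform.

(** * Reserve levels and the allocations they induce *)

Section Levels.
Variables (R : realType) (n m : nat) (D : valdist R m).

Definition at_level (x : R) (k : 'I_m) : bool :=
  (x <= D k) && [forall j : 'I_m, (j < k)%N ==> (D j < x)].

Lemma val_le (j k : 'I_m) : (D j <= D k) = (j <= k)%N.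
Proof.
case: (leqP j k) => [|kj]; last by rewrite leNgt (val_lt D kj).
rewrite leq_eqVlt => /predU1P[/val_inj ->|/(val_lt D)/ltW ->//]; exact: lexx.
Qed.

Lemma at_levelP x k : at_level x k -> forall a, (x <= D a) = (k <= a)%N.
Proof.
move=> /andP[xk /forallP lt_x] a; case: (leqP k a) => ka.
  by rewrite (le_trans xk) // val_le.
by apply/negbTE; rewrite -ltNge; have := lt_x a; rewrite ka.
Qed.

Lemma at_level_ex x a : x <= D a -> exists k, at_level x k.
Proof.
move=> xa; case: (@arg_minnP _ a (fun k : 'I_m => x <= D k) val xa) => k xk kmin.
exists k; rewrite /at_level xk; apply/forallP => j; apply/implyP => jk.
by rewrite ltNge; apply: contraL jk => xj; rewrite -leqNgt kmin.
Qed.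

Lemma at_level_uniq x k k' : at_level x k -> at_level x k' -> k = k'.
Proof.
move=> xk xk'; apply/val_inj/anti_leq.
by rewrite -(at_levelP xk) (at_levelP xk') leqnn /= -(at_levelP xk') (at_levelP xk) leqnn.
Qed.

Lemma sum_at_level (F : 'I_m -> R) x k : at_level x k ->
  \sum_(k' | at_level x k') F k' = F k.
Proof.
move=> xk; rewrite (big_pred1 k) // => k' /=; apply/idP/eqP => [xk'|->//].
exact: at_level_uniq xk' xk.
Qed.

Lemma sum_no_level (F : 'I_m -> R) x : (forall k, ~~ at_level x k) ->
  \sum_(k' | at_level x k') F k' = 0.
Proof. by move=> xk; rewrite big_pred0 // => k'; apply/negbTE. Qed.

(* chance of winning a round in which exactly the values from w_k up compete *)
Definition win_prob (k : 'I_m) : R :=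
  (1 - (1 - \sum_(a < m | (k <= a)%N) prob_of D a) ^+ n) /
  (n%:R * \sum_(a < m | (k <= a)%N) prob_of D a).

Lemma prob_tail_gt0 (k : 'I_m) : 0 < \sum_(a < m | (k <= a)%N) prob_of D a.
Proof.
by rewrite (bigD1 k) //= ltr_pwDl ?prob_gt0 // sumr_ge0 // => a _; rewrite ltW ?prob_gt0.
Qed.

Lemma Evals_share_level x k i : at_level x k ->
  Evals D (fun v : {ffun 'I_n -> 'I_m} => share R (fun a => x <= D a) i v) = win_prob k.
Proof.
move=> xk; rewrite /win_prob -(Evals_share i (prob_tail_gt0 k)).
apply: eq_bigr => v _; congr (_ * _); apply: eq_share => i' _.
exact: at_levelP.
Qed.

Lemma win_prob_ge0 k : (0 < n)%N -> 0 <= win_prob k.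
Proof.
move=> n0; have xk : at_level (D k) k.
  by rewrite /at_level lexx; apply/forallP => j; apply/implyP => /(val_lt D).
rewrite -(Evals_share_level (Ordinal n0) xk) sumr_ge0 // => v _.
by rewrite mulr_ge0 ?share_ge0 // prodr_ge0 // => i _; rewrite ltW ?prob_gt0.
Qed.

Lemma win_prob_le1 k : (0 < n)%N -> win_prob k <= 1.
Proof.
move=> n0; have xk : at_level (D k) k.
  by rewrite /at_level lexx; apply/forallP => j; apply/implyP => /(val_lt D).
rewrite -(Evals_share_level (Ordinal n0) xk) -[leRHS](Evals_const n D).
apply: ler_sum => v _; rewrite ler_wpM2l ?share_le1 //.
by rewrite prodr_ge0 // => i _; rewrite ltW ?prob_gt0.
Qed.

(* allocation of value w_j when a fraction l k of the rounds is at level k *)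
Definition sched_alloc (l : 'I_m -> R) (j : 'I_m) : R :=
  \sum_(k < m | (k <= j)%N) l k * win_prob k.

Lemma sched_alloc_ge0 l j : (0 < n)%N -> (forall k, 0 <= l k) -> 0 <= sched_alloc l j.
Proof. by move=> n0 l0; rewrite sumr_ge0 // => k _; rewrite mulr_ge0 ?win_prob_ge0. Qed.

Lemma sched_alloc_le1 l j : (0 < n)%N -> (forall k, 0 <= l k) -> \sum_k l k <= 1 ->
  sched_alloc l j <= 1.
Proof.
move=> n0 l0 l1; apply: le_trans l1; rewrite /sched_alloc big_mkcond /=.
apply: ler_sum => k _; case: ifP => // _.
by rewrite ler_piMr ?win_prob_le1.
Qed.

Variable (r : nat -> nat -> R).

Definition level_count T k : nat := #|[set t : 'I_T | at_level (r T t) k]%SET|.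

Lemma sum_level_count T (F : 'I_m -> R) :
  \sum_k (level_count T k)%:R * F k = \sum_(t < T) \sum_(k | at_level (r T t) k) F k.
Proof.
rewrite (exchange_big_dep predT) //=; apply: eq_bigr => k _.
rewrite sumr_const mulr_natl; congr (_ *+ _).
by apply: eq_card => t; rewrite !inE.
Qed.

Lemma level_count_le T : \sum_k (level_count T k)%:R <= T%:R :> R.
Proof.
have := sum_level_count T (fun _ => 1); under eq_bigr do rewrite mulr1; move=> ->.
rewrite -[in leRHS](card_ord T) -sum1_card natr_sum; apply: ler_sum => t _.
have [k tk|tk] := pickP (at_level (r T t)); first by rewrite (sum_at_level _ tk).
by rewrite sum_no_level ?ler01 // => k; rewrite tk.
Qed.

End Levels.

Section Ideal.
Variables (R : realType) (n m : nat) (D : valdist R m).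
Variables (r : nat -> nat -> R).

Lemma mean_share_level T t (i : 'I_n) k : at_level D (r T t) k ->
  mean_share D r T t i = win_prob n D k.
Proof. by move=> tk; rewrite -(Evals_share_level i tk). Qed.

(** A reserve enters only through its level, and a reserve above all values is met by none of them.
    The identity is exact at every positive horizon and makes the allocation linear in the level
    fractions. *)
Lemma ideal_totalE T (i : 'I_n) j : (0 < T)%N -> T%:R^-1 * ideal_total D r T i (D j) =
  sched_alloc n D (fun k => (level_count D r T k)%:R / T%:R) j.
Proof.
move=> T0; rewrite /sched_alloc.
under [RHS]eq_bigr do rewrite mulrAC mulrC; rewrite -big_distrr /=; congr (_ * _).
rewrite /ideal_total [in RHS]big_mkcond /=.
rewrite [RHS](eq_bigr (fun k => (level_count D r T k)%:R *
  (if (k <= j)%N then win_prob n D k else 0))); last first.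
  by move=> k _; case: ifP => // _; rewrite mulr0.
rewrite sum_level_count; apply: eq_bigr => t _.
have [k tk|tk] := pickP (at_level D (r T t)).
  by rewrite (sum_at_level _ tk) (at_levelP tk) (mean_share_level i tk).
rewrite sum_no_level; last by move=> k; rewrite tk.
by case: ifP => // /at_level_ex [k]; rewrite tk.
Qed.

End Ideal.

Lemma eqO_cvg0 (R : realType) (f g : nat -> R) :
  f =O_\oo g -> g @ \oo --> 0 -> f @ \oo --> 0.
Proof.
move=> /eqO_exP [c c0 fg] g0.
apply/norm_cvg0P; apply: (@squeeze_cvgr _ _ _ _ (fun _ => 0) (fun T => c * `|g T|)).
- by near=> T; rewrite normr_ge0; near: T.
- exact: cvg_cst.
- by rewrite -(mulr0 c); apply: cvgMr; apply/norm_cvg0P.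
Unshelve. all: by end_near. Qed.

(** * Upper bound on the revenue *)

Section UpperBound.
Variables (R : realType) (n m : nat) (D : valdist R m) (A : auction n D).
Variables (r : nat -> nat -> R).
Hypotheses (pybA : pay_your_bid A) (uniA : uniform_declining_reserve A r).

Notation K := (arms A).
Notation strat := (strategy R n m K).
Notation round := ({ffun 'I_n -> 'I_m} * bids n K)%type.

Lemma pyb_utility T t (i : 'I_n) v (k : 'I_K) b : (t < T)%N ->
  utility T t i v k b =
  (v - label A k) * (if r T t <= label A k then bid_share r T t i b else 0).
Proof.
move=> tT; rewrite /utility pybA // (uniform_alloc_deviate uniA) // ffunE eqxx.
by rewrite mulrBl.
Qed.

(** As the reserve declines, an arm below it now was below it in every earlier round and never
    won. *)
Lemma cumul_utility_below T (i : 'I_n) v (k : 'I_K) h : (size h < T)%N ->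
  label A k < r T (size h) -> cumul_utility T i k v (bids_of (D := D) h) = 0.
Proof.
move=> hT kr; rewrite cumul_utilityE /cum big_nat big1 // => s /andP[_ sh].
have sT : (s < T)%N by apply: ltn_trans hT.
rewrite size_take sh pyb_utility // leNgt (lt_le_trans kr) ?mulr0 //.
by apply: (uniA.1); rewrite (ltnW sh).
Qed.

Let S (T : nat) (i : 'I_n) : strat := hedge A T i.

(** A value below the reserve could reach it only by overbidding. For a value that meets it, an arm
    below the reserve has earned 0 and the arm of the own value at least 0, so the prior leaves each
    such arm a probability of at most 1/(1 + T^(1/4)). *)
Lemma hedge_mismatch T : Ex (S T) T (cum (mismatch r T)) <=
  T%:R * ((n * K)%:R / fourth_root R T).
Proof.
apply: le_trans (_ : Ex (S T) T (cum (fun _ _ => (n * K)%:R / fourth_root R T)) <= _);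
  last first.
  rewrite (@eq_Ex _ _ _ _ _ _ T _ (fun _ => T%:R * ((n * K)%:R / fourth_root R T))).
    by rewrite Ex_const.
  move=> h sh; rewrite (cum_time (fun _ => _)) sumr_const card_ord sh.
  by rewrite mulr_natl.
apply: Ex_cum_le => h hT; rewrite Estep_const /mismatch.
have a1 : 1 <= fourth_root R T.
  by apply: fourth_root_ge1; apply: leq_ltn_trans hT.
have a0 := lt_le_trans ltr01 a1.
rewrite (Estep_sum (S T) h predT) natrM -mulrA.
have -> : n%:R * (K%:R / fourth_root R T) =
    \sum_(i < n) (K%:R / fourth_root R T).
  by rewrite sumr_const card_ord mulr_natl.
apply: ler_sum => i _.
rewrite (Estep_own (S T) h i (fun a k =>
  ((r T (size h) <= label A k) != (r T (size h) <= D a))%:R)).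
rewrite -[leRHS]mul1r -[X in X * _](prob_sum1 D) big_distrl /=.
apply: ler_sum => a _; rewrite ler_wpM2l ?(ltW (prob_gt0 _ _)) //.
have -> : K%:R / fourth_root R T = \sum_(k < K) (fourth_root R T)^-1.
  by rewrite sumr_const card_ord mulr_natl.
apply: ler_sum => k _; case: eqP => [_|/eqP neq] /=.
  by rewrite mulr0 invr_ge0 ltW.
rewrite mulr1; case: (leP (r T (size h)) (label A k)) neq => rk /=.
  case: leP => // ar _.
  by rewrite /pull_after (@hedge_never_overbids _ _ _ _ _ T i) ?invr_ge0 ?ltW //
    (lt_le_trans ar).
case: leP => // ra _.
have kn : k != val_arm A a.
  by apply: contraTneq rk => ->; rewrite label_val -leNgt.
have ka : label A k <= D a by apply: le_trans (ltW rk) ra.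
apply: le_trans (_ : (1 + fourth_root R T)^-1 <= _); last first.
  by rewrite lef_pV2 ?posrE ?addr_gt0 // lerDr ler01.
apply: hedge_pull_le_top => //.
rewrite (cumul_utility_below _ _ hT rk) cumul_utilityE.
rewrite /cum sumr_ge0 // => s _; apply: utility_ge0.
by rewrite label_val.
Qed.

Lemma sum_avgU T (i : 'I_n) : (0 < T)%N ->
  \sum_j prob_of D j * avgU T (S T) i j = T%:R^-1 *
  Ex (S T) T (cum (fun h e => utility T (size h) i (D (e.1 i)) (e.2 i) e.2)).
Proof.
move=> T0; under eq_bigr => j _.
  rewrite avgUE mulrCA (mulrC _ (_ / _)) divfK ?gt_eqF ?prob_gt0 //.
over.
rewrite -big_distrr /= -(Ex_sum (S T) T predT); congr (_ * _).
apply: eq_Ex => h _; rewrite -cum_sum; apply: eq_bigr => s _.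
rewrite (bigD1 ((nth (round0 A) h s).1 i)) //= eqxx mul1r big1 ?addr0 //.
by move=> j jn; rewrite eq_sym (negPf jn) mul0r.
Qed.

(** This is the regret bound against bidding w_(c j) at value w_j. As prices are bids, this
    deviation earns w_j - w_(c j) per unit allocated to the arm w_(c j), which [avgY] measures. *)
Lemma hedge_utility_ge T (i : 'I_n) (c : 'I_m -> 'I_m) : (0 < T)%N ->
    (forall j, c j <= j)%N ->
  \sum_j prob_of D j * ((D j - D (c j)) * avgY T (S T) i (c j)) -
    (2 * K%:R + expR 1) / fourth_root R T <=
  \sum_j prob_of D j * avgU T (S T) i j.
Proof.
move=> T0 cj; have T0' : 0 < T%:R :> R by rewrite ltr0n.
have fj j : label A (val_arm A (c j)) <= D j by rewrite label_val val_le.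
have := hedge_regret (erefl (S T i)) fj.
rewrite -ler_pdivrMr // => reg; rewrite lerBlDr -lerBlDl.
apply: le_trans reg; rewrite le_eqVlt; apply/orP; left; apply/eqP.
rewrite sum_avgU // regretE [RHS]mulrC mulrBr; congr (_ - _).
transitivity (T%:R^-1 * \sum_j Ex (S T) T (fun h => (prob_of D j * (D j - D (c j))) *
  cum (fun h e => alloc A T (size h) (deviate e.2 i (val_arm A (c j))) i) h)).
  rewrite big_distrr; apply: eq_bigr => j _; rewrite avgYE ExZ /=; ring.
congr (_ * _).
rewrite -(Ex_sum (S T) T predT).
rewrite (@eq_Ex _ _ _ _ _ _ T _ (cum (fun h e => \sum_j (prob_of D j * (D j - D (c j))) *
  alloc A T (size h) (deviate e.2 i (val_arm A (c j))) i))); last first.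
  by move=> h _; rewrite cum_sum; apply: eq_bigr => j _; rewrite cumZ.
apply/esym; apply: Ex_cum_eq => h hT.
rewrite (Estep_resample (S T) h i); apply: eq_Estep => e.
apply: eq_bigr => j _; rewrite -mulrA; congr (_ * _).
rewrite -[RHS]mul1r -(pull_after_sum1 (S T) h i j) big_distrl /=.
apply: eq_bigr => k _; congr (_ * _).
by rewrite !ffunE eqxx utility_deviate /utility pybA // ffunE eqxx label_val mulrBl.
Qed.

(** Welfare of the schedule minus the utility that buyers secure by the deviation [c]. *)
Definition sched_revenue (l : 'I_m -> R) (c : 'I_m -> 'I_m) : R :=
  n%:R * \sum_j prob_of D j *
    (D j * sched_alloc n D l j - (D j - D (c j)) * sched_alloc n D l (c j)).

(** The horizon is fixed by error terms that do not involve c, so one schedule serves all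
    deviations; c may later be chosen optimally for this schedule. *)
Lemma revenue_le_sched x y u eps : (0 < n)%N -> feasible A x y u -> 0 < eps ->
  exists l : 'I_m -> R, [/\ forall k, 0 <= l k, \sum_k l k <= 1 &
    forall c : 'I_m -> 'I_m, (forall j, c j <= j)%N ->
      revenue n D x u <= sched_revenue l c + eps].
Proof.
move=> n0 fA eps0; pose i := Ordinal n0.
have {}fA := fA _ (hedge_rate_admissible R) S (hedge_clever A)
  (fun T i => @hedge_mean_based _ _ _ _ A T i) i.
pose rev T := n%:R * \sum_(j < m) prob_of D j *
  (D j * avgX T (S T) i j - avgU T (S T) i j).
have cvgg := cvg_div_fourth_root (2 : R).
have rev_cvg : rev @ \oo --> revenue n D x u.
  apply: cvgMr; apply: cvg_big => [|j _]; first exact: add_continuous.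
  apply: cvgMr; apply: cvgB.
    by apply: cvgMr; apply/subr_cvg0; have [/eqO_cvg0/(_ cvgg)] := fA j.
  by apply/subr_cvg0; have [_ _ /eqO_cvg0/(_ cvgg)] := fA j.
(* Sources of error: the regret once, and for each of the m values the mismatch in [avgX] and in
   [avgY]. *)
pose C : R := n%:R * ((2 * K%:R + expR 1) + m%:R * (2 * (n * K)%:R)).
have eps2 : 0 < eps / 2 by rewrite divr_gt0.
have /cvgrPdist_le/(_ _ eps2) near_rev := rev_cvg.
have /cvgrPdist_le/(_ _ eps2) near_C := cvg_div_fourth_root C.
have ev : \forall T \near \oo, [/\ (0 < T)%N,
    revenue n D x u <= rev T + eps / 2 & C / fourth_root R T <= eps / 2].
  near=> T; split.
  - by near: T; exact: nbhs_infty_gt.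
  - by rewrite -lerBlDl; apply: le_trans (ler_norm _) _; near: T.
  - by apply: le_trans (ler_norm _) _; rewrite -normrN -sub0r; near: T.
have [T [T0 revT CT]] : exists T, [/\ (0 < T)%N,
    revenue n D x u <= rev T + eps / 2 & C / fourth_root R T <= eps / 2].
  by have [N _ evN] := ev; exists N; apply: evN => /=.
have T0' : 0 < T%:R :> R by rewrite ltr0n.
pose l k : R := (level_count D r T k)%:R / T%:R.
exists l; split=> [k||c cj].
- by rewrite divr_ge0.
- by rewrite -big_distrl /= ler_pdivrMr // mul1r level_count_le.
apply: le_trans revT _.
suff : rev T <= sched_revenue l c + C / fourth_root R T by lra.
have a0 : 0 < fourth_root R T by rewrite (lt_le_trans ltr01) ?fourth_root_ge1.
pose M : R := (n * K)%:R / fourth_root R T.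
have MT : T%:R^-1 * Ex (S T) T (cum (mismatch r T)) <= M.
  by rewrite ler_pdivrMl // hedge_mismatch.
(* The factor q_j cancels the division by q_j in [avgX_close], so the error does not involve the
   distribution. *)
have Xj j : prob_of D j * (D j * avgX T (S T) i j) <=
    prob_of D j * (D j * sched_alloc n D l j) + M.
  have q0 := prob_gt0 D j.
  have := avgX_close uniA T (S T) i j; rewrite ideal_totalE // -/l.
  rewrite ler_distl => /andP[_ le1].
  have le2 : avgX T (S T) i j <= sched_alloc n D l j + M / prob_of D j.
    by apply: le_trans le1 _; rewrite lerD2l mulrA ler_wpM2r ?invr_ge0 ?(ltW q0).
  apply: le_trans (ler_wpM2l (ltW q0) (ler_wpM2l (val_ge0 D j) le2)) _.
  have -> : prob_of D j * (D j * (sched_alloc n D l j + M / prob_of D j)) =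
      prob_of D j * (D j * sched_alloc n D l j) + D j * M.
    by field; rewrite gt_eqF.
  by rewrite lerD2l ler_piMl ?val_le1 // divr_ge0 // ltW.
have Yj j : prob_of D j * ((D j - D (c j)) * sched_alloc n D l (c j)) - M <=
    prob_of D j * ((D j - D (c j)) * avgY T (S T) i (c j)).
  have q0 := prob_gt0 D j.
  have q1 : prob_of D j <= 1.
    by rewrite -(prob_sum1 D) (bigD1 j) //= lerDl sumr_ge0 // => a _; exact: ltW (prob_gt0 _ _).
  have d0 : 0 <= D j - D (c j) by rewrite subr_ge0 val_le.
  have d1 : D j - D (c j) <= 1.
    by have := val_le1 D j; have := val_ge0 D (c j); lra.
  have := avgY_close uniA T (S T) i (c j); rewrite ideal_totalE // -/l.
  move=> /le_trans/(_ MT); rewrite ler_distl => /andP[le1 _].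
  rewrite [prob_of D j * (_ * sched_alloc _ _ _ _)]mulrA.
  rewrite [prob_of D j * (_ * avgY _ _ _ _)]mulrA; set d := prob_of D j * (D j - D (c j)).
  have d00 : 0 <= d by rewrite mulr_ge0 // ltW.
  have d11 : d <= 1 by rewrite mulr_ile1 // ltW.
  have := ler_wpM2l d00 le1.
  have : d * M <= M by rewrite ler_piMl // divr_ge0 // ltW.
  by rewrite mulrBr; lra.
have U := hedge_utility_ge i T0 cj.
rewrite /rev /sched_revenue.
have -> : C / fourth_root R T = n%:R * ((2 * K%:R + expR 1) / fourth_root R T
    + m%:R * (2 * M)).
  by rewrite /C /M; ring.
rewrite -mulrDr ler_wpM2l //.
have -> : \sum_(j < m) prob_of D j * (D j * avgX T (S T) i j - avgU T (S T) i j) =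
  \sum_(j < m) prob_of D j * (D j * avgX T (S T) i j) -
  \sum_(j < m) prob_of D j * avgU T (S T) i j.
  by rewrite -sumrB; apply: eq_bigr => j _; rewrite mulrBr.
have -> : \sum_j prob_of D j *
    (D j * sched_alloc n D l j - (D j - D (c j)) * sched_alloc n D l (c j)) =
  \sum_j prob_of D j * (D j * sched_alloc n D l j) -
  \sum_j prob_of D j * ((D j - D (c j)) * sched_alloc n D l (c j)).
  by rewrite -sumrB; apply: eq_bigr => j _; rewrite mulrBr.
have sumM : \sum_(j < m) M = m%:R * M by rewrite sumr_const card_ord mulr_natl.
have sX : \sum_j prob_of D j * (D j * avgX T (S T) i j) <=
    \sum_j prob_of D j * (D j * sched_alloc n D l j) + m%:R * M.
  by rewrite -sumM -big_split; apply: ler_sum => j _; exact: Xj.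
have sY : \sum_j prob_of D j * ((D j - D (c j)) * sched_alloc n D l (c j)) - m%:R * M <=
    \sum_j prob_of D j * ((D j - D (c j)) * avgY T (S T) i (c j)).
  by rewrite -sumM -sumrB; apply: ler_sum => j _; exact: Yj.
lra.
Unshelve. all: by end_near. Qed.

End UpperBound.

(** * Mean-based buyers under a declining reserve *)

Section RealFacts.
Variable R : realType.

(* While [P] holds, [d] grows by [delta] each round, so it crosses the band
   [-M, M] in at most 2M / delta rounds. *)
Lemma count_in_band (d : nat -> R) (P : pred nat) (delta M : R) (T : nat) :
    0 < delta -> 0 <= M ->
    (forall s1 s2 s3, (s1 <= s2 <= s3)%N -> (s3 < T)%N -> P s1 -> P s3 -> P s2) ->
    (forall s, (s < T)%N -> P s -> d s + delta <= d s.+1) ->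
  \sum_(s < T) (P s && (`|d s| <= M))%:R <= 2 * M / delta + 1.
Proof.
move=> d0 M0 Pconv Pinc.
pose N t : R := \sum_(0 <= s < t) (P s && (`|d s| <= M))%:R.
have NS t : N t.+1 = N t + (P t && (`|d t| <= M))%:R by rewrite /N big_nat_recr.
(* Invariant of the scan: nothing is counted yet; or the interval of P is over; or P held last and d
   has risen from -M by at least [delta] per counted round. *)
suff H t : (t <= T)%N -> N t <= 2 * M / delta + 1 /\
    [\/ N t = 0, (exists2 s, (s < t)%N & P s) /\ ~~ P t.-1 |
      [/\ (0 < t)%N, P t.-1 & delta * N t - M <= d t]].
  by rewrite -(big_mkord predT (fun s => (P s && (`|d s| <= M))%:R)) -/(N T); have [] := H T (leqnn T).
have bound0 : 0 <= 2 * M / delta by rewrite divr_ge0 ?mulr_ge0 // ltW.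
elim: t => [|t IH] tT.
  by rewrite /N big_nil; split; [rewrite addr_ge0 | constructor 1].
have [IH1 IH2] := IH (ltnW tT); rewrite NS.
have [/andP[Pt dt]|] := boolP (P t && (`|d t| <= M)); last first.
  rewrite addr0 => notin; split=> //.
  case: IH2 => [N0|[[s st Ps] nP]|[t0 Pt1 dN]].
  - by constructor 1.
  - constructor 2; split; first by exists s; rewrite // ltnW.
    apply: contra nP => /= Pt; apply: (Pconv s _ t) => //.
    by rewrite leq_pred -ltnS (leq_trans st) //; case: (t) st.
  - have [Pt|nPt] := boolP (P t); last first.
      constructor 2; split=> //; exists t.-1 => //.
      by rewrite ltnS leq_pred.
    constructor 3; split=> //.
    by apply: le_trans (Pinc t tT Pt); apply: le_trans dN _; rewrite lerDl ltW.
have dt1 := Pinc t tT Pt; move: dt; rewrite ler_norml => /andP[dtl dtr].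
case: IH2 => [N0|[[s st Ps] nP]|[t0 Pt1 dN]].
- rewrite N0 add0r; split; first by rewrite lerDr.
  by constructor 3; split=> //=; lra.
- exfalso; move/negP: nP; apply; apply: (Pconv s _ t) => //.
  by rewrite leq_pred -ltnS (leq_trans st) //; case: (t) st.
- split; last by constructor 3; split=> //=; lra.
  rewrite lerD2r ler_pdivlMr //; lra.
Qed.

Lemma bigmax_dist (I : finType) (P : pred I) (F G : I -> R) :
  `|\big[Num.max/0]_(k | P k) F k - \big[Num.max/0]_(k | P k) G k| <=
  \sum_(k | P k) `|F k - G k|.
Proof.
elim/big_ind3 : _ => [|x1 y1 z1 x2 y2 z2|k _]; first by rewrite subrr normr0.
  rewrite !ler_norml => /andP[? ?] /andP[? ?].
  have [?|?] := leP z1 z2; have [?|?] := leP x1 x2; have [?|?] := leP y1 y2; lra.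
by [].
Qed.

End RealFacts.

Section MeanBasedDynamics.
Variables (R : realType) (n m : nat) (D : valdist R m) (A : auction n D).
Variables (r : nat -> nat -> R).
Hypotheses (pybA : pay_your_bid A) (uniA : uniform_declining_reserve A r).
Hypothesis label_le1 : forall k, label A k <= 1.

(** A value whose only winning arm is its own would earn 0 whether it wins or loses, and mean-based
    play would not determine its behaviour. *)
Hypothesis profitable : forall T t a, (t < T)%N -> r T t <= D a ->
  r T t <= 0 \/ exists2 k, r T t <= label A k & label A k < D a.

Notation K := (arms A).
Notation strat := (strategy R n m K).
Notation round := ({ffun 'I_n -> 'I_m} * bids n K)%type.

Variables (T : nat) (g : R) (S : 'I_n -> strat).
Hypotheses (g0 : 0 <= g) (S_overbid : forall i, never_overbids (S i)).
Hypothesis S_mean : forall i, mean_based T g i (S i).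

Definition sigma (i : 'I_n) (k : 'I_K) (a : 'I_m) (h : seq round) : R :=
  cumul_utility T i k (D a) (bids_of h).

Definition bad_pull i (h : seq round) a k : bool :=
  (D a < label A k) ||
  [exists k' : 'I_K, (label A k' <= D a) && (sigma i k a h < sigma i k' a h - g * T%:R)].

(** The two ways in which a round with reserve x favours one arm: both win and the lower bid is
    cheaper, or only the higher one wins and leaves a margin. In any other pair of distinct arms up
    to the value both earn exactly 0. *)
Definition live_pair (x : R) a (k k' : 'I_K) : bool :=
  (label A k < label A k') && (label A k' <= D a) &&
  ((x <= label A k) || [&& label A k < x, x <= label A k' & label A k' < D a]).

(** The slack 1 beyond gT allows for a change of leader within the round. *)
Definition close_pair i (h : seq round) a (k k' : 'I_K) : bool :=
  live_pair (r T (size h)) a k k' &&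
  (`|sigma i k a h - sigma i k' a h| <= g * T%:R + 1).

Definition close_call i (h : seq round) a : bool :=
  [exists k, exists k', close_pair i h a k k'].

Lemma bad_pull_prob i h : (size h < T)%N ->
  Estep S h (fun e => (bad_pull i h (e.1 i) (e.2 i))%:R) <= K%:R * g.
Proof.
move=> hT; rewrite (Estep_own S h i (fun a k => (bad_pull i h a k)%:R)).
rewrite -[leRHS]mul1r -[X in X * _](prob_sum1 D) big_distrl /=.
apply: ler_sum => a _; rewrite ler_wpM2l ?(ltW (prob_gt0 _ _)) //.
have -> : K%:R * g = \sum_(k < K) g by rewrite sumr_const card_ord mulr_natl.
apply: ler_sum => k _; case: (boolP (bad_pull _ _ _ _)) => [/orP[ak|]|_].
- by rewrite /pull_after S_overbid // mul0r.
- move=> /existsP[k' /andP[k'a sk]]; rewrite mulr1.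
  have [ka|ak] := leP (label A k) (D a); last by rewrite /pull_after S_overbid.
  by apply: (S_mean (i := i) _ _ ka k'a sk); rewrite !size_map.
- by rewrite mulr0.
Qed.

Lemma sigma_rcons i k a (h : seq round) e :
  sigma i k a (rcons h e) = sigma i k a h + utility T (size h) i (D a) k e.2.
Proof. by rewrite /sigma /bids_of map_rcons cumul_utility_rcons size_map. Qed.

Lemma sigma_ge0 i k a h : label A k <= D a -> 0 <= sigma i k a h.
Proof.
by move=> ka; rewrite /sigma cumul_utilityE /cum sumr_ge0 // => s _; exact: utility_ge0.
Qed.

(* every round in which a pair of arms is live widens the gap between them *)
Definition pair_gap a (k k' : 'I_K) : R :=
  Num.min (label A k' - label A k)
    (if label A k' < D a then D a - label A k' else 1) / n%:R.

(** Absolute values make all terms nonnegative, even for pairs in the wrong order, so each term is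
    at most the sum. *)
Definition pair_bound : R :=
  \sum_(a < m) \sum_(k < K) \sum_(k' < K) `|2 * (2 / pair_gap a k k' + 1)|.

Lemma pair_bound_ge0 : 0 <= pair_bound.
Proof. by do 3 (rewrite sumr_ge0 // => ? _). Qed.

(** The 1 in [pair_gap] is a placeholder: if k' leaves no margin, the second kind of live round does
    not occur. *)
Lemma pair_gap_gt0 (i : 'I_n) a k k' : label A k < label A k' -> 0 < pair_gap a k k'.
Proof.
move=> kk'; rewrite divr_gt0 ?ltr0n ?(leq_ltn_trans (leq0n i)) //.
rewrite lt_min subr_gt0 kk' /=; case: ifP => // k'a.
by rewrite subr_gt0.
Qed.

(** The rounds in which only k' wins form an interval, and so do the later ones in which both win.
    The difference [d] drifts down in the former and up in the latter, since a winning share is at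
    least 1/n; [count_in_band] applies to each. *)
Lemma close_pair_count i (h : seq round) a k k' : size h = T ->
  \sum_(0 <= s < T) (close_pair i (take s h) a k k')%:R <=
  `|2 * (2 / pair_gap a k k' + 1)| * (g * T%:R + 1).
Proof.
move=> sh; have M1 : 1 <= g * T%:R + 1 by rewrite lerDr mulr_ge0.
have M0 := le_trans ler01 M1.
have [kk'|k'k] := ltP (label A k) (label A k'); last first.
  rewrite big1 ?mulr_ge0 // => s _.
  by rewrite /close_pair /live_pair ltNge k'k.
have [k'a|ak'] := leP (label A k') (D a); last first.
  rewrite big1 ?mulr_ge0 // => s _.
  by rewrite /close_pair /live_pair (leNgt _ (D a)) ak' andbF.
have del0 := pair_gap_gt0 i a kk'.
have n0 : 0 < n%:R :> R by rewrite ltr0n (leq_ltn_trans (leq0n i)).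
pose d s := sigma i k a (take s h) - sigma i k' a (take s h).
have dS s : (s < T)%N -> d s.+1 = d s +
    (utility T s i (D a) k (nth (round0 A) h s).2 -
     utility T s i (D a) k' (nth (round0 A) h s).2).
  move=> sT; rewrite /d (take_nth (round0 A)) ?sh // !sigma_rcons.
  by rewrite size_take sh sT; ring.
have shareT s : n%:R^-1 <= bid_share r T s i (nth (round0 A) h s).2.
  exact: share_ge.
have gap1 : pair_gap a k k' <= (label A k' - label A k) / n%:R.
  by rewrite ler_wpM2r ?invr_ge0 ?(ltW n0) // ge_min lexx.
have rdecr s1 s2 : (s1 <= s2)%N -> (s2 < T)%N -> r T s2 <= r T s1.
  by move=> s12 s2T; apply: (uniA.1); rewrite s12.
have c1 : \sum_(s < T) ((r T s <= label A k) && (`|d s| <= g * T%:R + 1))%:R <=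
    2 * (g * T%:R + 1) / pair_gap a k k' + 1.
  apply: (@count_in_band _ d (fun s => r T s <= label A k)) => //.
    move=> s1 s2 s3 /andP[s12 s23] s3T rs1 _.
    by apply: le_trans rs1; apply: rdecr => //; exact: leq_ltn_trans s3T.
  move=> s sT rs; rewrite dS // lerD2l !(pyb_utility pybA uniA) // rs.
  rewrite (le_trans rs (ltW kk')) -mulrBl; apply: le_trans gap1 _.
  have -> : D a - label A k - (D a - label A k') = label A k' - label A k by ring.
  by rewrite ler_wpM2l // subr_ge0 ltW.
have c2 : \sum_(s < T) ([&& label A k < r T s, r T s <= label A k' & label A k' < D a] &&
      (`|- d s| <= g * T%:R + 1))%:R <= 2 * (g * T%:R + 1) / pair_gap a k k' + 1.
  apply: (@count_in_band _ (fun s => - d s)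
    (fun s => [&& label A k < r T s, r T s <= label A k' & label A k' < D a])) => //.
    move=> s1 s2 s3 /andP[s12 s23] s3T /and3P[_ rs1 k'a'] /and3P[rs3 _ _].
    rewrite k'a' (lt_le_trans rs3) ?(le_trans _ rs1) ?rdecr //.
    exact: leq_ltn_trans s3T.
  move=> s sT /and3P[krs rsk' k'a'] /=; rewrite dS // [- (d s + _)]opprD lerD2l.
  rewrite !(pyb_utility pybA uniA) // rsk'.
  rewrite [r T s <= label A k]leNgt krs /= mulr0 sub0r opprK.
  apply: (@le_trans _ _ ((D a - label A k') / n%:R)).
    by rewrite ler_wpM2r ?invr_ge0 ?(ltW n0) // ge_min k'a' lexx orbT.
  by rewrite ler_wpM2l // subr_ge0.
rewrite big_mkord; apply: le_trans (_ : \sum_(s < T)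
  (((r T s <= label A k) && (`|d s| <= g * T%:R + 1))%:R +
   ([&& label A k < r T s, r T s <= label A k' & label A k' < D a] &&
      (`|- d s| <= g * T%:R + 1))%:R) <= _).
  apply: ler_sum => s _; rewrite /close_pair /live_pair normrN.
  rewrite size_take sh ltn_ord kk' k'a /= -/(d s).
  case: (_ <= _ + 1); rewrite ?andbF ?andbT ?addr0 //.
  by case: (r T s <= label A k) => //=; rewrite ?lerDl ?add0r.
rewrite big_split /=; apply: le_trans (lerD c1 c2) _.
apply: le_trans (ler_wpM2r M0 (ler_norm _)).
have : 0 <= (pair_gap a k k')^-1 by rewrite invr_ge0 ltW.
nra.
Qed.

Lemma close_call_count i (h : seq round) a : size h = T ->
  cum (fun h _ => (close_call i h a)%:R) h <= pair_bound * (g * T%:R + 1).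
Proof.
move=> sh; have M0 : 0 <= g * T%:R + 1 by rewrite addr_ge0 ?mulr_ge0.
apply: le_trans (_ : \sum_k \sum_k' \sum_(0 <= s < T)
    (close_pair i (take s h) a k k')%:R <= _).
  rewrite /cum sh; under [leRHS]eq_bigr do rewrite exchange_big.
  rewrite exchange_big /=; apply: ler_sum => s _.
  have [/existsP[k /existsP[k' kk']]|_] := boolP (close_call _ _ _); last first.
    by do 2 (rewrite sumr_ge0 // => ? _).
  rewrite (bigD1 k) //= (bigD1 k') //= kk' -addrA lerDl addr_ge0 //.
    by rewrite sumr_ge0.
  by do 2 (rewrite sumr_ge0 // => ? _).
rewrite /pair_bound (bigD1 a) //= mulrDl -[leLHS]addr0 lerD //; last first.
  by rewrite mulr_ge0 //; do 3 (rewrite sumr_ge0 // => ? _).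
rewrite big_distrl; apply: ler_sum => k _; rewrite big_distrl; apply: ler_sum => k' _.
exact: close_pair_count.
Qed.

(** An arm below the reserve has earned 0. Unless the pull is bad, the profitable arm is at most gT
    ahead of it, and then the two form a close live pair. *)
Lemma mismatch_le h (e : round) : (size h < T)%N -> mismatch r T h e <=
  \sum_(i < n) ((bad_pull i h (e.1 i) (e.2 i))%:R + (close_call i h (e.1 i))%:R).
Proof.
move=> hT; apply: ler_sum => i _; set a := e.1 i; set k := e.2 i.
case: eqP => [_|/eqP neq]; first by rewrite addr_ge0.
case: (boolP (bad_pull i h a k)) => [_|nbad]; first by rewrite lerDl.
rewrite add0r /=; case: (boolP (close_call i h a)) => // nclose; exfalso.
move: nbad; rewrite negb_or -leNgt negb_exists => /andP[ka /forallP nbad].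
case: (leP (r T (size h)) (D a)) neq => ra; last first.
  by rewrite leNgt (le_lt_trans ka ra).
case: leP => // kr _.
have [r0|[k' rk' k'a]] := profitable hT ra.
  by move: kr; rewrite ltNge (le_trans r0) ?label_ge0.
move/negP: nclose; apply; apply/existsP; exists k; apply/existsP; exists k'.
rewrite /close_pair /live_pair (lt_le_trans kr) // (ltW k'a) kr rk' k'a orbT /=.
have s0 : sigma i k a h = 0 by exact: (cumul_utility_below pybA uniA).
have := nbad k'; rewrite (ltW k'a) /= -leNgt s0 sub0r normrN.
by rewrite ger0_norm ?sigma_ge0 ?(ltW k'a) //; lra.
Qed.

Definition error_bound : R := n%:R * (K%:R + m%:R * pair_bound).

Lemma close_call_bound i : Ex S T (cum (fun h e => (close_call i h (e.1 i))%:R)) <=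
  m%:R * pair_bound * (g * T%:R + 1).
Proof.
rewrite -[leRHS](Ex_const S T); apply: Ex_le => h sh.
apply: le_trans (_ : \sum_a cum (fun h _ => (close_call i h a)%:R) h <= _).
  rewrite -cum_sum; apply: cum_le => h' e _.
  by rewrite (bigD1 (e.1 i)) //= lerDl sumr_ge0.
apply: le_trans (ler_sum _ (fun a _ => close_call_count i a sh)) _.
by rewrite sumr_const card_ord -mulrA mulr_natl.
Qed.

Lemma bad_pull_bound i : Ex S T (cum (fun h e => (bad_pull i h (e.1 i) (e.2 i))%:R)) <=
  K%:R * (g * T%:R + 1).
Proof.
apply: le_trans (_ : Ex S T (cum (fun _ _ => K%:R * g)) <= _).
  by apply: Ex_cum_le => h hT; rewrite Estep_const bad_pull_prob.
rewrite (Ex_cum_time S T (fun _ => K%:R * g)) sumr_const card_ord -[_ *+ T]mulr_natr -mulrA.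
by rewrite ler_wpM2l // lerDl.
Qed.

Lemma mismatch_bound :
  Ex S T (cum (mismatch r T)) <= error_bound * (g * T%:R + 1).
Proof.
apply: le_trans (_ : Ex S T (cum (fun h e => \sum_(i < n)
  ((bad_pull i h (e.1 i) (e.2 i))%:R + (close_call i h (e.1 i))%:R))) <= _).
  by apply: Ex_le => h sh; apply: cum_le => h' e h'h; apply: mismatch_le; rewrite -sh.
rewrite (@eq_Ex _ _ _ _ _ _ T _ (fun h => \sum_(i < n)
  (cum (fun h e => (bad_pull i h (e.1 i) (e.2 i))%:R) h +
   cum (fun h e => (close_call i h (e.1 i))%:R) h))); last first.
  by move=> h _; rewrite cum_sum; apply: eq_bigr => i _; rewrite cumD.
rewrite (Ex_sum S T predT) /error_bound -mulrA.
rewrite -[n in n%:R * _]card_ord mulr_natl -sumr_const; apply: ler_sum => i _.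
by rewrite ExD mulrDl lerD ?bad_pull_bound ?close_call_bound.
Qed.

(** The base value 0 of the maximum is harmless: the arm 0 is available to every value and never
    loses. *)
Definition best i (a : 'I_m) h : R :=
  \big[Num.max/0]_(k | label A k <= D a) sigma i k a h.

Lemma best_ge i k a h : label A k <= D a -> sigma i k a h <= best i a h.
Proof. by move=> ka; rewrite /best (le_bigmax_cond _ (fun k => sigma i k a h)). Qed.

Lemma best_ex i a h : exists2 k, label A k <= D a & best i a h = sigma i k a h.
Proof.
have za : label A (zero_arm A) <= D a by rewrite label_zero val_ge0.
have [b0|//] : best i a h = 0 \/
    exists2 k, label A k <= D a & best i a h = sigma i k a h.
  rewrite /best; elim/big_ind : _ => [|x y Hx Hy|k ka]; first by left.
    by case: (leP x y).
  by right; exists k.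
exists (zero_arm A) => //; apply: le_anti.
by rewrite best_ge // b0 sigma_ge0.
Qed.

Definition best_incr i a h e : R := best i a (rcons h e) - best i a h.

Lemma cum_best_incr i a h : cum (best_incr i a) h = best i a h.
Proof.
elim/last_ind: h => [|h e IH]; last by rewrite cum_rcons IH /best_incr addrC subrK.
have [k _ ->] := best_ex i a [::].
by rewrite cum_nil /sigma cumul_utility_nil.
Qed.

(** Nearly tied arms in a round without close call do not form a live pair, and outside live pairs
    both earn 0. *)
Lemma not_close_utility0 i h a k k' b : (size h < T)%N -> ~~ close_call i h a ->
    label A k <= D a -> label A k' <= D a -> k != k' ->
    `|sigma i k a h - sigma i k' a h| <= g * T%:R + 1 ->
  utility T (size h) i (D a) k b = 0 /\ utility T (size h) i (D a) k' b = 0.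
Proof.
move=> hT nclose.
wlog kk' : k k' / label A k < label A k'.
  move=> IH ka k'a kn sk; case: (ltgtP (label A k) (label A k')) => [lt|lt|eq].
  - exact: (IH k k').
  - have [] := IH k' k lt k'a ka; last by [].
      by rewrite eq_sym.
    by rewrite distrC.
  - by rewrite (label_inj eq) eqxx in kn.
move=> ka k'a _ sk; rewrite !(pyb_utility pybA uniA) //.
have : ~~ live_pair (r T (size h)) a k k'.
  apply: contra nclose => live; apply/existsP; exists k; apply/existsP; exists k'.
  by rewrite /close_pair live.
rewrite /live_pair kk' k'a /= negb_or => /andP[rk].
rewrite (negPf rk) mulr0 ltNge rk /= => nlive; split=> //.
case: ifP nlive => [_ /= |_ _]; last by rewrite mulr0.
by rewrite -leNgt => ak'; rewrite (le_anti (introT andP (conj k'a ak'))) subrr mul0r.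
Qed.

Lemma best_incr_range i a h e : (0 <= best_incr i a h e <= 1).
Proof.
rewrite /best_incr subr_ge0 lerBlDr; apply/andP; split.
  have [k ka ->] := best_ex i a h; apply: le_trans (best_ge i _ ka).
  by rewrite sigma_rcons lerDl utility_ge0.
have [k ka ->] := best_ex i a (rcons h e); rewrite sigma_rcons addrC.
by rewrite lerD ?utility_le1 ?best_ge.
Qed.

(** Apart from bad pulls and close calls the two quantities agree: the pulled arm is within gT of
    the leader and the next leader within 1 of it, so if one of them differs from the leader, it
    earns 0 and so does the leader. *)
Lemma best_incr_close i a h k e : (size h < T)%N ->
  `|utility T (size h) i (D a) k e.2 - best_incr i a h e| <=
  2 * (bad_pull i h a k)%:R + (close_call i h a)%:R.
Proof.
move=> hT; have /andP[inc0 inc1] := best_incr_range i a h e.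
case: (boolP (bad_pull i h a k)) => [_|].
  apply: le_trans (_ : 2 <= _); last by rewrite mulr1 lerDl.
  have : `|utility T (size h) i (D a) k e.2| <= 1.
    rewrite (pyb_utility pybA uniA) //; case: ifP => _; last by rewrite mulr0 normr0.
    rewrite normrM; apply: mulr_ile1 => //; last first.
      by rewrite ger0_norm ?share_ge0 ?share_le1.
    rewrite ler_norml.
    have := val_ge0 D a; have := val_le1 D a.
    by have := label_ge0 k; have := label_le1 k; lra.
  by rewrite !ler_norml; lra.
rewrite negb_or -leNgt negb_exists => /andP[ka /forallP nbad]; rewrite mulr0 add0r.
have near_best k' : label A k' <= D a -> sigma i k' a h - g * T%:R <= sigma i k a h.
  by move=> k'a; have := nbad k'; rewrite k'a /= -leNgt.
have uk0 := utility_ge0 T (size h) i e.2 ka; have uk1 := utility_le1 T (size h) i a k e.2.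
case: (boolP (close_call i h a)) => [_|nclose].
  by rewrite /= ler_norml; lra.
have gT : 0 <= g * T%:R by rewrite mulr_ge0.
suff -> : best_incr i a h e = utility T (size h) i (D a) k e.2.
  by rewrite subrr normr0.
have [k1 k1a b1] := best_ex i a h; have [k2 k2a b2] := best_ex i a (rcons h e).
have u2 := utility_le1 T (size h) i a k2 e.2.
have u20 := utility_ge0 T (size h) i e.2 k2a.
have u10 := utility_ge0 T (size h) i e.2 k1a.
have g2 := best_ge i h k2a; have g1 := best_ge i (rcons h e) k1a.
rewrite b1 in g2; rewrite b2 !sigma_rcons in g1.
rewrite /best_incr b1 b2 sigma_rcons.
have [E|n21] := eqVneq k2 k1.
  rewrite E addrAC subrr add0r; have [->//|n1] := eqVneq k k1.
  have [|-> ->//] := @not_close_utility0 i h a k k1 e.2 hT nclose ka k1a n1.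
  have := near_best k1 k1a; have := best_ge i h ka; rewrite b1 ler_norml; lra.
have [|u2z u1z] := @not_close_utility0 i h a k2 k1 e.2 hT nclose k2a k1a n21.
  by rewrite ler_norml; lra.
have -> : sigma i k2 a h = sigma i k1 a h by apply: le_anti; rewrite g2 /=; lra.
rewrite u2z addr0 subrr; have [->|n1] := eqVneq k k1; first by rewrite u1z.
have [|-> //] := @not_close_utility0 i h a k k1 e.2 hT nclose ka k1a n1.
by have := near_best k1 k1a; have := best_ge i h ka; rewrite b1 ler_norml; lra.
Qed.

Definition utility_error : R := 2 * K%:R + m%:R * pair_bound.

Lemma best_incr_set_buyer i j h (e : round) a k :
  best_incr i j h (set_buyer e i a k) = best_incr i j h e.
Proof.
rewrite /best_incr /best; congr (_ - _); apply: eq_bigr => k' _.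
by rewrite !sigma_rcons utility_deviate.
Qed.

(** The increment of [best] involves neither the own value nor the own bid of the round, so the
    event of having value w_j factors out; the increments then telescope. *)
Lemma utility_close_best i j :
  `|Ex S T (cum (fun h e => (e.1 i == j)%:R *
      utility T (size h) i (D j) (e.2 i) e.2)) - prob_of D j * Ex S T (best i j)| <=
  utility_error * (g * T%:R + 1).
Proof.
have -> : prob_of D j * Ex S T (best i j) =
    Ex S T (cum (fun h e => (e.1 i == j)%:R * best_incr i j h e)).
  rewrite -ExZ (@eq_Ex _ _ _ _ _ _ T _
    (cum (fun h e => prob_of D j * best_incr i j h e))); last first.
    by move=> h _; rewrite cumZ cum_best_incr.
  apply: Ex_cum_eq => h _; rewrite [RHS](Estep_resample S h i); apply: eq_Estep => e.
  rewrite (bigD1 j) //= [X in _ = _ + X]big1 ?addr0 => [|a /negPf aj]; last first.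
    by rewrite big1 ?mulr0 // => k _; rewrite ffunE eqxx aj mul0r mulr0.
  congr (_ * _); rewrite -[LHS]mul1r.
  rewrite -[X in X * _ = _](pull_after_sum1 S h i j) big_distrl /=.
  apply: eq_bigr => k _; congr (_ * _).
  by rewrite set_coord_eq eqxx mul1r best_incr_set_buyer.
apply: le_trans (_ : Ex S T (cum (fun h e =>
  2 * (bad_pull i h (e.1 i) (e.2 i))%:R + (close_call i h (e.1 i))%:R)) <= _).
  apply: Ex_cum_close => h e hT; rewrite -mulrBr normrM.
  case: (altP (e.1 i =P j)) => [<-|_].
    by rewrite normr1 mul1r best_incr_close.
  by rewrite normr0 mul0r addr_ge0 ?mulr_ge0.
rewrite (@eq_Ex _ _ _ _ _ _ T _ (fun h =>
  2 * cum (fun h e => (bad_pull i h (e.1 i) (e.2 i))%:R) h +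
   cum (fun h e => (close_call i h (e.1 i))%:R) h)); last first.
  by move=> h _; rewrite cumD cumZ.
rewrite ExD ExZ /utility_error [leRHS]mulrDl; apply: lerD; last exact: close_call_bound.
by rewrite -mulrA ler_wpM2l ?bad_pull_bound.
Qed.

(** Two replacements: bids by values, which costs [mismatch], and the share determined by the
    rivals' fresh values by its mean, which leaves a martingale. *)
Lemma sigma_close i j k : (0 < T)%N -> label A k <= D j ->
  Ex S T (fun h => `|sigma i k j h -
    (D j - label A k) * ideal_total D r T i (label A k)|) <=
  error_bound * (g * T%:R + 1) + Num.sqrt T%:R.
Proof.
move=> T0 kj; pose c (h : seq round) (e : round) :=
  if r T (size h) <= label A k then bid_share r T (size h) i e.2 else 0.
pose phi (h : seq round) (e : round) := if r T (size h) <= label A k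
  then val_share D r T (size h) i e.1 - mean_share D r T (size h) i else 0.
have dj : 0 <= D j - label A k <= 1.
  by rewrite subr_ge0 kj lerBlDr ler_wpDr ?label_ge0 ?val_le1.
apply: le_trans (_ : Ex S T (fun h => cum (mismatch r T) h + `|cum phi h|) <= _).
  apply: Ex_le => h sh; have -> : sigma i k j h = (D j - label A k) * cum c h.
    rewrite /sigma cumul_utilityE -cumZ /cum; apply: eq_big_nat => s /andP[_ sh'].
    by rewrite (pyb_utility pybA uniA) // size_take sh' -sh.
  have -> : ideal_total D r T i (label A k) = cum (fun h _ =>
      if r T (size h) <= label A k then mean_share D r T (size h) i else 0) h.
    by rewrite (cum_time (fun t => if r T t <= label A k then mean_share D r T t i else 0)) sh.
  rewrite -mulrBr normrM; case/andP: dj => dj0 dj1.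
  apply: le_trans (ler_piMl (normr_ge0 _) _) _; first by rewrite ger0_norm.
  rewrite /cum -sumrB.
  apply: le_trans (_ : `|\sum_(0 <= s < size h)
     ((c (take s h) (nth (round0 A) h s) -
       (if r T (size (take s h)) <= label A k then
        val_share D r T (size (take s h)) i (nth (round0 A) h s).1 else 0)) +
     phi (take s h) (nth (round0 A) h s))| <= _).
    rewrite le_eqVlt; apply/orP; left; apply/eqP; congr `|_|; apply: eq_bigr => s _.
    by rewrite /c /phi; case: ifP => _; ring.
  rewrite big_split /=; apply: le_trans (ler_normD _ _) _; rewrite lerD2r.
  apply: le_trans (ler_norm_sum _ _ _) _; apply: ler_sum => s _; rewrite /c.
  case: ifP => _; first exact: bid_share_close.
  by rewrite subrr normr0 mismatch_ge0.
rewrite ExD; apply: lerD; first exact: mismatch_bound.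
apply: Ex_martingale_norm => // [h hT|h e].
  rewrite /phi; case: (r T (size h) <= label A k); last exact: Estep_const.
  rewrite EstepD (Estep_vals S h (val_share D r T (size h) i)) Estep_const.
  by rewrite /mean_share subrr.
rewrite /phi; case: ifP => _; last by rewrite normr0 ler01.
have w0 (v : {ffun 'I_n -> 'I_m}) : 0 <= \prod_(i' < n) prob_of D (v i').
  by apply: prodr_ge0 => i' _; rewrite ltW ?prob_gt0.
have v0 : 0 <= val_share D r T (size h) i e.1 by exact: share_ge0.
have v1 : val_share D r T (size h) i e.1 <= 1 by exact: share_le1.
have m0 : 0 <= mean_share D r T (size h) i.
  by apply: sumr_ge0 => v _; rewrite mulr_ge0 ?share_ge0.
have m1 : mean_share D r T (size h) i <= 1.
  rewrite -[leRHS](Evals_const n D); apply: ler_sum => v _.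
  by rewrite ler_wpM2l ?share_le1.
by rewrite ler_norml; lra.
Qed.

(* Following the leader earns what the best arm in hindsight earns. *)
Definition ideal_utility (i : 'I_n) (j : 'I_m) : R := \big[Num.max/0]_(k | label A k <= D j)
  ((D j - label A k) * ideal_total D r T i (label A k)).

Lemma avgU_close i j : (0 < T)%N ->
  `|avgU T S i j - T%:R^-1 * ideal_utility i j| <= T%:R^-1 *
  (utility_error * (g * T%:R + 1) / prob_of D j +
   K%:R * (error_bound * (g * T%:R + 1) + Num.sqrt T%:R)).
Proof.
move=> T0; have q0 := prob_gt0 D j.
rewrite avgUE -mulrBr normrM ger0_norm ?invr_ge0 ?ler0n //.
rewrite ler_wpM2l ?invr_ge0 ?ler0n //.
apply: le_trans (ler_distD (Ex S T (best i j)) _ _) _; apply: lerD.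
  rewrite -[X in _ - X](mulKf (lt0r_neq0 q0)) [X in _ - X]mulrC -mulrBl normrM.
  rewrite [X in _ * X]ger0_norm ?invr_ge0 ?(ltW q0) // ler_wpM2r ?invr_ge0 ?(ltW q0) //.
  exact: utility_close_best.
rewrite -[X in _ - X](Ex_const S T) -ExB; apply: le_trans (Ex_norm _ _ _) _.
apply: le_trans (_ : Ex S T (fun h => \sum_(k | label A k <= D j)
  `|sigma i k j h - (D j - label A k) * ideal_total D r T i (label A k)|) <= _).
  by apply: Ex_le => h _; exact: bigmax_dist.
have E0 : 0 <= error_bound * (g * T%:R + 1) + Num.sqrt T%:R.
  by rewrite addr_ge0 ?sqrtr_ge0 // mulr_ge0 ?addr_ge0 ?mulr_ge0 ?addr_ge0 ?mulr_ge0 ?pair_bound_ge0.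
rewrite Ex_sum -[K in leRHS]card_ord mulr_natl -sumr_const big_mkcond.
by apply: ler_sum => k _; case: ifP => // kj; exact: sigma_close.
Qed.

End MeanBasedDynamics.

(** * Feasibility from error bounds at fixed horizons *)

Section FeasibleBounds.
Variables (R : realType) (n m : nat) (D : valdist R m) (A : auction n D).

(** The constant is uniform in horizon, rate and strategies; an admissible rate then absorbs the
    sampling term T^(-1/2). *)
Lemma feasible_of_bounds x y u (C : R) :
    (forall T g S i j, (0 < T)%N -> 0 <= g ->
      (forall i, never_overbids (S i)) -> (forall i, mean_based T g i (S i)) ->
      let err := C * (g + (Num.sqrt T%:R)^-1) in
      [/\ `|avgX (A := A) T S i j - x j| <= err, `|avgY (A := A) T S i j - y j| <= err &
          `|avgU (A := A) T S i j - u j| <= err]) ->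
  feasible A x y u.
Proof.
move=> bnd gamma [gamma0 _ /eqO_exP [c c0 gammaO]] S cleverS meanS i j.
have O (f : nat -> R) : (forall T, (0 < T)%N ->
    `|f T| <= C * (gamma T + (Num.sqrt T%:R)^-1)) -> f =O_\oo gamma.
  move=> fC; apply/eqO_exP; exists (`|C| * (1 + c) + 1).
    by rewrite ltr_wpDl // mulr_ge0 // addr_ge0 // ltW.
  near=> T; have T0 : (0 < T)%N by near: T; exact: nbhs_infty_gt.
  have g0 := gamma0 T; rewrite (ger0_norm g0).
  have : `|(Num.sqrt (T%:R : R))^-1| <= c * `|gamma T| by near: T.
  rewrite (ger0_norm g0) ger0_norm ?invr_ge0 ?sqrtr_ge0 // => sT.
  apply: le_trans (fC T T0) _; apply: le_trans (ler_wpM2r _ (ler_norm C)) _.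
    by rewrite addr_ge0 ?invr_ge0 ?sqrtr_ge0.
  have := normr_ge0 C; nra.
have overbid T i' : never_overbids (S T i') by have [] := cleverS i'.
by split; apply: O => T T0;
   have [] := bnd T (gamma T) (S T) i j T0 (gamma0 T) (overbid T) (meanS T).
Unshelve. all: by end_near. Qed.

(** The limit [Z] of the allocation is needed at all arms, since the best bid of a value may be an
    arm between the values. *)
Lemma pyb_feasible r (Z : R -> R) (C0 : R) : (0 < n)%N ->
    pay_your_bid A -> uniform_declining_reserve A r ->
    (forall k, label A k <= 1) ->
    (forall T t a, (t < T)%N -> r T t <= D a ->
      r T t <= 0 \/ exists2 k, r T t <= label A k & label A k < D a) ->
    (forall T (i : 'I_n) k, (0 < T)%N ->
      `|T%:R^-1 * ideal_total D r T i (label A k) - Z (label A k)| <=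
      C0 * (Num.sqrt T%:R)^-1) ->
  feasible A (fun j => Z (D j)) (fun j => Z (D j))
    (fun j => \big[Num.max/0]_(k | label A k <= D j)
       ((D j - label A k) * Z (label A k))).
Proof.
move=> n0 pybA uniA lab1 prof Zlim; set K : R := (arms A)%:R.
have C00 : 0 <= C0.
  have := Zlim 1%N (Ordinal n0) (zero_arm A) isT; rewrite sqrtr1 invr1 mulr1.
  exact: le_trans.
pose E := error_bound A; pose E' := utility_error A.
have E0 : 0 <= E by rewrite /E /error_bound !(mulr_ge0, addr_ge0) ?pair_bound_ge0.
have E'0 : 0 <= E' by rewrite /E' /utility_error !(mulr_ge0, addr_ge0) ?pair_bound_ge0.
have q0 j := prob_gt0 D j.
pose Q : R := \sum_(j < m) (prob_of D j)^-1.
have qQ j : (prob_of D j)^-1 <= Q.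
  by rewrite /Q (bigD1 j) //= lerDl sumr_ge0 // => a _; rewrite invr_ge0 ltW.
have q'0 j : 0 <= (prob_of D j)^-1 by rewrite invr_ge0 ltW.
(* Q bounds every 1/q_j, E comes from mismatches, E' from the loss against the best arm, C0 from
   [Z]; each of the K arms adds a concentration error. *)
apply: (@feasible_of_bounds _ _ _ ((E + E') * Q + E + C0 + K * (E + 1 + C0))).
move=> T g S i j T0 g0 over mean /=; set s := Num.sqrt T%:R.
have T0' : 0 < T%:R :> R by rewrite ltr0n.
have s1 : 1 <= s by rewrite -[leLHS]sqrtr1 ler_wsqrtr // (ler_nat _ 1).
have s0 := lt_le_trans ltr01 s1.
have s2 : T%:R = s * s by rewrite -expr2 sqr_sqrtr ?ler0n.
set w := g + s^-1.
have w0 : 0 <= w by rewrite addr_ge0 // invr_ge0 ltW.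
have K0 : 0 <= K by exact: ler0n.
have sw : s^-1 <= w by rewrite lerDr.
have Q0 : 0 <= Q by exact: le_trans (q'0 j) (qQ j).
have gTw : T%:R^-1 * (g * T%:R + 1) <= w.
  rewrite mulrDr mulr1 mulrCA mulVf ?gt_eqF // mulr1 lerD2l s2 invfM.
  by rewrite ler_piMl ?invr_ge0 ?(ltW s0) // invf_le1.
have mm : T%:R^-1 * Ex S T (cum (mismatch r T)) <= E * w.
  apply: le_trans (_ : T%:R^-1 * (E * (g * T%:R + 1)) <= _).
    by rewrite ler_wpM2l ?invr_ge0 ?(ltW T0') //; exact: mismatch_bound.
  by rewrite mulrCA ler_wpM2l.
have Zj : `|T%:R^-1 * ideal_total D r T i (D j) - Z (D j)| <= C0 * w.
  rewrite -(label_val A j); apply: le_trans (Zlim T i _ T0) _.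
  by rewrite ler_wpM2l.
have EQw := mulr_ge0 (mulr_ge0 E0 Q0) w0.
have E'Qw := mulr_ge0 (mulr_ge0 E'0 Q0) w0.
have KEw := mulr_ge0 (mulr_ge0 K0 E0) w0.
have KCw := mulr_ge0 (mulr_ge0 K0 C00) w0.
have Kw := mulr_ge0 K0 w0.
have Ew := mulr_ge0 E0 w0.
have Cw := mulr_ge0 C00 w0.
split.
- apply: le_trans (ler_distD (T%:R^-1 * ideal_total D r T i (D j)) _ _) _.
  have : `|avgX T S i j - T%:R^-1 * ideal_total D r T i (D j)| <= E * Q * w.
    apply: le_trans (avgX_close uniA T S i j) _; rewrite mulrA.
    apply: le_trans (ler_wpM2r (q'0 j) mm) _.
    by rewrite mulrAC; apply: ler_wpM2r => //; apply: ler_wpM2l.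
  by move: Zj; lra.
- apply: le_trans (ler_distD (T%:R^-1 * ideal_total D r T i (D j)) _ _) _.
  have := le_trans (avgY_close uniA T S i j) mm.
  by move: Zj; lra.
apply: le_trans (ler_distD (T%:R^-1 * ideal_utility A r T i j) _ _) _.
have U1 : `|avgU T S i j - T%:R^-1 * ideal_utility A r T i j| <=
    E' * Q * w + K * (E + 1) * w.
  apply: le_trans (avgU_close pybA uniA lab1 prof g0 over mean i j T0) _.
  rewrite -/s -/E -/E' -/K mulrDr lerD //.
    have -> : T%:R^-1 * (E' * (g * T%:R + 1) / prob_of D j) =
        E' * ((prob_of D j)^-1 * (T%:R^-1 * (g * T%:R + 1))) by ring.
    rewrite -mulrA; apply: ler_wpM2l => //; apply: ler_pM => //.
    by rewrite mulr_ge0 ?invr_ge0 ?(ltW T0') ?addr_ge0 ?mulr_ge0 ?(ltW T0').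
  rewrite mulrCA -mulrA ler_wpM2l // mulrDr mulrDl mul1r lerD //.
    by rewrite mulrCA ler_wpM2l.
  by rewrite s2 invfM -mulrA mulVf ?mulr1 // gt_eqF.
have U2 : `|T%:R^-1 * ideal_utility A r T i j - \big[Num.max/0]_(k | label A k <= D j)
       ((D j - label A k) * Z (label A k))| <= K * C0 * w.
  rewrite (_ : T%:R^-1 * _ = \big[Num.max/0]_(k | label A k <= D j)
     (T%:R^-1 * ((D j - label A k) * ideal_total D r T i (label A k)))); last first.
    rewrite /ideal_utility; elim/big_rec2 : _ => [|k a b _ <-]; first by rewrite mulr0.
    by rewrite maxr_pMr // invr_ge0 ltW.
  apply: le_trans (bigmax_dist _ _ _) _.
  rewrite -mulrA /K -[arms A in leRHS]card_ord mulr_natl -sumr_const big_mkcond.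
  apply: ler_sum => k _; case: ifP => // kj.
  rewrite mulrCA -mulrBr normrM ger0_norm ?subr_ge0 //.
  apply: le_trans (ler_piMl (normr_ge0 _) _) _.
    by rewrite lerBlDr ler_wpDr ?label_ge0 ?val_le1.
  by apply: le_trans (Zlim T i k T0) _; rewrite ler_wpM2l.
by move: U1 U2; lra.
Qed.

End FeasibleBounds.

(** * Uniform auctions built from a list of labels *)

Section UniformAuction.
Variables (R : realType) (n m : nat) (D : valdist R m).
Variables (labels : seq R) (r : nat -> nat -> R).
Hypotheses (labels_uniq : uniq labels) (labels_ge0 : {in labels, forall b, 0 <= b}).
Hypotheses (zero_in : 0 \in labels) (val_in : forall j, D j \in labels).

Notation K := (size labels).

Let lab (k : 'I_K) : R := nth 0 labels k.

Definition uniform_alloc_rule (T t : nat) (b : bids n K) (i : 'I_n) : R :=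
  if r T t <= lab (b i)
  then (#|[set i' : 'I_n | r T t <= lab (b i')]%SET|%:R)^-1 else 0.

Definition uniform_pay_rule (T t : nat) (b : bids n K) (i : 'I_n) : R := lab (b i) * uniform_alloc_rule T t b i.

Let lab_ge0 k : 0 <= lab k.
Proof. by apply: labels_ge0; exact: mem_nth. Qed.

Let index_lt b (bP : b \in labels) : (index b labels < K)%N.
Proof. by rewrite index_mem. Qed.

Definition zero_index : 'I_K := Ordinal (index_lt zero_in).
Definition val_index j : 'I_K := Ordinal (index_lt (val_in j)).

Let lab_inj : injective lab.
Proof. by move=> k k' /eqP; rewrite nth_uniq // => /eqP/val_inj. Qed.

Let lab_zero : lab zero_index = 0. Proof. by rewrite /lab nth_index. Qed.

Let lab_val j : lab (val_index j) = D j. Proof. by rewrite /lab nth_index. Qed.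

Let alloc_share T t b i : uniform_alloc_rule T t b i =
  if r T t <= lab (b i) then share R (fun k => r T t <= lab k) i b else 0.
Proof. by rewrite /uniform_alloc_rule; case: ifP => // rb; rewrite share_in. Qed.

Let rule_ge0 T t b i : 0 <= uniform_alloc_rule T t b i.
Proof. by rewrite alloc_share; case: ifP => _ //; exact: share_ge0. Qed.

Let rule_le1 T t b i : uniform_alloc_rule T t b i <= 1.
Proof. by rewrite alloc_share; case: ifP => _ //; exact: share_le1. Qed.

Let rule_sum_le1 T t b : \sum_(i < n) uniform_alloc_rule T t b i <= 1.
Proof.
rewrite /uniform_alloc_rule -big_mkcond /= sumr_const.
set N := #|[set i' | _]%SET|.
have -> : #|[pred i | r T t <= lab (b i)]| = N by apply: eq_card => i; rewrite !inE.
have [->|N0] := posnP N; first by rewrite mulr0n ler01.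
by rewrite -[_ *+ N]mulr_natl divff // pnatr_eq0 -lt0n.
Qed.

Let rule_perm T t (s : {perm 'I_n}) b i :
  uniform_alloc_rule T t (permute_bids s b) i = uniform_alloc_rule T t b (s i).
Proof.
rewrite /uniform_alloc_rule ffunE; case: ifP => // _; congr (_%:R^-1).
rewrite -[in RHS](card_preimset _ (@perm_inj _ s)); apply: eq_card => i'.
by rewrite !inE ffunE.
Qed.

Let rule_deviate T t b i k : uniform_alloc_rule T t (deviate b i k) i =
  if r T t <= lab k then share R (fun k => r T t <= lab k) i b else 0.
Proof.
rewrite alloc_share ffunE eqxx; case: ifP => // _.
by apply: eq_share => i' /negPf ni; rewrite ffunE ni.
Qed.

Let rule_mono T t b i k k' : lab k <= lab k' ->
  uniform_alloc_rule T t (deviate b i k) i <= uniform_alloc_rule T t (deviate b i k') i.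
Proof.
move=> kk'; rewrite !rule_deviate; case: ifP => rk; last by case: ifP; rewrite ?share_ge0.
by rewrite (le_trans rk kk').
Qed.

Let rule_pay_ge0 T t b i : 0 <= uniform_pay_rule T t b i.
Proof. by rewrite mulr_ge0. Qed.

Let rule_pay_le T t b i : uniform_pay_rule T t b i <= lab (b i) * uniform_alloc_rule T t b i.
Proof. exact: lexx. Qed.

Let rule_pay_perm T t (s : {perm 'I_n}) b i :
  uniform_pay_rule T t (permute_bids s b) i = uniform_pay_rule T t b (s i).
Proof. by rewrite /uniform_pay_rule rule_perm ffunE. Qed.

Let rule_pay_mono T t b i k k' : lab k <= lab k' ->
  uniform_pay_rule T t (deviate b i k) i <= uniform_pay_rule T t (deviate b i k') i.
Proof.
by move=> kk'; rewrite /uniform_pay_rule !ffunE !eqxx; apply: ler_pM => //; exact: rule_mono.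
Qed.

Definition uniform_auction : auction n D := Auction lab_inj lab_ge0 lab_zero lab_val
  rule_ge0 rule_le1 rule_sum_le1 rule_pay_ge0 rule_pay_le rule_perm rule_pay_perm
  rule_mono rule_pay_mono.

Lemma uniform_auction_uniform :
    (forall T s t, (s <= t < T)%N -> r T t <= r T s) ->
  uniform_declining_reserve uniform_auction r.
Proof. by []. Qed.

End UniformAuction.

(** * Auctions with a prescribed schedule *)

(** T - t runs through 1, ..., T, so the sum is the integer part of x. *)
Lemma count_le (R : realType) (T : nat) (x : R) : 0 <= x <= T%:R ->
  `|\sum_(t < T) ((T - t)%:R <= x)%R%:R - x| <= 1.
Proof.
case/andP=> x0 xT; have -> : \sum_(t < T) ((T - t)%:R <= x)%R%:R =
    \sum_(t < T) (t.+1%:R <= x)%R%:R :> R.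
  rewrite (reindex_inj rev_ord_inj) /=; apply: eq_bigr => t _.
  by rewrite subKn.
have count_prefix (T' : nat) : \sum_(t < T') (t.+1%:R <= x)%R%:R <= x /\
    (\sum_(t < T') (t.+1%:R <= x)%R%:R = T'%:R :> R \/
     x < \sum_(t < T') (t.+1%:R <= x)%R%:R + 1).
  elim: T' => [|T' [IH1 IH2]].
    by rewrite big_ord0; split=> //; left.
  rewrite big_ord_recr /=; set N := \sum_(t < T') _ in IH1 IH2 *.
  have NT : N <= T'%:R.
    rewrite -[in leRHS](card_ord T') -sum1_card natr_sum; apply: ler_sum => t _.
    by rewrite lern1 leq_b1.
  have := natr1 T' : T'%:R + 1 = T'.+1%:R :> R; case: (leP T'.+1%:R x) => [Tx|x_lt] T1 /=.
    case: IH2 => [NT'|]; last by lra.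
    by split; [lra | left; lra].
  by rewrite addr0; split=> //; right; case: IH2 => [NT'|//]; lra.
by have := count_prefix T; rewrite ler_norml => -[? [?|?]]; lra.
Qed.

Section Schedule.
Variables (R : realType) (n m : nat) (D : valdist R m).
Hypothesis n0 : (0 < n)%N.

Lemma small_gap (e : R) : 0 < e -> exists e', [/\ 0 < e', e' <= e &
  forall j k : 'I_m, (j < k)%N -> e' < D k - D j].
Proof.
move=> e0; pose e' := \big[Num.min/e]_(p : 'I_m * 'I_m | (p.1 < p.2)%N) ((D p.2 - D p.1) / 2).
exists e'; split; first 1 last.
- exact: bigmin_le_id.
- move=> j k jk; have : e' <= (D k - D j) / 2.
    exact: (@bigmin_le_cond _ _ _ _ (j, k) (fun p => (p.1 < p.2)%N)
      (fun p => (D p.2 - D p.1) / 2)).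
  by have := val_lt D jk; lra.
rewrite /e'; elim/big_ind : _ => [//|x y x0 y0|[j k] /= jk].
  by rewrite lt_min x0 y0.
by rewrite divr_gt0 // subr_gt0 val_lt.
Qed.

Variables (l : 'I_m -> R) (eps : R).
Hypotheses (l0 : forall k, 0 <= l k) (l1 : \sum_k l k <= 1) (eps0 : 0 < eps).
Hypothesis eps_gap : forall j k : 'I_m, (j < k)%N -> eps < D k - D j.

Definition level_reserve k : R := Num.max 0 (D k - eps).

Let rho := level_reserve.

Lemma level_reserve_ge0 k : 0 <= rho k.
Proof. by rewrite le_max lexx. Qed.

Lemma level_reserve_ge k : D k - eps <= rho k.
Proof. by rewrite le_max lexx orbT. Qed.

Lemma level_reserve_le k : rho k <= D k.
Proof. by rewrite ge_max val_ge0 /= gerBl ltW. Qed.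

Lemma level_reserve_gt (j k : 'I_m) : (j < k)%N -> D j < rho k.
Proof. by move/eps_gap => jk; apply: lt_le_trans (level_reserve_ge k); lra. Qed.

Lemma level_reserve_le_val (j k : 'I_m) : (rho k <= D j) = (k <= j)%N.
Proof.
case: (leqP k j) => [kj|/level_reserve_gt jk]; last by rewrite leNgt jk.
by rewrite (le_trans (level_reserve_le k)) // val_le.
Qed.

Lemma level_reserve_mono (k k' : 'I_m) : (k <= k')%N -> rho k <= rho k'.
Proof.
rewrite leq_eqVlt => /predU1P[/val_inj ->//|/level_reserve_gt/ltW kk'].
exact: le_trans (level_reserve_le k) kk'.
Qed.

Lemma at_level_reserve k k' : at_level D (rho k) k' = (k' == k).
Proof.
have lk : at_level D (rho k) k.
  rewrite /at_level level_reserve_le; apply/forallP => j; apply/implyP.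
  exact: level_reserve_gt.
by apply/idP/eqP => [lk'|->//]; exact: at_level_uniq lk' lk.
Qed.

(** The reserve 2 marks rounds without sale, which fill the time that l leaves unallotted. *)
Lemma at_level_two k : at_level D 2 k = false.
Proof. by apply/negbTE; rewrite negb_and -ltNge (le_lt_trans (val_le1 D k)) ?ltr1n. Qed.

Definition due T t (k : 'I_m) : bool :=
  (T - t)%:R <= (\sum_(k' < m | (k' <= k)%N) l k') * T%:R.

(* High reserves come first: level k is reached when the remaining rounds fit
   into the time allotted to the levels up to k. *)
Definition level_at T t : option 'I_m :=
  [pick k | due T t k && [forall k' : 'I_m, (k' < k)%N ==> ~~ due T t k']].

Definition sched_reserve T t : R := if level_at T t is Some k then rho k else 2.

Let r := sched_reserve.

Lemma due_mono T t (k k' : 'I_m) : (k <= k')%N -> due T t k -> due T t k'.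
Proof.
move=> kk' /le_trans; apply; rewrite ler_wpM2r // [leRHS](bigID (fun a : 'I_m => (a <= k)%N)) /=.
rewrite ler_wpDr ?sumr_ge0 // le_eqVlt; apply/orP; left; apply/eqP.
by apply: eq_bigl => a; case: (leqP a k) => ak; rewrite ?andbF // (leq_trans ak kk').
Qed.

Lemma level_at_Some T t k : (level_at T t == Some k) =
  due T t k && [forall k' : 'I_m, (k' < k)%N ==> ~~ due T t k'].
Proof.
rewrite /level_at; case: pickP => [k1 /andP[d1 /forallP f1]|none]; last by rewrite none.
apply/eqP/andP => [[<-]|[d2 /forallP f2]]; first by split=> //; apply/forallP.
congr Some; apply/val_inj; case: (ltngtP k1 k) => // kk.
  by have := f2 k1; rewrite kk d1.
by have := f1 k; rewrite kk d2.
Qed.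

Lemma level_at_None T t k : level_at T t = None -> due T t k = false.
Proof.
move=> none; apply/negbTE/negP => dk.
case: (@arg_minnP _ k (due T t) val dk) => k1 d1 min1.
have := level_at_Some T t k1; rewrite none d1 /= => /esym/negP; apply.
apply/forallP => k2; apply/implyP => k21; apply: contraL k21 => d2.
by rewrite -leqNgt min1.
Qed.

Lemma sched_reserve_decr T s t : (s <= t < T)%N -> r T t <= r T s.
Proof.
case/andP=> st tT; have duet k : due T s k -> due T t k.
  by apply: le_trans; rewrite ler_nat leq_sub2l.
rewrite /r /sched_reserve; case Es: (level_at T s) => [k|]; last first.
  by case: (level_at T t) => [k|] //; rewrite (le_trans (level_reserve_le k)) //
    (le_trans (val_le1 D k)) // ler1n.
move/eqP: Es; rewrite level_at_Some => /andP[/duet dk _].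
case Et: (level_at T t) => [k'|]; last by rewrite (level_at_None k Et) in dk.
move/eqP: Et; rewrite level_at_Some => /andP[_ /forallP f'].
apply: level_reserve_mono; rewrite leqNgt; apply/negP => kk'.
by have := f' k; rewrite kk' dk.
Qed.

Lemma at_level_sched T t k : at_level D (r T t) k = (level_at T t == Some k).
Proof.
rewrite /r /sched_reserve; case: (level_at T t) => [k'|]; last by rewrite at_level_two.
by rewrite at_level_reserve eq_sym.
Qed.

(** Levels become due from the top down, so being at level k is a difference of two threshold
    conditions on the remaining time, each counted by [count_le]. *)
Lemma level_at_indicator T t k : (t < T)%N ->
  ((level_at T t == Some k)%:R : R) = (due T t k)%:R -
  ((T - t)%:R <= (\sum_(k' < m | (k' < k)%N) l k') * T%:R)%R%:R.
Proof.
move=> tT; rewrite level_at_Some.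
have -> : [forall k' : 'I_m, (k' < k)%N ==> ~~ due T t k'] =
    ~~ ((T - t)%:R <= (\sum_(k' < m | (k' < k)%N) l k') * T%:R).
  case: k => [[|k] km] /=.
    (* At the lowest level the threshold is the empty sum, and T - t is positive. *)
    rewrite big_pred0 // mul0r leNgt ltr0n subn_gt0 tT /=.
    exact/forallP.
  have kP : (k < m)%N by apply: ltnW.
  have -> : (\sum_(k' < m | (k' < k.+1)%N) l k') * T%:R =
    (\sum_(k' < m | (k' <= Ordinal kP)%N) l k') * T%:R by [].
  rewrite -/(due T t (Ordinal kP)); apply/forallP/idP => [/(_ (Ordinal kP))/implyP->//|nd k'].
  by apply/implyP => k'k; apply: contra nd; apply: due_mono.
case: (boolP (due T t k)) => [dk|ndk]; first by case: (_ <= _); rewrite ?subrr ?subr0.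
rewrite /=; case: leP => [le|]; last by rewrite subr0.
exfalso; move/negP: ndk; apply; apply: le_trans le _; rewrite ler_wpM2r //.
rewrite [leRHS](bigD1 k) //= ler_wpDl //.
rewrite le_eqVlt; apply/orP; left; apply/eqP; apply: eq_bigl => a.
by rewrite -(inj_eq val_inj) ltn_neqAle andbC.
Qed.

Lemma sched_level_count T k : `|(level_count D r T k)%:R - l k * T%:R| <= 2.
Proof.
have Tge : 0 <= T%:R :> R by [].
have sub1 (P : pred 'I_m) : 0 <= \sum_(k' | P k') l k' <= 1.
  rewrite sumr_ge0 //= (le_trans _ l1) // [leRHS](bigID P) /= lerDl.
  by rewrite sumr_ge0.
have c1 (P : pred 'I_m) : 0 <= (\sum_(k' | P k') l k') * T%:R <= T%:R.
  by have /andP[p0 p1] := sub1 P; rewrite mulr_ge0 //= ler_piMl.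
have -> : (level_count D r T k)%:R = \sum_(t < T)
    ((T - t)%:R <= (\sum_(k' < m | (k' <= k)%N) l k') * T%:R)%R%:R -
    \sum_(t < T) ((T - t)%:R <= (\sum_(k' < m | (k' < k)%N) l k') * T%:R)%R%:R :> R.
  rewrite -sumrB -(eq_bigr _ (fun t _ => level_at_indicator k (ltn_ord t))).
  rewrite /level_count -sum1_card natr_sum big_mkcond /=; apply: eq_bigr => t _.
  by rewrite inE at_level_sched; case: eqP.
have b1 := count_le (c1 (fun k' => (k' <= k)%N)).
have b2 := count_le (c1 (fun k' => (k' < k)%N)).
have lk : \sum_(k' < m | (k' <= k)%N) l k' = l k + \sum_(k' < m | (k' < k)%N) l k'.
  rewrite (bigD1 k) //=; congr (_ + _); apply: eq_bigl => a.
  by rewrite -(inj_eq val_inj) ltn_neqAle andbC.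
move: b1 b2; rewrite lk mulrDl !ler_norml; lra.
Qed.

Lemma sched_reserve_schedule : reserve_schedule D r l.
Proof.
move=> k; apply/cvgrPdist_le => e e_gt0.
exists (Num.truncn (2 / e)).+1 => // T /= NT.
have T0 : 0 < T%:R :> R by rewrite ltr0n (leq_trans _ NT).
have eT : 2 <= e * T%:R.
  rewrite -ler_pdivrMl // mulrC; apply: le_trans (ltW (truncnS_gt _)) _.
  by rewrite ler_nat.
have := sched_level_count T k; rewrite /level_count => cnt.
rewrite distrC -[X in _ - X](mulKf (lt0r_neq0 T0)) -mulrBr normrM.
rewrite ger0_norm ?invr_ge0 ?(ltW T0) // ler_pdivrMl // [X in _ - X]mulrC [leRHS]mulrC.
exact: le_trans cnt eT.
Qed.

(** Extends [sched_alloc] from values to all bids, as needed for the arms at the reserves. *)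
Definition sched_total (b : R) : R := \sum_(k | rho k <= b) l k * win_prob n D k.

Lemma sched_ideal T (i : 'I_n) b : (0 < T)%N -> b <= 1 ->
  `|T%:R^-1 * ideal_total D r T i b - sched_total b| <=
  (2 * m%:R) * (Num.sqrt T%:R)^-1.
Proof.
move=> T0 b1; set s := Num.sqrt T%:R.
have T0' : 0 < T%:R :> R by rewrite ltr0n.
have s1 : 1 <= s by rewrite -[leLHS]sqrtr1 ler_wsqrtr // (ler_nat _ 1).
have s0 := lt_le_trans ltr01 s1.
have s2 : T%:R = s * s by rewrite -expr2 sqr_sqrtr ?ler0n.
have -> : ideal_total D r T i b = \sum_k (level_count D r T k)%:R *
    (if rho k <= b then win_prob n D k else 0).
  rewrite sum_level_count; apply: eq_bigr => t _.
  have [k tk|tk] := pickP (at_level D (r T t)).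
    rewrite (sum_at_level _ tk) (mean_share_level i tk); congr (if _ then _ else _).
    by move: tk; rewrite at_level_sched /r /sched_reserve => /eqP ->.
  rewrite sum_no_level; last by move=> k; rewrite tk.
  have : level_at T t = None.
    case E: (level_at T t) => [k|] //.
    by have := tk k; rewrite at_level_sched E eqxx.
  rewrite /r /sched_reserve => ->; rewrite leNgt (le_lt_trans b1) ?ltr1n //.
rewrite /sched_total big_distrr [X in _ - X]big_mkcond -sumrB /=.
apply: le_trans (ler_norm_sum _ _ _) _.
have -> : 2 * m%:R * s^-1 = \sum_(k < m) (2 * s^-1).
  by rewrite sumr_const card_ord -[_ *+ m]mulr_natl; ring.
apply: ler_sum => k _; case: ifP => _; last first.
  by rewrite !mulr0 subrr normr0 mulr_ge0 // invr_ge0 ltW.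
rewrite mulrA -mulrBl normrM [X in _ * X]ger0_norm ?win_prob_ge0 //.
apply: le_trans (ler_piMr (normr_ge0 _) (win_prob_le1 _ _ _)) _ => //.
rewrite -[X in _ - X](mulKf (lt0r_neq0 T0')) -mulrBr normrM.
rewrite ger0_norm ?invr_ge0 ?(ltW T0') // [X in _ - X]mulrC.
apply: le_trans (ler_wpM2l _ (sched_level_count T k)) _; first by rewrite invr_ge0 ltW.
rewrite mulrC ler_wpM2l // s2 invfM ler_piMl ?invr_ge0 ?(ltW s0) //.
by rewrite invf_le1.
Qed.

Lemma sched_total_val j : sched_total (D j) = sched_alloc n D l j.
Proof. by apply: eq_bigl => k; exact: level_reserve_le_val. Qed.

(** Let k be the highest level that b reaches. Then b wins exactly as often as w_k and is at least
    w_k - [eps], so it gains at most [eps] over bidding w_k. *)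
Lemma sched_total_le M j b : b <= D j ->
    (forall k, (D j - D k) * sched_alloc n D l k <= M) ->
  (D j - b) * sched_total b <= M + eps.
Proof.
move=> bj HM; have [k0 k0b|none] := pickP (fun k => rho k <= b); last first.
  rewrite /sched_total big_pred0 // mulr0 addr_ge0 ?(ltW eps0) //.
  by have := HM j; rewrite subrr mul0r.
case: (@arg_maxnP _ k0 (fun k => rho k <= b) val k0b) => k kb kmax.
have -> : sched_total b = sched_alloc n D l k.
  apply: eq_bigl => k'; apply/idP/idP => [/kmax//|/level_reserve_mono/le_trans]; exact.
have x0 := sched_alloc_ge0 D k n0 l0; have x1 := sched_alloc_le1 D k n0 l0 l1.
have := HM k; have := level_reserve_ge k; rewrite -/rho => rk.
have : (D j - b) * sched_alloc n D l k <= (D j - D k + eps) * sched_alloc n D l k.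
  by rewrite ler_wpM2r //; move: kb => /=; lra.
rewrite [leRHS]mulrDl.
have : eps * sched_alloc n D l k <= eps by rewrite ler_piMr // ltW.
lra.
Qed.

(** Each reserve is itself an arm, so that a value meeting a positive reserve can win with a strict
    profit. *)
Definition sched_labels : seq R :=
  undup (0 :: [seq D j | j <- enum 'I_m] ++ [seq rho k | k <- enum 'I_m]).

Lemma sched_labels_range b : b \in sched_labels -> 0 <= b <= 1.
Proof.
rewrite mem_undup inE mem_cat => /or3P[/eqP->|/mapP[j _ ->]|/mapP[k _ ->]].
- by rewrite lexx ler01.
- by rewrite val_ge0 val_le1.
- by rewrite level_reserve_ge0 (le_trans (level_reserve_le k)) ?val_le1.
Qed.

Lemma sched_labels_ge0 : {in sched_labels, forall b, 0 <= b}.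
Proof. by move=> b /sched_labels_range/andP[]. Qed.

Lemma sched_labels_zero : 0 \in sched_labels.
Proof. by rewrite mem_undup inE eqxx. Qed.

Lemma sched_labels_val j : D j \in sched_labels.
Proof. by rewrite mem_undup inE mem_cat map_f ?orbT // mem_enum. Qed.

Lemma sched_labels_reserve k : rho k \in sched_labels.
Proof. by rewrite mem_undup inE mem_cat [X in _ || X]orbC map_f ?orbT // mem_enum. Qed.

Definition sched_auction : auction n D :=
  uniform_auction n r (undup_uniq _) sched_labels_ge0 sched_labels_zero sched_labels_val.

Lemma sched_auction_uniform : uniform_declining_reserve sched_auction r.
Proof. by apply: uniform_auction_uniform => T s t; exact: sched_reserve_decr. Qed.

Lemma sched_auction_feasible : exists u : 'I_m -> R,
  feasible sched_auction (fun j => sched_total (D j)) (fun j => sched_total (D j)) u /\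
  forall M j, (forall k, (D j - D k) * sched_alloc n D l k <= M) -> u j <= M + eps.
Proof.
pose A := sched_auction.
exists (fun j => \big[Num.max/0]_(k | label A k <= D j)
  ((D j - label A k) * sched_total (label A k))); split.
  have lab1 (k : 'I_(arms A)) : label A k <= 1.
    by have /andP[] := sched_labels_range (mem_nth 0 (ltn_ord k)).
  apply: (@pyb_feasible _ _ _ _ _ r sched_total (2 * m%:R)) => //.
  - exact: sched_auction_uniform.
  - move=> T t a tT; rewrite {1 2}/r /sched_reserve.
    case E: (level_at T t) => [k|]; last first.
      by rewrite leNgt (le_lt_trans (val_le1 D a)) ?ltr1n.
    (* A reserve truncated to 0 is met by every arm; otherwise it is an arm lying [eps] below
       w_k. *)
    move=> ka; have [k0|k0] := leP (D k - eps) 0.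
      by left; rewrite /rho /level_reserve ge_max lexx.
    right; have rkE : rho k = D k - eps by rewrite /rho /level_reserve; apply/max_idPr/ltW.
    have ri : (index (rho k) sched_labels < size sched_labels)%N.
      by rewrite index_mem sched_labels_reserve.
    exists (Ordinal ri).
      by rewrite /r /sched_reserve E /= nth_index ?sched_labels_reserve.
    rewrite /= nth_index ?sched_labels_reserve // rkE.
    rewrite level_reserve_le_val in ka; rewrite -(val_le D) in ka.
    by move: ka eps0; lra.
  - by move=> T i k T0; exact: sched_ideal.
move=> M j HM; elim/big_ind : _ => [|x y|k kj].
- by rewrite addr_ge0 ?(ltW eps0) //; have := HM j; rewrite subrr mul0r.
- by rewrite ge_max => -> ->.
- exact: sched_total_le.
Qed.

End Schedule.

Lemma sched_auction_revenue (R : realType) (n m : nat) (D : valdist R m)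
    (l M : 'I_m -> R) (eps : R) : (0 < n)%N -> 0 < eps ->
    (forall k, 0 <= l k) -> \sum_k l k <= 1 ->
    (forall j k, (D j - D k) * sched_alloc n D l k <= M j) ->
  exists (A : auction n D) (r : nat -> nat -> R) (x y u : 'I_m -> R),
    [/\ pay_your_bid A, uniform_declining_reserve A r, feasible A x y u,
        reserve_schedule D r l &
        n%:R * (\sum_j prob_of D j * (D j * sched_alloc n D l j - M j)) - eps <=
        revenue n D x u].
Proof.
move=> n0 eps0 l0 l1 HM; have n0' : 0 < n%:R :> R by rewrite ltr0n.
have [e [e0 e_eps e_gap]] := small_gap D (divr_gt0 eps0 n0').
have [u [fA uM]] := sched_auction_feasible n0 l0 l1 e0 e_gap.
exists (sched_auction n D l e0), (sched_reserve D l e).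
exists (fun j => sched_total n D l e (D j)), (fun j => sched_total n D l e (D j)), u.
split=> //.
- exact: sched_auction_uniform.
- exact: sched_reserve_schedule.
rewrite lerBlDr /revenue -[eps](mulfVK (lt0r_neq0 n0')) [eps / _ * _]mulrC -mulrDr.
rewrite ler_wpM2l // -lerBlDl.
apply: le_trans e_eps; rewrite -sumrB -[leRHS]mul1r -[X in _ <= X * _](prob_sum1 D) big_distrl /=.
apply: ler_sum => j _; rewrite -mulrBr ler_wpM2l ?(ltW (prob_gt0 _ _)) //.
rewrite sched_total_val //; have := uM _ _ (HM j); lra.
Qed.

(** * The linear program *)

Section LinearPrograms.
Variables (R : realType) (m n : nat) (D : valdist R m) (L : lp_template m).

Let linear_continuous N (a : 'I_N -> R) :
  continuous (fun v : 'rV[R]_N => \sum_c a c * v ord0 c).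
Proof.
apply: continuous_big => [|c _ v]; first exact: add_continuous.
apply: (@continuousM R 'rV[R]_N (fun=> a c) (fun v : 'rV[R]_N => v ord0 c)).
  exact: cst_continuous.
exact: coord_continuous.
Qed.

(** The feasible set may be unbounded. The extreme value theorem is applied inside the box, and
    domination makes the maximum found there global. *)
Lemma lp_optimum_exists (B : R) (z0 : 'I_(lp_vars L) -> R) :
    lp_feasible n D (L := L) z0 ->
    (forall z, lp_feasible n D (L := L) z -> exists z', [/\ lp_feasible n D (L := L) z',
       forall c, `|z' c| <= B &
       lp_value n D (L := L) z <= lp_value n D (L := L) z']) ->
  exists z, lp_optimal n D (L := L) z.
Proof.
move=> z0P dom; pose N := lp_vars L.
pose box := [set v : 'rV[R]_N | forall c, `[- B, B]%classic (v ord0 c)].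
pose F := \bigcap_(r in [set: 'I_(lp_rows L)]) [set v : 'rV[R]_N |
  \sum_c expr_eval n D (lp_mat r c) * v ord0 c <= expr_eval n D (lp_rhs r)].
have boxE z : (forall c, `|z c| <= B) -> box (\row_c z c).
  by move=> zB c; rewrite /= mxE in_itv /= -ler_norml.
have rowE (a z : 'I_N -> R) : \sum_c a c * (\row_c z c) ord0 c = \sum_c a c * z c.
  by apply: eq_bigr => c _; rewrite mxE.
have FE z : lp_feasible n D (L := L) z -> F (\row_c z c) by move=> zP r _ /=; rewrite rowE; exact: zP.
have cpt : compact (box `&` F).
  apply: (@subclosed_compact _ (box `&` F) box); last exact: subIsetl.
    apply: closedI.
      apply: compact_closed; first exact: norm_hausdorff.
      by apply: (@rV_compact _ N (fun=> `[- B, B]%classic)) => _; exact: segment_compact.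
    apply: closed_bigI => r _.
    apply: ((continuous_closedP _).1 (@linear_continuous N _) _
      (@closed_le R (expr_eval n D (lp_rhs r)))).
  by apply: (@rV_compact _ N (fun=> `[- B, B]%classic)) => _; exact: segment_compact.
have [z1 [z1P z1B _]] := dom z0 z0P.
have ne : box `&` F !=set0 by exists (\row_c z1 c); split; [exact: boxE | exact: FE].
have [v /set_mem[_ vF] vmax] := @EVT_max_rV R N (fun v => \sum_c expr_eval n D (lp_obj c) * v ord0 c)
  (box `&` F) ne cpt (continuous_subspaceT (@linear_continuous _ _)).
exists (v ord0); split; first by move=> r; exact: vF.
move=> z zP; have [z' [z'P z'B zz']] := dom z zP.
apply: le_trans zz' _; rewrite /lp_value -rowE; apply: vmax; apply/mem_set.
by split; [exact: boxE | exact: FE].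
Qed.

End LinearPrograms.

(** * The template of the program and its size *)

Section Template.
Variable m : nat.

Definition expr_zero : expr m := EAdd (EOne m) (EOpp (EOne m)).

Definition add_exprs (s : seq (expr m)) : expr m := foldr (@EAdd m) expr_zero s.

Definition expr_tail (k : 'I_m) : expr m :=
  add_exprs [seq EProb a | a : 'I_m <- enum 'I_m & (k <= a)%N].

Definition expr_one_minus (e : expr m) : expr m := EAdd (EOne m) (EOpp e).

(** The use of [EPow] keeps the size independent of the number of buyers. *)
Definition expr_win (k : 'I_m) : expr m :=
  EMul (expr_one_minus (EPow (expr_one_minus (expr_tail k))))
    (EInv (EMul (EBuyers m) (expr_tail k))).

(* The rows [(j, inl k)] bound the utility of value w_j from below by that of
   bidding w_k; the rows [(k, inr true)] say that the k-th fraction is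
   nonnegative; the rows [(k, inr false)], repeated so that there is no row for
   m = 0, say that the fractions add up to at most 1. *)
Definition reserve_row := ('I_m * ('I_m + bool))%type.

Definition reserve_mat (row : reserve_row) (c : 'I_(m + m)) : expr m :=
  match row.2, fintype.split c with
  | inl k, inl k' =>
      if (k' <= k)%N then EMul (EAdd (EVal row.1) (EOpp (EVal k))) (expr_win k')
      else expr_zero
  | inl k, inr j' => if j' == row.1 then EOpp (EOne m) else expr_zero
  | inr true, inl k' => if k' == row.1 then EOpp (EOne m) else expr_zero
  | inr false, inl k' => EOne m
  | inr _, inr _ => expr_zero
  end.

Definition reserve_rhs (row : reserve_row) : expr m :=
  if row.2 is inr false then EOne m else expr_zero.

(** The coefficient of a level fraction collects the welfare of all values competing at that level,
    by exchanging the sums over levels and values. *)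
Definition reserve_obj (c : 'I_(m + m)) : expr m :=
  match fintype.split c with
  | inl k => EMul (EBuyers m) (EMul (expr_win k)
      (add_exprs [seq EMul (EProb j) (EVal j) | j : 'I_m <- enum 'I_m & (k <= j)%N]))
  | inr j => EOpp (EMul (EBuyers m) (EProb j))
  end.

Definition reserve_lp : lp_template m := {|
  lp_vars := m + m;
  lp_rows := #|{: reserve_row}|;
  lp_obj := reserve_obj;
  lp_mat := fun row => reserve_mat (enum_val row);
  lp_rhs := fun row => reserve_rhs (enum_val row);
  lp_sched := fun k => lshift m k |}.

Lemma add_exprs_size (I : Type) (f : I -> expr m) (s : seq I) (b : nat) :
  (forall x, expr_size (f x) <= b)%N ->
  (expr_size (add_exprs (map f s)) <= size s * b.+1 + 4)%N.
Proof. by move=> fb; elim: s => [|x s IH] //=; have := fb x; move: IH; nia. Qed.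

Lemma size_filter_enum (P : pred 'I_m) : (size [seq x <- enum 'I_m | P x] <= m)%N.
Proof. by rewrite size_filter (leq_trans (count_size _ _)) // size_enum_ord. Qed.

Lemma expr_tail_size k : (expr_size (expr_tail k) <= 2 * m + 4)%N.
Proof.
apply: leq_trans (@add_exprs_size _ (@EProb m) _ 1 (fun=> isT)) _.
by rewrite leq_add2r mulnC leq_mul2l size_filter_enum orbT.
Qed.

Lemma expr_win_size k : (expr_size (expr_win k) <= 4 * m + 19)%N.
Proof. by have := expr_tail_size k; rewrite /expr_win /=; lia. Qed.

Lemma reserve_obj_size c : (expr_size (reserve_obj c) <= 8 * m + 26)%N.
Proof.
rewrite /reserve_obj; case: (fintype.split c) => k /=; last by lia.
have := @add_exprs_size _ (fun j => EMul (EProb j) (EVal j))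
  [seq a : 'I_m <- enum 'I_m | (k <= a)%N] 3 (fun=> isT).
have := leq_mul (size_filter_enum (fun a : 'I_m => (k <= a)%N)) (leqnn 4).
have := expr_win_size k; rewrite /=; set w := expr_size _; set s := size _.
by set t := expr_size _; lia.
Qed.

Lemma reserve_mat_size row c : (expr_size (reserve_mat row c) <= 8 * m + 26)%N.
Proof.
case: row => j [k|[]]; rewrite /reserve_mat /=; case: (fintype.split c) => k' /=;
  try case: ifP => _ /=; try lia.
by have := expr_win_size k'; rewrite /=; lia.
Qed.

Lemma reserve_rhs_size row : (expr_size (reserve_rhs row) <= 4)%N.
Proof. by case: row => j [k|[]]. Qed.

(** The matrix dominates: m (m + 2) rows and 2m columns with entries of length O(m). For m = 0 the
    bound is 0 and the program is empty. *)
Lemma reserve_lp_size : (lp_size reserve_lp <= 400 * m ^ 4)%N.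
Proof.
have sum_bound (N b : nat) (F : 'I_N -> nat) : (forall i, F i <= b)%N ->
    (\sum_(i < N) F i <= N * b)%N.
  by move=> Fb; rewrite -[N in (N * b)%N]card_ord -sum_nat_const leq_sum.
have rows : lp_rows reserve_lp = (m * (m + 2))%N.
  by rewrite /= card_prod card_sum card_bool !card_ord.
have b1 := sum_bound _ _ _ reserve_obj_size.
have b2 : (\sum_(r < lp_rows reserve_lp) \sum_(c < lp_vars reserve_lp)
    expr_size (lp_mat r c) <= (m * (m + 2)) * ((m + m) * (8 * m + 26)))%N.
  rewrite -rows; apply: (sum_bound) => r; apply: (sum_bound) => c.
  exact: reserve_mat_size.
have b3 : (\sum_(r < lp_rows reserve_lp) expr_size (lp_rhs r) <= (m * (m + 2)) * 4)%N.
  by rewrite -rows; apply: sum_bound => r; exact: reserve_rhs_size.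
apply: leq_trans (leq_add (leq_add (leq_add (leq_add (leqnn _) (eq_leq rows)) b1) b2) b3) _.
rewrite /=; have [->|m0] := posnP m; first by rewrite !mul0n.
have m4 : (m ^ 4 = m * (m * (m * m)))%N by rewrite !expnS expn0 muln1.
have m2 : (m <= m * m)%N by rewrite leq_pmulr.
have m3 : (m * m <= m * (m * m))%N by rewrite leq_mul2l m2 orbT.
have m34 : (m * (m * m) <= m * (m * (m * m)))%N by rewrite leq_mul2l m3 orbT.
rewrite m4; nia.
Qed.

End Template.

Section ReserveLP.
Variables (R : realType) (m n : nat) (D : valdist R m).
Hypothesis n0 : (0 < n)%N.

Lemma expr_zeroE : expr_eval n D (expr_zero m) = 0.
Proof. exact: subrr. Qed.

Lemma add_exprsE (I : Type) (f : I -> expr m) (s : seq I) :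
  expr_eval n D (add_exprs (map f s)) = \sum_(x <- s) expr_eval n D (f x).
Proof. by elim: s => [|x s IH]; rewrite /= ?big_nil ?big_cons ?IH ?subrr. Qed.

Lemma add_exprs_tailE (f : 'I_m -> expr m) (k : 'I_m) :
  expr_eval n D (add_exprs [seq f a | a : 'I_m <- enum 'I_m & (k <= a)%N]) =
  \sum_(a < m | (k <= a)%N) expr_eval n D (f a).
Proof. by rewrite add_exprsE big_filter big_enum_cond. Qed.

Lemma expr_winE k : expr_eval n D (expr_win k) = win_prob n D k.
Proof. by rewrite /expr_win /= /expr_tail add_exprs_tailE. Qed.

Lemma expr_mulE e1 e2 :
  expr_eval n D (EMul e1 e2) = expr_eval n D e1 * expr_eval n D e2.
Proof. by []. Qed.

Variable z : 'I_(m + m) -> R.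

Definition lp_fraction (k : 'I_m) : R := z (lshift m k).
Definition lp_utility (j : 'I_m) : R := z (rshift m j).

Lemma reserve_lp_valueE : lp_value n D (L := reserve_lp m) z =
  n%:R * \sum_j prob_of D j * (D j * sched_alloc n D lp_fraction j - lp_utility j).
Proof.
rewrite /lp_value /= big_split_ord /=.
have -> : \sum_(k < m) expr_eval n D (reserve_obj (lshift m k)) * z (lshift m k) =
    n%:R * \sum_j prob_of D j * (D j * sched_alloc n D lp_fraction j).
  transitivity (\sum_(k < m) n%:R * \sum_(j < m)
      (if (k <= j)%N then prob_of D j * D j * (win_prob n D k * lp_fraction k) else 0)).
    apply: eq_bigr => k _.
    rewrite /reserve_obj (unsplitK (inl _ k)) 2!expr_mulE expr_winE add_exprs_tailE.
    by rewrite -big_mkcond -big_distrl /= /lp_fraction; ring.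
  rewrite -big_distrr exchange_big /=; congr (_ * _); apply: eq_bigr => j _.
  rewrite mulrA /sched_alloc big_distrr -big_mkcond /=; apply: eq_bigr => k _.
  by ring.
have -> : \sum_(j < m) expr_eval n D (reserve_obj (rshift m j)) * z (rshift m j) =
    - (n%:R * \sum_j prob_of D j * lp_utility j).
  rewrite big_distrr -sumrN; apply: eq_bigr => j _.
  by rewrite /reserve_obj (unsplitK (inr _ j)) /= /lp_utility; ring.
rewrite -mulrBr -sumrB; congr (_ * _); apply: eq_bigr => j _; ring.
Qed.

Lemma reserve_lp_feasibleP : lp_feasible n D (L := reserve_lp m) z <->
  [/\ forall j k, (D j - D k) * sched_alloc n D lp_fraction k <= lp_utility j,
      forall k, 0 <= lp_fraction k & \sum_k lp_fraction k <= 1].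
Proof.
have rowE (row : reserve_row m) :
  \sum_c expr_eval n D (reserve_mat row c) * z c =
  match row.2 with
  | inl k => (D row.1 - D k) * sched_alloc n D lp_fraction k - lp_utility row.1
  | inr true => - lp_fraction row.1
  | inr false => \sum_k lp_fraction k
  end.
  rewrite big_split_ord /=; case: row => j [k|[]] /=.
  - congr (_ + _).
      rewrite /sched_alloc big_distrr [RHS]big_mkcond /=; apply: eq_bigr => k' _.
      rewrite /reserve_mat (unsplitK (inl _ k')) [(_, _).2]/=.
      case: ifP => _; last by rewrite expr_zeroE mul0r.
      by rewrite expr_mulE expr_winE /= /lp_fraction; ring.
    rewrite (bigD1 j) //= big1 ?addr0.
      by rewrite /reserve_mat (unsplitK (inr _ j)) /= eqxx mulN1r.
    move=> j' /negPf jj'.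
    by rewrite /reserve_mat (unsplitK (inr _ j')) /= jj' expr_zeroE mul0r.
  - rewrite [X in _ + X]big1 ?addr0; last first.
      by move=> k _; rewrite /reserve_mat (unsplitK (inr _ k)) expr_zeroE mul0r.
    rewrite (bigD1 j) //= big1 ?addr0.
      by rewrite /reserve_mat (unsplitK (inl _ j)) /= eqxx mulN1r.
    move=> j' /negPf jj'.
    by rewrite /reserve_mat (unsplitK (inl _ j')) /= jj' expr_zeroE mul0r.
  - rewrite [X in _ + X]big1 ?addr0; last first.
      by move=> k _; rewrite /reserve_mat (unsplitK (inr _ k)) expr_zeroE mul0r.
    by apply: eq_bigr => k _; rewrite /reserve_mat (unsplitK (inl _ k)) mul1r.
have rhsE (row : reserve_row m) : expr_eval n D (reserve_rhs row) =
    if row.2 is inr false then 1 else 0.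
  by case: row => j [k|[]]; rewrite /reserve_rhs ?expr_zeroE.
have allP : lp_feasible n D (L := reserve_lp m) z <-> forall row : reserve_row m,
    \sum_c expr_eval n D (reserve_mat row c) * z c <= expr_eval n D (reserve_rhs row).
  split=> [zP row|zP i]; last exact: zP.
  by have := zP (enum_rank row); rewrite /= enum_rankK.
apply: iff_trans allP _; split=> [zP|[zU z0 z1] [j [k|[]]]]; last first.
- by rewrite rowE rhsE.
- by rewrite rowE rhsE oppr_le0.
- by rewrite rowE rhsE subr_le0.
split=> [j k|k|].
- by have := zP (j, inl k); rewrite rowE rhsE subr_le0.
- by have := zP (k, inr true); rewrite rowE rhsE oppr_le0.
- by have := zP (some_value D, inr false); rewrite rowE rhsE.
Qed.

End ReserveLP.

Definition lp_point (R : Type) (m : nat) (l u : 'I_m -> R) (c : 'I_(m + m)) : R :=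
  match fintype.split c with inl k => l k | inr j => u j end.

Lemma lp_fraction_point (R : realType) m (l u : 'I_m -> R) :
  lp_fraction (lp_point l u) = l.
Proof. by apply: funext => k; rewrite /lp_fraction /lp_point (unsplitK (inl _ k)). Qed.

Lemma lp_utility_point (R : realType) m (l u : 'I_m -> R) :
  lp_utility (lp_point l u) = u.
Proof. by apply: funext => k; rewrite /lp_utility /lp_point (unsplitK (inr _ k)). Qed.

Section Optimum.
Variables (R : realType) (m n : nat) (D : valdist R m).
Hypothesis n0 : (0 < n)%N.

(** Utilities are unbounded above but count negatively, and no constraint forces one above 1;
    capping them at 1 stays feasible and does not lower the value. *)
Lemma reserve_lp_optimum : exists z, lp_optimal n D (L := reserve_lp m) z.
Proof.
apply: (@lp_optimum_exists R m n D (reserve_lp m) 1 (lp_point (fun=> 0) (fun=> 0))).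
  apply/reserve_lp_feasibleP; rewrite lp_fraction_point lp_utility_point; split=> //.
    move=> j k; rewrite /sched_alloc big1 ?mulr0 // => a _; exact: mul0r.
  by rewrite big1 ?ler01.
move=> z /reserve_lp_feasibleP [zU z0 z1].
have zU0 j : 0 <= lp_utility z j by have := zU j j; rewrite subrr mul0r.
exists (lp_point (lp_fraction z) (fun j => Num.min (lp_utility z j) 1)); split.
- apply/reserve_lp_feasibleP; rewrite lp_fraction_point lp_utility_point; split=> //.
  move=> j k; rewrite le_min zU /=.
  have x0 := sched_alloc_ge0 D k n0 z0; have x1 := sched_alloc_le1 D k n0 z0 z1.
  have := val_ge0 D k; have := val_le1 D j; have := val_ge0 D j; nra.
- move=> c; rewrite /lp_point; case: (fintype.split c) => k.
    rewrite ger0_norm //; apply: le_trans z1.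
    by rewrite (bigD1 k) //= lerDl sumr_ge0.
  by rewrite ger0_norm ?le_min ?zU0 ?ler01 // ge_min lexx orbT.
rewrite !reserve_lp_valueE lp_fraction_point lp_utility_point ler_wpM2l //.
apply: ler_sum => j _; rewrite ler_wpM2l ?(ltW (prob_gt0 D j)) // lerD2l lerN2.
by rewrite ge_min lexx.
Qed.

(** With l fixed, c is the best deviation for l; its utilities complete l to a feasible point whose
    value is the bound of [revenue_le_sched] up to the tolerance. *)
Lemma pyb_revenue_le_lp z rev : lp_optimal n D (L := reserve_lp m) z ->
  pyb_declining_revenues n D rev -> rev <= lp_value n D (L := reserve_lp m) z.
Proof.
move=> [_ zopt] [A [r [x [y [u [pybA uniA fA ->]]]]]].
apply/ler_addgt0Pr => e e0.
have [l [l0 l1 le_l]] := revenue_le_sched pybA uniA n0 fA e0.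
pose v j (k : 'I_m) := (D j - D k) * sched_alloc n D l k.
pose c (j : 'I_m) := [arg max_(k > j | (k <= j)%N) v j k]%O.
have cP j : (c j <= j)%N /\ forall k : 'I_m, (k <= j)%N -> v j k <= v j (c j).
  by rewrite /c; case: Order.TotalTheory.arg_maxP.
apply: le_trans (le_l c (fun j => (cP j).1)) _; rewrite lerD2r.
apply: le_trans (zopt (lp_point l (fun j => v j (c j))) _).
  rewrite reserve_lp_valueE lp_fraction_point lp_utility_point /sched_revenue.
  by rewrite lexx.
apply/reserve_lp_feasibleP; rewrite lp_fraction_point lp_utility_point; split=> // j k.
(* A deviation above the value is no better than bidding the value, which earns 0. *)
case: (leqP k j) => kj; first exact: (cP j).2.
apply: le_trans (_ : v j j <= _); last by apply: (cP j).2.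
rewrite /v subrr mul0r mulr_le0_ge0 ?sched_alloc_ge0 // subr_le0 ltW //.
exact: val_lt.
Qed.

Lemma reserve_lp_finds : lp_finds_optimal_auction n D (reserve_lp m).
Proof.
split; first exact: reserve_lp_optimum.
move=> z zopt; have [zU z0 z1] := (reserve_lp_feasibleP n D z).1 zopt.1.
have approx eps : 0 < eps -> exists (A : auction n D) (r : nat -> nat -> R) (x y u : 'I_m -> R),
    [/\ pay_your_bid A, uniform_declining_reserve A r, feasible A x y u,
        reserve_schedule D r (lp_fraction z) &
        lp_value n D (L := reserve_lp m) z - eps <= revenue n D x u].
  move=> e0; rewrite reserve_lp_valueE.
  exact: sched_auction_revenue.
split; last exact: approx.
apply: le_anti; apply/andP; split.
  apply: ge_ereal_sup => _ [rev revP <-]; rewrite lee_fin.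
  exact: pyb_revenue_le_lp.
apply/lee_addgt0Pr => e e0.
have [A [r [x [y [u [pybA uniA fA _ rev_ge]]]]]] := approx e e0.
apply: (@le_trans _ _ ((revenue n D x u)%:E + e%:E)%E).
  by rewrite -EFinD lee_fin -lerBlDr.
rewrite leeD2r //; apply: ereal_sup_ubound; exists (revenue n D x u) => //.
by exists A, r, x, y, u.
Qed.

End Optimum.

(** * Separation for two buyers *)

Section Dominant.
Variables (R : realType) (n m : nat) (D : valdist R m) (A : auction n D).

Notation K := (arms A).
Notation strat := (strategy R n m K).
Notation round := ({ffun 'I_n -> 'I_m} * bids n K)%type.

Definition truthful (v : {ffun 'I_n -> 'I_m}) : bids n K := [ffun i => val_arm A (v i)].

Variables (delta : R) (x y u : 'I_m -> R).
Hypothesis delta0 : 0 < delta.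
Hypothesis label_le1 : forall k, label A k <= 1.
Hypothesis dominant : forall T t i a k b, label A k <= D a -> k != val_arm A a ->
  utility T t i (D a) k b + delta <= utility T t i (D a) (val_arm A a) b.
Hypothesis xE : forall T t i j,
  Evals D (fun v => (v i == j)%:R * alloc A T t (truthful v) i) = prob_of D j * x j.
Hypothesis yE : forall T t i j,
  Evals D (fun v => alloc A T t (deviate (truthful v) i (val_arm A j)) i) = y j.
Hypothesis uE : forall T t i j,
  Evals D (fun v => (v i == j)%:R * utility T t i (D j) (val_arm A j) (truthful v)) =
  prob_of D j * u j.

Definition untruthful (h : seq round) (e : round) : R :=
  \sum_(i < n) (e.2 i != val_arm A (e.1 i))%:R.

Lemma untruthful_cases h e : 1 <= untruthful h e \/ e.2 = truthful e.1.
Proof.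
have [i ti|tt] := pickP (fun i => e.2 i != val_arm A (e.1 i)).
  by left; rewrite /untruthful (bigD1 i) //= ti lerDl sumr_ge0.
by right; apply/ffunP => i; rewrite ffunE; have /negbFE/eqP := tt i.
Qed.

Lemma untruthful_ge0 h e : 0 <= untruthful h e.
Proof. by rewrite sumr_ge0. Qed.

(** After t rounds the truthful arm leads by at least t [delta]. Beyond round gT/[delta] each other
    arm has probability at most g; the earlier rounds are charged in full. *)
Lemma untruthful_bound T g (S : 'I_n -> strat) : 0 <= g ->
    (forall i, never_overbids (S i)) -> (forall i, mean_based T g i (S i)) ->
  Ex S T (cum untruthful) <= n%:R * (K%:R + 2 / delta + 1) * (g * T%:R + 1).
Proof.
move=> g0 over mean; have gT0 : 0 <= g * T%:R by rewrite mulr_ge0.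
apply: le_trans (_ : \sum_(t < T) (n%:R * (K%:R * g + (`|t%:R * delta| <= g * T%:R)%R%:R)) <= _).
  rewrite -(Ex_cum_time S T (fun t => n%:R * (K%:R * g + (`|t%:R * delta| <= g * T%:R)%R%:R))).
  apply: Ex_cum_le => h hT; rewrite Estep_const /untruthful (Estep_sum S h predT).
  rewrite -[n in n%:R * _]card_ord mulr_natl -sumr_const; apply: ler_sum => i _.
  rewrite (Estep_own S h i (fun a k => (k != val_arm A a)%:R)).
  rewrite -[leRHS]mul1r -[X in _ <= X * _](prob_sum1 D) big_distrl /=.
  apply: ler_sum => a _; rewrite ler_wpM2l ?(ltW (prob_gt0 _ _)) //.
  rewrite ger0_norm ?mulr_ge0 ?(ltW delta0) //.
  case: (leP ((size h)%:R * delta) (g * T%:R)) => [_|late] /=.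
    apply: le_trans (_ : \sum_k pull_after S h i a k <= _); last first.
      by rewrite pull_after_sum1; have := mulr_ge0 (ler0n R K) g0; lra.
    apply: ler_sum => k _; rewrite ler_piMr ?pull_after_ge0 //.
    by rewrite lern1 leq_b1.
  rewrite addr0; have -> : K%:R * g = \sum_(k < K) g by rewrite sumr_const card_ord mulr_natl.
  apply: ler_sum => k _; case: eqP => [_|/eqP kn] /=; first by rewrite mulr0.
  rewrite mulr1; have [ka|ak] := leP (label A k) (D a); last first.
    by rewrite /pull_after over.
  have va : label A (val_arm A a) <= D a by rewrite label_val.
  apply: (mean i _ _ _ _ _ _ _ ka va); rewrite ?size_map //.
  have gap : cumul_utility T i k (D a) (bids_of h) + (size h)%:R * delta <=
      cumul_utility T i (val_arm A a) (D a) (bids_of h).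
    elim/last_ind: (h) => [|h' e IH].
      by rewrite !cumul_utility_nil mul0r addr0.
    rewrite /bids_of map_rcons !cumul_utility_rcons size_map size_rcons -natr1 mulrDl mul1r.
    by have := dominant T (size h') i e.2 ka kn; move: IH; rewrite /bids_of; lra.
  by rewrite -/(bids_of h); lra.
rewrite -big_distrr /= -mulrA ler_wpM2l // big_split /= sumr_const card_ord.
have band := @count_in_band R (fun t => t%:R * delta) predT delta (g * T%:R) T delta0 gT0.
have {}band : \sum_(t < T) (`|t%:R * delta| <= g * T%:R)%R%:R <= 2 * (g * T%:R) / delta + 1.
  by apply: band => // s _ _; rewrite -natr1 mulrDl mul1r.
have d0 : 0 <= 2 / delta by rewrite divr_ge0 // ltW.
apply: le_trans (lerD (lexx _) band) _.
have K0 : 0 <= K%:R :> R by [].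
by rewrite -[_ *+ T]mulr_natr; lra.
Qed.

Lemma utility_norm T t (i : 'I_n) (a : 'I_m) (k : 'I_K) b : `|utility T t i (D a) k b| <= 1.
Proof.
rewrite ler_norml utility_le1 andbT /utility.
have := pay_le T t (deviate b i k) i; rewrite ffunE eqxx.
have := alloc_ge0 T t (deviate b i k) i; have := alloc_le1 T t (deviate b i k) i.
by have := val_ge0 D a; have := label_ge0 k; have := label_le1 k; nra.
Qed.

Lemma dominant_feasible : feasible A x y u.
Proof.
pose Q : R := \sum_(j < m) (prob_of D j)^-1.
pose N : R := n%:R * (K%:R + 2 / delta + 1).
(* Utilities can be negative on overbids, hence the factor 2 for U; Q pays for the division by q_j,
   and N alone serves Y. *)
apply: (@feasible_of_bounds _ _ _ _ _ _ _ _ (2 * N * Q + N)) => T g S i j T0 g0 over mean /=.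
set w := g + (Num.sqrt T%:R)^-1.
have T0' : 0 < T%:R :> R by rewrite ltr0n.
have s1 : 1 <= Num.sqrt (T%:R : R) by rewrite -[leLHS]sqrtr1 ler_wsqrtr // (ler_nat _ 1).
have s0 := lt_le_trans ltr01 s1.
have s2 : T%:R = Num.sqrt (T%:R : R) ^+ 2 by rewrite sqr_sqrtr ?ler0n.
have q0 := prob_gt0 D j.
have q'0 a : 0 <= (prob_of D a)^-1 by rewrite invr_ge0 ltW ?prob_gt0.
have qQ : (prob_of D j)^-1 <= Q by rewrite /Q (bigD1 j) //= lerDl sumr_ge0.
have w0 : 0 <= w by rewrite addr_ge0 // invr_ge0 ltW.
have N0 : 0 <= N.
  by rewrite /N mulr_ge0 // !addr_ge0 // divr_ge0 // ltW.
have Q0 := le_trans (q'0 j) qQ.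
have err : T%:R^-1 * Ex S T (cum untruthful) <= N * w.
  apply: le_trans (ler_wpM2l _ (untruthful_bound g0 over mean)) _.
    by rewrite invr_ge0 ltW.
  rewrite -/N mulrCA ler_wpM2l // mulrDr mulr1 mulrCA mulVf ?gt_eqF // mulr1 lerD2l.
  rewrite [in leLHS]s2 expr2 invfM ler_piMl ?invr_ge0 ?(ltW s0) // invf_le1 //.
have Nw := mulr_ge0 N0 w0.
have NQw := mulr_ge0 (mulr_ge0 N0 Q0) w0.
have close (c : R) (f : seq round -> round -> R) (G : nat -> {ffun 'I_n -> 'I_m} -> R) X :
    0 <= c -> (forall h e, `|f h e - G (size h) e.1| <= c * untruthful h e) ->
    (forall t, Evals D (G t) = X) ->
    `|T%:R^-1 * Ex S T (cum f) - X| <= c * (N * w).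
  move=> c0 fG GX; rewrite -[X in _ - X](mulKf (lt0r_neq0 T0')) -mulrBr normrM.
  rewrite ger0_norm ?invr_ge0 ?(ltW T0') //.
  have -> : T%:R * X = Ex S T (cum (fun h e => G (size h) e.1)).
    rewrite mulr_natl -[T in LHS]card_ord -sumr_const -(Ex_cum_time S T (fun=> X)).
    apply: Ex_cum_eq => h _; rewrite Estep_const (Estep_vals S h (G (size h))).
    by rewrite GX.
  apply: le_trans (ler_wpM2l _ (Ex_cum_close S (fun h e _ => fG h e))) _.
    by rewrite invr_ge0 ltW.
  rewrite (_ : Ex S T _ = c * Ex S T (cum untruthful)); last first.
    by rewrite -ExZ; apply: eq_Ex => h _; rewrite cumZ.
  by rewrite mulrCA ler_wpM2l.
have scale a b c : 0 <= c -> `|T%:R^-1 * a - prob_of D j * b| <= c * (N * w) ->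
    `|T%:R^-1 * (a / prob_of D j) - b| <= c * (N * Q * w).
  move=> c0 ab; rewrite mulrA -[b in _ - b](mulKf (lt0r_neq0 q0)).
  rewrite [X in _ - X]mulrC -mulrBl normrM [X in _ * X]ger0_norm //.
  have -> : c * (N * Q * w) = c * (N * w) * Q by ring.
  by apply: ler_pM => //; rewrite ?mulr_ge0.
have dist1 (b1 b2 : R) : 0 <= b1 <= 1 -> 0 <= b2 <= 1 -> `|b1 - b2| <= 1.
  by rewrite ler_norml; lra.
have alloc01 T' t b i' : 0 <= alloc A T' t b i' <= 1 by rewrite alloc_ge0 alloc_le1.
split.
- rewrite avgXE; apply: le_trans (scale _ _ 1 ler01 _) _; last by nra.
  apply: (close 1 _ (fun t v => (v i == j)%:R * alloc A T t (truthful v) i)) => // h e.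
  rewrite mul1r -mulrBr; case: (untruthful_cases h e) => [n1|->]; last first.
    by rewrite subrr mulr0 normr0 untruthful_ge0.
  apply: le_trans n1; case: (_ == _); rewrite ?mul0r ?normr0 ?ler01 // mul1r.
  exact: dist1.
- rewrite avgYE; apply: le_trans (_ : 1 * (N * w) <= _); last by nra.
  apply: (close 1 _ (fun t v => alloc A T t (deviate (truthful v) i (val_arm A j)) i)) => // h e.
  rewrite mul1r; case: (untruthful_cases h e) => [n1|->]; last first.
    by rewrite subrr normr0 untruthful_ge0.
  by apply: le_trans n1; exact: dist1.
rewrite avgUE; apply: le_trans (scale _ _ 2 _ _) _ => //; last by nra.
apply: (close 2 _ (fun t v => (v i == j)%:R *
  utility T t i (D j) (val_arm A j) (truthful v))) => // h e.
rewrite -mulrBr; case: (untruthful_cases h e) => [n1|->]; last first.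
  rewrite ffunE; case: eqP => [<-|_]; last by rewrite mul0r normr0 mulr_ge0 ?untruthful_ge0.
  by rewrite subrr mulr0 normr0 mulr_ge0 ?untruthful_ge0.
apply: le_trans (_ : 2 * 1 <= _); last by rewrite ler_wpM2l.
case: (_ == _); last by rewrite mul0r normr0 mulr1.
have := utility_norm T (size h) i j (e.2 i) e.2.
have := utility_norm T (size h) i j (val_arm A j) (truthful e.1).
by rewrite mul1r !ler_norml; lra.
Qed.

End Dominant.

Section TwoBuyers.
Variable R : realType.

Definition two_values (j : 'I_2) : R := if j == ord0 then 3 / 4 else 1.

Let two_values_ge0 j : 0 <= two_values j.
Proof. by rewrite /two_values; case: ifP => _; lra. Qed.

Let two_values_le1 j : two_values j <= 1.
Proof. by rewrite /two_values; case: ifP => _; lra. Qed.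

Let two_values_lt (j k : 'I_2) : (j < k)%N -> two_values j < two_values k.
Proof.
move=> jk; have k2 := ltn_ord k; rewrite /two_values -!(inj_eq val_inj) /=.
have -> : j == 0%N :> nat by lia.
have -> : (k == 0%N :> nat) = false by lia.
lra.
Qed.

Let half_gt0 (j : 'I_2) : 0 < 1 / 2 :> R.
Proof. by lra. Qed.

Let half_sum : \sum_(j < 2) (1 / 2) = 1 :> R.
Proof. by rewrite !big_ord_recl big_ord0; lra. Qed.

Definition two_dist : valdist R 2 :=
  ValDist two_values_ge0 two_values_le1 two_values_lt half_gt0 half_sum.

(** Always bidding the lower value is deviation enough: with it the bound becomes 3/4 times the sum
    of the two fractions, so all full schedules tie. *)
Lemma two_dist_pyb_le rev : pyb_declining_revenues 2 two_dist rev -> rev <= 3 / 4.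
Proof.
move=> [A [r [x [y [u [pybA uniA fA ->]]]]]].
apply/ler_addgt0Pr => e e0.
have [l [l0 l1 le_l]] := revenue_le_sched pybA uniA isT fA e0.
apply: le_trans (le_l (fun=> ord0) (fun=> isT)) _; rewrite lerD2r.
have w0 : win_prob 2 two_dist ord0 = 1 / 2.
  by rewrite /win_prob !(big_ord_recl, big_ord0) /=; field.
have w1 : win_prob 2 two_dist (lift ord0 ord0) = 3 / 4.
  rewrite /win_prob big_mkcond !(big_ord_recl, big_ord0) /=.
  by field.
move: l1; rewrite !(big_ord_recl, big_ord0) /= => l1.
have x0 : sched_alloc 2 two_dist l ord0 = l ord0 * (1 / 2).
  by rewrite /sched_alloc big_mkcond !(big_ord_recl, big_ord0) /= w0; ring.
have x1 : sched_alloc 2 two_dist l (lift ord0 ord0) =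
    l ord0 * (1 / 2) + l (lift ord0 ord0) * (3 / 4).
  by rewrite /sched_alloc big_mkcond !(big_ord_recl, big_ord0) /= w0 w1; ring.
rewrite /sched_revenue !(big_ord_recl, big_ord0) x0 x1 /= /two_values /=.
lra.
Qed.

Let ord3_cases (k : 'I_3) : [\/ nat_of_ord k = 0%N, nat_of_ord k = 1%N | nat_of_ord k = 2%N].
Proof.
by case: k => [[|[|[|k]]] lt3] //; [constructor 1 | constructor 2 | constructor 3].
Qed.

(* The prices leave value w_1 a margin of 1/32 per unit of allocation and give
   value w_2 exactly 1/32 more than it would get from the arm w_1, so that the
   arm of one's own value is strictly dominant. *)
Definition arm_label (k : 'I_3) : R :=
  match nat_of_ord k with 0%N => 0 | 1%N => 3 / 4 | _ => 1 end.

(** Without price margins, a share s for the higher of the two value arms would yield 5/8 + s/4,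
    above 3/4 once s > 1/2. Keeping s below 1 leaves the arm of w_1 a positive chance against every
    rival, as strict dominance requires. *)
Definition arm_alloc (k k' : nat) : R :=
  match k, k' with
  | 0%N, _ => 0
  | 1%N, 2 => 1 / 4
  | 1%N, _ => 1 / 2
  | _, 0%N => 1
  | _, 1%N => 3 / 4
  | _, _ => 1 / 2
  end.

(** Here 23/32 = 3/4 - 1/32, and 9/32 = 1 - 23/32 is what value 1 earns per unit won at the arm of
    w_1. *)
Definition arm_pay (k k' : nat) : R :=
  match k with
  | 0%N => 0
  | 1%N => 23 / 32 * arm_alloc 1 k'
  | _ => arm_alloc 2 k' - 9 / 32 * arm_alloc 1 k' - 1 / 32
  end.

Definition duel_alloc (T t : nat) (b : bids 2 3) (i : 'I_2) : R :=
  arm_alloc (b i) (b (rev_ord i)).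

Definition duel_pay (T t : nat) (b : bids 2 3) (i : 'I_2) : R :=
  arm_pay (b i) (b (rev_ord i)).

Definition arm_of_value (j : 'I_2) : 'I_3 := lift ord0 j.

Let rev_neq (i : 'I_2) : (rev_ord i == i) = false.
Proof. by rewrite -(inj_eq val_inj) /=; have := ltn_ord i; lia. Qed.

Let neq_rev (i l : 'I_2) : l != i -> l = rev_ord i.
Proof.
rewrite -(inj_eq val_inj) => li; apply/val_inj => /=.
by have := ltn_ord i; have := ltn_ord l; move: li => /=; lia.
Qed.

Let rev_perm (s : {perm 'I_2}) (i : 'I_2) : s (rev_ord i) = rev_ord (s i).
Proof. by apply: neq_rev; rewrite (inj_eq perm_inj) rev_neq. Qed.

Let arm_label_inj : injective arm_label.
Proof.
move=> [[|[|[|k]]] kP] [[|[|[|k']]] kP'] //; rewrite /arm_label /= => E;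
  first [exact: val_inj | exfalso; lra].
Qed.

Let arm_label_ge0 k : 0 <= arm_label k.
Proof. by rewrite /arm_label; case: (ord3_cases k) => ->; lra. Qed.

Let arm_label_le1 k : arm_label k <= 1.
Proof. by rewrite /arm_label; case: (ord3_cases k) => ->; lra. Qed.

Let arm_label_zero : arm_label ord0 = 0. Proof. by []. Qed.

Let arm_label_val j : arm_label (arm_of_value j) = two_dist j.
Proof.
rewrite /arm_label /= /two_values -(inj_eq val_inj) /=.
by case: j => [[|[|l]] lt2] //=.
Qed.

Let duel_alloc_ge0 T t b i : 0 <= duel_alloc T t b i.
Proof.
by rewrite /duel_alloc; case: (ord3_cases (b i)) => ->; case: (ord3_cases (b (rev_ord i))) => -> /=; lra.
Qed.

Let duel_alloc_le1 T t b i : duel_alloc T t b i <= 1.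
Proof.
by rewrite /duel_alloc; case: (ord3_cases (b i)) => ->; case: (ord3_cases (b (rev_ord i))) => -> /=; lra.
Qed.

Let duel_alloc_sum T t b : \sum_(i < 2) duel_alloc T t b i <= 1.
Proof.
rewrite !big_ord_recl big_ord0 /duel_alloc.
have -> : rev_ord (lift ord0 ord0) = ord0 :> 'I_2 by exact: val_inj.
have -> : rev_ord ord0 = lift ord0 ord0 :> 'I_2 by exact: val_inj.
by case: (ord3_cases (b ord0)) => ->; case: (ord3_cases (b (lift ord0 ord0))) => -> /=; lra.
Qed.

Let duel_pay_ge0 T t b i : 0 <= duel_pay T t b i.
Proof.
by rewrite /duel_pay; case: (ord3_cases (b i)) => ->; case: (ord3_cases (b (rev_ord i))) => -> /=; lra.
Qed.

Let duel_pay_le T t b i : duel_pay T t b i <= arm_label (b i) * duel_alloc T t b i.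
Proof.
rewrite /duel_pay /duel_alloc /arm_label.
by case: (ord3_cases (b i)) => ->; case: (ord3_cases (b (rev_ord i))) => -> /=; lra.
Qed.

Let duel_alloc_perm T t (s : {perm 'I_2}) b i :
  duel_alloc T t (permute_bids s b) i = duel_alloc T t b (s i).
Proof. by rewrite /duel_alloc !ffunE rev_perm. Qed.

Let duel_pay_perm T t (s : {perm 'I_2}) b i :
  duel_pay T t (permute_bids s b) i = duel_pay T t b (s i).
Proof. by rewrite /duel_pay !ffunE rev_perm. Qed.

Let duel_alloc_deviate T t b i k :
  duel_alloc T t (deviate b i k) i = arm_alloc k (b (rev_ord i)).
Proof. by rewrite /duel_alloc !ffunE eqxx rev_neq. Qed.

Let duel_pay_deviate T t b i k :
  duel_pay T t (deviate b i k) i = arm_pay k (b (rev_ord i)).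
Proof. by rewrite /duel_pay !ffunE eqxx rev_neq. Qed.

Let duel_alloc_mono T t b i k k' : arm_label k <= arm_label k' ->
  duel_alloc T t (deviate b i k) i <= duel_alloc T t (deviate b i k') i.
Proof.
rewrite !duel_alloc_deviate /arm_label.
by case: (ord3_cases k) => ->; case: (ord3_cases k') => ->; case: (ord3_cases (b (rev_ord i))) => -> /=; lra.
Qed.

Let duel_pay_mono T t b i k k' : arm_label k <= arm_label k' ->
  duel_pay T t (deviate b i k) i <= duel_pay T t (deviate b i k') i.
Proof.
rewrite !duel_pay_deviate /arm_label.
by case: (ord3_cases k) => ->; case: (ord3_cases k') => ->; case: (ord3_cases (b (rev_ord i))) => -> /=; lra.
Qed.

Definition duel : auction 2 two_dist := Auction arm_label_inj arm_label_ge0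
  arm_label_zero arm_label_val duel_alloc_ge0 duel_alloc_le1 duel_alloc_sum
  duel_pay_ge0 duel_pay_le duel_alloc_perm duel_pay_perm duel_alloc_mono duel_pay_mono.

Definition duel_x (j : 'I_2) : R := if j == ord0 then 3 / 8 else 5 / 8.
Definition duel_u (j : 'I_2) : R := if j == ord0 then 3 / 256 else 35 / 256.

Let Evals_rival (i : 'I_2) (f : 'I_2 -> R) (F : 'I_2 -> R) :
  Evals two_dist (fun v : {ffun 'I_2 -> 'I_2} => f (v i) * F (v (rev_ord i))) =
  (\sum_a 1 / 2 * f a) * (1 / 2 * F ord0 + 1 / 2 * F (lift ord0 ord0)).
Proof.
rewrite (Evals_coord two_dist f); last by move=> v a; rewrite ffunE rev_neq.
congr (_ * _); transitivity (Evals two_dist (fun v : {ffun 'I_2 -> 'I_2} =>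
  F (v (rev_ord i)) * 1)); first by apply: eq_bigr => v _; rewrite mulr1.
rewrite (Evals_coord two_dist F) // Evals_const mulr1.
by rewrite !big_ord_recl big_ord0 addr0.
Qed.

Let sum_indicator (j : 'I_2) : \sum_a 1 / 2 * (a == j)%:R = 1 / 2 :> R.
Proof.
by rewrite (bigD1 j) //= eqxx mulr1 big1 ?addr0 // => a /negPf ->; rewrite mulr0.
Qed.

Lemma duel_feasible : feasible duel duel_x duel_x duel_u.
Proof.
(* The least margin is that of w_1 against a rival on the top arm: 1/32 times the allocation 1/4. *)
have d0 : 0 < 1 / 128 :> R by lra.
apply: (@dominant_feasible R 2 2 two_dist duel (1 / 128)) => //.
- move=> T t i a k b; rewrite /utility /= !duel_alloc_deviate !duel_pay_deviate.
  rewrite /arm_label /two_values -!(inj_eq val_inj) /=.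
  case: a => [[|[|l]] lt2] //=; case: (ord3_cases k) => -> //=; case: (ord3_cases (b (rev_ord i))) => -> /=; lra.
- move=> T t i j; transitivity (Evals two_dist (fun v : {ffun 'I_2 -> 'I_2} =>
    (v i == j)%:R * arm_alloc (arm_of_value j) (arm_of_value (v (rev_ord i))))).
    apply: eq_bigr => v _; congr (_ * _); rewrite /= /duel_alloc !ffunE.
    by case: eqP => [->|_]; rewrite ?mul0r.
  rewrite (Evals_rival i (fun a => (a == j)%:R)
    (fun a => arm_alloc (arm_of_value j) (arm_of_value a))) sum_indicator /=; congr (_ * _).
  rewrite /duel_x -(inj_eq val_inj) /=; case: j => [[|[|l]] lt2] //=; lra.
- move=> T t i j; transitivity (Evals two_dist (fun v : {ffun 'I_2 -> 'I_2} =>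
    1 * arm_alloc (arm_of_value j) (arm_of_value (v (rev_ord i))))).
    apply: eq_bigr => v _; congr (_ * _).
    by rewrite /= duel_alloc_deviate ffunE mul1r.
  rewrite (Evals_rival i (fun=> 1)
    (fun a => arm_alloc (arm_of_value j) (arm_of_value a))) !big_ord_recl big_ord0.
  rewrite /duel_x -(inj_eq val_inj) /=; case: j => [[|[|l]] lt2] //=; lra.
move=> T t i j; transitivity (Evals two_dist (fun v : {ffun 'I_2 -> 'I_2} =>
  (v i == j)%:R * (two_dist j * arm_alloc (arm_of_value j) (arm_of_value (v (rev_ord i))) -
    arm_pay (arm_of_value j) (arm_of_value (v (rev_ord i)))))).
  apply: eq_bigr => v _; congr (_ * (_ * _)).
  by rewrite /utility /= duel_alloc_deviate duel_pay_deviate ffunE.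
rewrite (Evals_rival i (fun a => (a == j)%:R) (fun a =>
  two_dist j * arm_alloc (arm_of_value j) (arm_of_value a) -
  arm_pay (arm_of_value j) (arm_of_value a))) sum_indicator /=; congr (_ * _).
rewrite /duel_u /two_values -(inj_eq val_inj) /=; case: j => [[|[|l]] lt2] //=; lra.
Qed.

Lemma duel_revenue : revenue 2 two_dist duel_x duel_u = 97 / 128.
Proof.
rewrite /revenue !(big_ord_recl, big_ord0) /= /two_values /duel_x /duel_u /=.
lra.
Qed.

Lemma feasible_beats_pyb :
  (optimal_pyb_declining_revenue 2 two_dist < optimal_feasible_revenue 2 two_dist)%E.
Proof.
apply: (@le_lt_trans _ _ (3 / 4)%:E).
  by apply: ge_ereal_sup => _ [rev revP <-]; rewrite lee_fin two_dist_pyb_le.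
apply: (@lt_le_trans _ _ (97 / 128)%:E); first by rewrite lte_fin; lra.
apply: ereal_sup_ubound; exists (97 / 128) => //.
exists duel, duel_x, duel_x, duel_u; split; first exact: duel_feasible.
by rewrite duel_revenue.
Qed.

End TwoBuyers.

Theorem theorem21 (R : realType) :
  (exists c d : nat, forall m : nat, exists L : lp_template m,
     (lp_size L <= c * m ^ d)%N /\
     forall (n : nat) (D : valdist R m), (0 < n)%N ->
       lp_finds_optimal_auction n D L) /\
  (exists (m : nat) (D : valdist R m),
     (optimal_pyb_declining_revenue 2 D < optimal_feasible_revenue 2 D)%E).
Proof.
split; last by exists 2, (two_dist R); exact: feasible_beats_pyb.
exists 400, 4 => m; exists (reserve_lp m); split; first exact: reserve_lp_size.
by move=> n D n0; exact: reserve_lp_finds.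
Qed.
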